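(* Let $\ell\ge 3$ be an integer. Every graph that contains neither a twisted $\ell$-prism nor the $4\times 4$ grid as a minor has treewidth at most $2\ell+10$.
   Context: Graphs are finite and simple. A twisted $\ell$-prism is a graph that consists of two vertex-disjoint cycles of length $\ell$ joined by a matching of size $\ell$ (i.e. a perfect matching between the vertex sets of the two cycles, given by an arbitrary bijection). ''Contains no twisted $\ell$-prism as a minor'' means that no minor of the graph is isomorphic to any twisted $\ell$-prism. The $4\times4$ grid is the Cartesian product of two paths on $4$ vertices. *)

(* Defs.v *)
From HB Require Import structures.
From mathcomp Require Import all_boot all_fingroup.
From mathcomp Require Import boolp.

Set Implicit Arguments.
Unset Strict Implicit.
Unset Printing Implicit Defensive.

Record sgraph := SGraph {
  vertex :> finType;
  edge : rel vertex;
  edge_sym : symmetric edge;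
  edge_irrefl : irreflexive edge }.

(* The subgraph of G induced by S is connected; this holds for S empty. *)
Definition connected_set (G : sgraph) (S : {set G}) : Prop :=
  {in S &, forall x y : G,
    connect [rel u v : G | [&& u \in S, v \in S & edge u v]] x y}.

(* H is a minor of G when G has pairwise disjoint, nonempty, connected branch
   sets, one per vertex of H, with an edge of G between the branch sets of any
   two adjacent vertices of H. The branch sets need not cover G, and edges of G
   between branch sets of non-adjacent vertices are allowed. The relation is
   invariant under isomorphism of H. *)
Definition is_minor (H G : sgraph) : Prop :=
  exists B : H -> {set G},
    [/\ forall x : H, B x != set0,
        forall x : H, connected_set (B x),
        forall x y : H, x != y -> [disjoint B x & B y]
      & forall x y : H, edge x y ->
          exists u v : G, [/\ u \in B x, v \in B y & edge u v]].

(* In MathComp, [ucycle edge c] also holds for c of size 0, and for the two ends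
   of an edge; graph-theoretic cycles are those of size at least 3. *)
Definition is_tree (T : sgraph) : Prop :=
  [/\ 0 < #|T|,
      connected_set [set: T]
    & forall c : seq T, ucycle (@edge T) c -> size c < 3].

Definition tree_decomposition (G T : sgraph) (B : T -> {set G}) : Prop :=
  [/\ is_tree T,
      forall v : G, exists t : T, v \in B t,
      forall u v : G, edge u v -> exists t : T, (u \in B t) && (v \in B t)
    & forall v : G, connected_set [set t : T | v \in B t]].

(* Truncated predecessor: the null graph gets width 0 rather than -1. *)
Definition width (G T : sgraph) (B : T -> {set G}) : nat :=
  (\max_(t : T) #|B t|).-1.

Definition has_tree_decomposition_of_width (G : sgraph) (k : nat) : Prop :=
  exists (T : sgraph) (B : T -> {set G}),
    tree_decomposition B /\ width B = k.

Definition point_graph : sgraph :=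
  @SGraph unit [rel _ _ | false] (fun _ _ => erefl) (fun _ => erefl).

Lemma exists_tree_decomposition (G : sgraph) :
  exists k : nat, `[< has_tree_decomposition_of_width G k >].
Proof.
pose B (_ : point_graph) := [set: G].
exists (width B); apply/asboolP; exists point_graph, B; split=> //.
split.
- split; first by rewrite card_unit.
  + by move=> [] [] _ _; exact: connect0.
  + by case=> [|[] [|[] c]] // /andP[].
- by move=> v; exists tt; rewrite inE.
- by move=> u v _; exists tt; rewrite !inE.
- by move=> v [] [] _ _; exact: connect0.
Qed.

Definition treewidth (G : sgraph) : nat := ex_minn (exists_tree_decomposition G).

Section Path.
Variable n : nat.
Definition path_rel : rel 'I_n := [rel i j : 'I_n | (i.+1 == j) || (j.+1 == i)].
Lemma path_rel_sym : symmetric path_rel.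
Proof. by move=> i j; rewrite /path_rel /= orbC. Qed.
Lemma path_rel_irrefl : irreflexive path_rel.
Proof. by move=> i; rewrite /path_rel /= orbb gtn_eqF. Qed.
Definition path_graph : sgraph := SGraph path_rel_sym path_rel_irrefl.
End Path.

Section Cycle.
Variable n : nat.
(* [ordS i] is i + 1 modulo n; for n >= 3 this is the cycle of length n. *)
Definition cycle_rel : rel 'I_n :=
  [rel i j : 'I_n | (i != j) && ((ordS i == j) || (ordS j == i))].
Lemma cycle_rel_sym : symmetric cycle_rel.
Proof. by move=> i j; rewrite /cycle_rel /= orbC eq_sym. Qed.
Lemma cycle_rel_irrefl : irreflexive cycle_rel.
Proof. by move=> i; rewrite /cycle_rel /= eqxx. Qed.
Definition cycle_graph : sgraph := SGraph cycle_rel_sym cycle_rel_irrefl.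
End Cycle.

Section CartesianProduct.
Variables G H : sgraph.
Definition cartesian_rel : rel (G * H) :=
  [rel x y : G * H | (x.1 == y.1) && edge x.2 y.2 || (x.2 == y.2) && edge x.1 y.1].
Lemma cartesian_rel_sym : symmetric cartesian_rel.
Proof.
move=> x y; rewrite /cartesian_rel /=.
by rewrite [y.1 == _]eq_sym [y.2 == _]eq_sym (edge_sym y.1) (edge_sym y.2).
Qed.
Lemma cartesian_rel_irrefl : irreflexive cartesian_rel.
Proof. by move=> x; rewrite /cartesian_rel /= !edge_irrefl !andbF. Qed.
Definition cartesian_product : sgraph :=
  SGraph cartesian_rel_sym cartesian_rel_irrefl.
End CartesianProduct.

Definition grid (m n : nat) : sgraph :=
  cartesian_product (path_graph m) (path_graph n).

(* Every graph consisting of two disjoint cycles of length l joined by a perfect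
   matching is isomorphic to [twisted_prism s] for some permutation s. *)
Section TwistedPrism.
Variables (l : nat) (s : {perm 'I_l}).
Definition twisted_prism_rel : rel (cycle_graph l + cycle_graph l) :=
  fun x y => match x, y with
  | inl i, inl j => edge i j
  | inr i, inr j => edge i j
  | inl i, inr j => s i == j
  | inr j, inl i => s i == j
  end.
Lemma twisted_prism_rel_sym : symmetric twisted_prism_rel.
Proof. by move=> [i|i] [j|j] //; exact: edge_sym. Qed.
Lemma twisted_prism_rel_irrefl : irreflexive twisted_prism_rel.
Proof. by move=> [i|i]; exact: edge_irrefl. Qed.
Definition twisted_prism : sgraph :=
  SGraph twisted_prism_rel_sym twisted_prism_rel_irrefl.
End TwistedPrism.

(* Main.v *)
Require Import Defs.
From mathcomp Require Import all_boot all_fingroup zify.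
From mathcomp Require Import boolp.

Set Implicit Arguments.
Unset Strict Implicit.
Unset Printing Implicit Defensive.

(** The proof is by contradiction. A graph of treewidth more than [2 * l + 10] has a
bramble, that is a family of pairwise touching connected sets, that no
[2 * l + 11] vertices cover ([bramble_of_treewidth], the duality theorem of Seymour
and Thomas). For each set [Y] of at most that size the bramble selects one component
[beta Y] of the graph without [Y].

This guides the growth of disjoint connected sets ([grow_all]). Seven of them, the
anchors, form a path; from the first and from the last anchor an ear leads to two
further sets, the hubs. The ears are paths, as short as possible, that fewer than
[l] vertices cannot separate from the bramble. Minimality gives [l - 1] vertices that
separate everything but the end of an ear from the bramble, so both ears can be
deleted and 13 vertices still do not cover the rest of the bramble. These 13 suffice
to link, in the part of the graph towards the bramble, three of the anchors to the
first hub by disjoint rows and three other anchors to the second hub by disjoint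
columns ([linkage]).

Suppose that the ends of the two ears can be joined by disjoint connected sets
outside the ears. Then the ears close up to two disjoint cycles that fewer than [l]
vertices cannot separate, and Menger's theorem gives [l] disjoint paths between
them: a twisted prism ([prism_of_cycles]). Otherwise every connection of the first
anchor to the first hub meets every connection of the last anchor to the second
hub, and this forces the rows and columns to cross in a grid-like manner: in a
crossing that cannot be made smaller by contraction and re-routing, each row meets
each column exactly once and in the right order. Together with the path of anchors,
which provides the first row and the first column, this is a 4 by 4 grid
([grid_of_crossing]). *)

(** * Connected sets *)

Section ExitLemma.
Variables (T : finType) (e : rel T).

(** The walk is followed up to the first time that it leaves [A], so its first part
is a connection inside [A]. *)
Lemma connect_exit (A : {set T}) x y :
    connect e x y -> x \in A -> y \notin A ->
  exists u v, [/\ u \in A, v \notin A, e u v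
    & connect [rel a b | [&& a \in A, b \in A & e a b]] x u].
Proof.
case/connectP=> p; elim: p x => [|z p IH] x /=; first by move=> _ -> ->.
case/andP=> exz pzp ly xA yA; have [zA|zA] := boolP (z \in A); last first.
  by exists x, z; split.
have [u [v [uA vA euv zu]]] := IH z pzp ly zA yA.
exists u, v; split=> //; apply: connect_trans zu; apply: connect1.
by rewrite /= xA zA exz.
Qed.

Lemma connect_simple x y :
  connect e x y -> exists p, [/\ path e x p, last x p = y & uniq (x :: p)].
Proof. by case/connectP=> p pp ->; case: (shortenP pp) => q *; exists q. Qed.

End ExitLemma.

Lemma path_all (T : eqType) (e : rel T) (a : pred T) x p :
    (forall u v, e u v -> a v) -> a x -> path e x p -> all a (x :: p).
Proof.
move=> h; elim: p x => [|y p IH] x ax /=; first by rewrite ax.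
by case/andP=> /h ay pp; rewrite ax; apply: IH.
Qed.

Section Connected.
Variable G : sgraph.
Implicit Types (S A B X Y : {set G}) (x y u v : G).

Definition inside S : rel G := fun u v => [&& u \in S, v \in S & edge u v].
Arguments inside S u v /.

Lemma inside_csym S : connect_sym (inside S).
Proof.
apply: sym_connect_sym => u v /=.
by rewrite edge_sym; case: (u \in S); case: (v \in S).
Qed.

Lemma connect_edge S x y :
  x \in S -> y \in S -> edge x y -> connect (inside S) x y.
Proof. by move=> xS yS xy; apply: connect1; rewrite /= xS yS xy. Qed.

Lemma inside_sub A B : A \subset B -> subrel (inside A) (inside B).
Proof.
by move=> /subsetP AB u v /and3P[uA vA uv]; apply/and3P; split=> //; exact: AB.
Qed.

Lemma connect_inside_sub A B x y :
  A \subset B -> connect (inside A) x y -> connect (inside B) x y.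
Proof.
move=> AB; apply: connect_sub => u v /(inside_sub AB); exact: connect1.
Qed.

Lemma connect_insideE S x y : connect (inside S) x y -> x \in S -> y \in S.
Proof.
move=> xy xS; apply: contraT => yS.
by have [u [v [_ /negP vS /and3P[_ ? _] _]]] := connect_exit xy xS yS.
Qed.

Lemma connected_root S r :
  (forall y, y \in S -> connect (inside S) r y) -> connected_set S.
Proof.
by move=> h x y /h rx /h ry; apply: connect_trans ry; rewrite inside_csym.
Qed.

Lemma connected1 x : connected_set [set x].
Proof. by move=> u v /set1P-> /set1P->; exact: connect0. Qed.

Definition adj A B := [exists u in A, [exists v in B, edge u v]].

Lemma adjP A B :
  reflect (exists u v, [/\ u \in A, v \in B & edge u v]) (adj A B).
Proof.
apply: (iffP existsP) => [[u /andP[uA /existsP[v /andP[vB uv]]]]|[u [v [uA vB uv]]]].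
  by exists u, v.
by exists u; rewrite uA; apply/existsP; exists v; rewrite vB.
Qed.

Lemma adj_sym A B : adj A B = adj B A.
Proof.
by apply/adjP/adjP => -[u [v [? ? ?]]]; exists v, u; split=> //; rewrite edge_sym.
Qed.

Lemma adj_sub A B A' B' : A \subset A' -> B \subset B' -> adj A B -> adj A' B'.
Proof.
move=> /subsetP AA /subsetP BB /adjP[u [v [uA vB uv]]].
by apply/adjP; exists u, v; split; auto.
Qed.

Definition touch A B := (A :&: B != set0) || adj A B.

Lemma connectedU A B :
  connected_set A -> connected_set B -> touch A B -> connected_set (A :|: B).
Proof.
move=> cA cB t.
have [u [v [uA vB uv]]] : exists u v, [/\ u \in A, v \in B & u = v \/ edge u v].
  case/orP: t => [/set0Pn[u /setIP[uA uB]]|/adjP[u [v [uA vB uv]]]].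
    by exists u, u; split=> //; left.
  by exists u, v; split=> //; right.
have uv' : connect (inside (A :|: B)) u v.
  case: uv => [->|uv]; first exact: connect0.
  by apply: connect1; rewrite /= !inE uA vB uv orbT.
apply: (@connected_root _ u) => y /setUP[yA|yB].
  by apply: (connect_inside_sub (subsetUl A B)); apply: cA.
apply: connect_trans uv' _.
by apply: (connect_inside_sub (subsetUr A B)); apply: cB.
Qed.

Lemma connectedU_adj A B :
  connected_set A -> connected_set B -> adj A B -> connected_set (A :|: B).
Proof. by move=> cA cB t; apply: connectedU; rewrite // /touch t orbT. Qed.

Lemma connectedU_meet A B z :
  connected_set A -> connected_set B -> z \in A -> z \in B ->
  connected_set (A :|: B).
Proof.
move=> cA cB zA zB; apply: connectedU => //.
by apply/orP; left; apply/set0Pn; exists z; rewrite inE zA.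
Qed.

Lemma connected_path x p : path (@edge G) x p -> connected_set [set y in x :: p].
Proof.
elim: p x => [|z p IH] x /= => [_|/andP[xz pp]].
  have -> : [set y in [:: x]] = [set x] by apply/setP=> y; rewrite !inE.
  exact: connected1.
have -> : [set y in [:: x, z & p]] = [set x] :|: [set y in z :: p].
  by apply/setP=> y; rewrite !inE.
apply: connectedU_adj; [exact: connected1|exact: IH|].
by apply/adjP; exists x, z; rewrite !inE !eqxx.
Qed.

Lemma connected_simple S x y :
    connected_set S -> x \in S -> y \in S ->
  exists p, [/\ path (@edge G) x p, last x p = y, uniq (x :: p)
    & {subset x :: p <= S}].
Proof.
move=> cS xS yS; have [p [pp lp up]] := connect_simple (cS _ _ xS yS).
exists p; split=> //; first by apply: sub_path pp => u v /and3P[].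
by apply/allP; apply: (path_all _ xS pp) => u v /and3P[].
Qed.

Lemma connected_exit S A x y :
    connected_set S -> x \in S -> y \in S -> x \in A -> y \notin A ->
  exists u v, [/\ u \in S :&: A, v \in S :\: A, edge u v
    & connect (inside (S :&: A)) x u].
Proof.
move=> cS xS yS xA yA.
have [u [v [uA vA /and3P[uS vS uv] xu]]] := connect_exit (cS _ _ xS yS) xA yA.
exists u, v; split; rewrite ?inE ?uA ?uS ?vA //.
apply: connect_sub xu => a b /and3P[aA bA /and3P[aS bS ab]].
by apply: connect1; rewrite /= !inE aA aS bA bS.
Qed.

Definition component S x := [set y | connect (inside S) x y].

Lemma component_connected S x : connected_set (component S x).
Proof.
apply: (@connected_root _ x) => y; rewrite inE => /connectP[p pp ->].
suff key w q : path (inside S) w q -> w \in component S x ->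
    connect (inside (component S x)) w (last w q).
  by apply: key; rewrite // inE connect0.
elim: q w {p pp y} => [|z p IH] w /= => [_ _|/andP[wz pp] wc].
  exact: connect0.
have zc : z \in component S x.
  by move: wc; rewrite !inE => xw; apply: (connect_trans xw); exact: connect1.
apply: connect_trans (IH z pp zc); apply: connect1.
by rewrite /= wc zc; case/and3P: wz.
Qed.

Lemma component_sub S x : x \in S -> component S x \subset S.
Proof. by move=> xS; apply/subsetP=> y; rewrite inE => /connect_insideE ->. Qed.

Lemma connected_image (H : sgraph) (f : G -> H) S :
    {in S &, forall x y, edge x y -> f x = f y \/ edge (f x) (f y)} ->
  connected_set S -> connected_set (f @: S).
Proof.
move=> hf cS _ _ /imsetP[x xS ->] /imsetP[y yS ->].
have /connectP[p pp ->] := cS _ _ xS yS.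
elim: p x xS pp => [|z p IH] x xS /=; first by move=> _; exact: connect0.
case/andP=> /and3P[_ zS xz] pp; apply: connect_trans (IH z zS pp).
case: (hf _ _ xS zS xz) => [->|fxz]; first exact: connect0.
by apply: connect1; rewrite /= !imset_f.
Qed.

End Connected.

Arguments inside {G} S u v /.

(** * Minors *)

Section Minors.
Variables (H G : sgraph) (B : H -> {set G}).
Hypothesis B0 : forall x, B x != set0.
Hypothesis Bc : forall x, connected_set (B x).
Hypothesis Be : forall x y, edge x y -> adj (B x) (B y).

Lemma connected_bigcup (X : {set H}) :
  connected_set X -> connected_set (\bigcup_(x in X) B x).
Proof.
move=> cX u v /bigcupP[x xX ux] /bigcupP[y yX vy].
have sub z : z \in X -> B z \subset \bigcup_(x in X) B x.
  by move=> zX; apply: bigcup_sup.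
have /connectP[p pp ly] := cX _ _ xX yX; subst y.
elim: p x xX u ux pp vy yX => [|z p IH] x xX u ux /=.
  by move=> _ vx _; apply: (connect_inside_sub (sub x xX)); apply: Bc.
case/andP=> /and3P[_ zX /Be/adjP[a [b [ax bz ab]]]] pp vy yX.
apply: connect_trans (IH z zX b bz pp vy yX).
apply: (@connect_trans _ _ a).
  by apply: (connect_inside_sub (sub x xX)); apply: Bc.
apply: connect1; rewrite /= ab (subsetP (sub x xX)) //.
by rewrite (subsetP (sub z zX)).
Qed.

End Minors.

Lemma is_minor_trans (F H G : sgraph) :
  is_minor F H -> is_minor H G -> is_minor F G.
Proof.
move=> [A [A0 Ac Ad Ae]] [B [B0 Bc Bd Be]].
have Be' x y : edge x y -> adj (B x) (B y) by move/Be=> ?; apply/adjP.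
exists (fun x => \bigcup_(z in A x) B z); split=> [x|x|x y xy|x y xy].
- have [z zA] := set0Pn _ (A0 x); have [u uB] := set0Pn _ (B0 z).
  by apply/set0Pn; exists u; apply/bigcupP; exists z.
- by apply: connected_bigcup => //; exact: Ac.
- rewrite -setI_eq0; apply: contraT => /set0Pn[u /setIP[]].
  move=> /bigcupP[a aA ua] /bigcupP[b bA ub].
  have ab : a != b.
    apply: contraTneq aA => ->; apply: contraTN bA => bA.
    by rewrite (disjointFr (Ad _ _ xy) bA).
  by rewrite (disjointFr (Bd _ _ ab) ua) in ub.
- have [a [b [aA bA /Be[u [v [ua vb uv]]]]]] := Ae _ _ xy.
  by exists u, v; split=> //; apply/bigcupP; [exists a|exists b].
Qed.

Lemma is_minor_refl (H : sgraph) : is_minor H H.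
Proof.
exists (fun x => [set x]); split=> [x|x|x y xy|x y xy].
- by apply/set0Pn; exists x; rewrite inE.
- exact: connected1.
- by rewrite disjoints1 inE.
- by exists x, y; rewrite !inE.
Qed.

(** * Two crossing linkages contain the 4 by 4 grid *)

Section Contraction.
Variables (H : sgraph) (u w : H).
Hypothesis uw : edge u w.

Let uDw : u != w. Proof. by apply: contraTneq uw => ->; rewrite edge_irrefl. Qed.

Definition contr_vertex := {x : H | x != w}.

(** Contraction of the edge [u w]: the fibres of [contr], which are [u, w] and
singletons, are the branch sets of the contracted graph in [H]. *)
Definition contr (x : H) : contr_vertex := insubd (exist _ u uDw) x.

Definition contr_rel : rel contr_vertex := fun a b =>
  (a != b) && adj (contr @^-1: [set a]) (contr @^-1: [set b]).
Arguments contr_rel a b /.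

Lemma contr_rel_sym : symmetric contr_rel.
Proof. by move=> a b /=; rewrite eq_sym adj_sym. Qed.
Lemma contr_rel_irrefl : irreflexive contr_rel.
Proof. by move=> a /=; rewrite eqxx. Qed.

Definition contr_graph : sgraph := SGraph contr_rel_sym contr_rel_irrefl.

Lemma val_contr x : x != w -> val (contr x) = x.
Proof. by move=> xw; rewrite val_insubd xw. Qed.

Lemma contr_w : contr w = contr u.
Proof. by apply: val_inj; rewrite !val_insubd eqxx uDw. Qed.

Lemma contr_eq x y : contr x = contr y ->
  [\/ x = y, x = u /\ y = w | x = w /\ y = u].
Proof.
have cE z : z != w -> contr z = contr u -> z = u.
  by move=> zw /(congr1 val); rewrite !val_contr.
have [->|xw] := eqVneq x w; have [->|yw] := eqVneq y w.
- by move=> _; constructor 1.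
- by rewrite contr_w => /esym/(cE _ yw)->; constructor 3.
- by rewrite contr_w => /(cE _ xw)->; constructor 2.
- by move/(congr1 val); rewrite !val_contr // => ->; constructor 1.
Qed.

Lemma contr_fiber_connected (a : contr_graph) : connected_set (contr @^-1: [set a]).
Proof.
apply: (@connected_root _ _ (val a)) => x; rewrite !inE => /eqP xa.
have aa : contr (val a) = a by apply: val_inj; rewrite val_contr ?(valP a).
have := contr_eq (etrans xa (esym aa)).
case=> [->|[xu aw]|[xw au]]; first exact: connect0.
  by have := valP a; rewrite aw eqxx.
by apply: connect_edge; rewrite ?inE ?aa ?xa ?eqxx //= au xw.
Qed.

Lemma contr_minor : is_minor contr_graph H.
Proof.
exists (fun a => contr @^-1: [set a]); split.
- move=> a; apply/set0Pn; exists (val a); rewrite !inE; apply/eqP.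
  by apply: val_inj; rewrite val_contr ?(valP a).
- exact: contr_fiber_connected.
- move=> a b ab; apply/pred0P => x /=; rewrite !inE.
  by apply: contraNF ab => /andP[/eqP<- /eqP<-].
- by move=> a b /andP[_ /adjP].
Qed.

Lemma contr_connected (A : {set H}) :
  connected_set A -> connected_set (contr @: A : {set contr_graph}).
Proof.
apply: connected_image => x y _ _ xy.
have [->|nxy] := eqVneq (contr x) (contr y); [by left|right].
rewrite /= nxy; apply/adjP; exists x, y; by rewrite !inE !eqxx.
Qed.

Lemma contr_preim_connected (A : {set contr_graph}) :
  connected_set A -> connected_set (contr @^-1: A).
Proof.
move=> cA; have -> : contr @^-1: A = \bigcup_(a in A) contr @^-1: [set a].
  apply/setP=> x; apply/idP/bigcupP => [|[a aA]]; rewrite !inE.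
    by move=> xA; exists (contr x); rewrite // !inE.
  by move=> /eqP->.
by apply: connected_bigcup cA => [|a b /andP[]//]; exact: contr_fiber_connected.
Qed.

Lemma contr_disjoint (A B : {set H}) :
    [disjoint A & B] -> ~~ ((u \in A) && (w \in B)) ->
    ~~ ((w \in A) && (u \in B)) ->
  [disjoint contr @: A & contr @: B].
Proof.
move=> AB uwN wuN; apply/pred0P => z /=; apply: contraNF wuN.
case/andP=> /imsetP[x xA ->] /imsetP[y yB] /contr_eq.
case=> [xy|[xu yw]|[xw yu]]; subst.
- by rewrite (disjointFr AB xA) in yB.
- by rewrite xA yB in uwN.
- by rewrite xA yB.
Qed.

Lemma contr_adj (A B : {set H}) :
  [disjoint contr @: A & contr @: B] -> adj A B ->
  @adj contr_graph (contr @: A) (contr @: B).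
Proof.
move=> dAB /adjP[x [y [xA yB xy]]]; apply/adjP; exists (contr x), (contr y).
split; rewrite ?imset_f //=; apply/andP; split.
  apply: contraTneq (imset_f contr yB) => <-.
  by rewrite (disjointFr dAB) ?imset_f.
by apply/adjP; exists x, y; rewrite !inE !eqxx.
Qed.

Lemma card_contr_lt (A : {set H}) : u \in A -> w \in A -> #|contr @: A| < #|A|.
Proof.
move=> uA wA; rewrite (cardsD1 w A) wA ltnS.
apply: leq_trans (leq_imset_card contr (A :\ w)); apply: subset_leq_card.
apply/subsetP => _ /imsetP[x xA ->]; have [->|xw] := eqVneq x w.
  by rewrite contr_w imset_f // !inE uDw.
by rewrite imset_f // !inE xw.
Qed.

End Contraction.

Definition anchor (b : bool) (i : nat) : nat := if b then i else 4 + i.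
Definition hub (b : bool) : nat := if b then 7 else 8.

(** The sets [S 0], ..., [S 6] form a path of anchors, and [S 7], [S 8] are two hubs.
The rows [C true i] link the anchors 0, 1, 2 to the first hub, and the columns
[C false j] link the anchors 4, 5, 6 to the second one; anchor 3 becomes the corner
of the grid. The last condition is what a planar drawing would give if the first
anchor, the last anchor, the first hub and the second hub lay in this order on the
boundary of a disc: a connection of the first pair crosses a connection of the
second pair. All sets are connected sets rather than vertices and paths, so that
the notion is stable under contraction. *)
Record crossing (H : sgraph) (S : nat -> {set H}) (C : bool -> 'I_3 -> {set H}) :
    Prop := Crossing {
  cr_conn : forall i, i < 9 -> connected_set (S i);
  cr_disj : forall i j, i < 9 -> j < 9 -> i != j -> [disjoint S i & S j];
  cr_path : forall i, i < 6 -> adj (S i) (S i.+1);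
  cr_Cconn : forall b i, connected_set (C b i);
  cr_Cdisj : forall b i j, i != j -> [disjoint C b i & C b j];
  cr_CS : forall b i k, k < 9 -> [disjoint C b i & S k];
  cr_anchor : forall b (i : 'I_3), adj (S (anchor b i)) (C b i);
  cr_hub : forall b i, adj (C b i) (S (hub b));
  cr_cross : forall X Y, connected_set X -> connected_set Y ->
    S 0 :|: S 7 \subset X -> S 6 :|: S 8 \subset Y -> ~ [disjoint X & Y] }.

Definition linkage_size (H : sgraph) (C : bool -> 'I_3 -> {set H}) :=
  #|\bigcup_i C true i| + #|\bigcup_i C false i|.

Lemma anchor_lt b (i : 'I_3) : anchor b i < 9.
Proof. by have := ltn_ord i; case: b => /=; lia. Qed.
Lemma hub_lt b : hub b < 9.
Proof. by case: b. Qed.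

(** An edge inside a linked set can be contracted as long as it does not merge two
sets of one linkage, and this makes the linkages smaller. *)
Lemma crossing_contr (H : sgraph) S (C : bool -> 'I_3 -> {set H}) b i u w :
    crossing S C -> edge u w -> u \in C b i -> w \in C b i ->
    (forall b' i' j', u \in C b' i' -> w \in C b' j' -> i' = j') ->
  exists (H' : sgraph) S' (C' : bool -> 'I_3 -> {set H'}),
    [/\ is_minor H' H, crossing S' C' & linkage_size C' < linkage_size C].
Proof.
move=> cr uw uC wC same.
have nS x k : x \in C b i -> k < 9 -> x \notin S k.
  by move=> xC k9; rewrite (disjointFr (cr_CS cr b i k9) xC).
pose f : H -> contr_graph uw := contr uw.
exists (contr_graph uw), (fun k => f @: S k), (fun b i => f @: C b i).
have dS k l : k < 9 -> l < 9 -> k != l -> [disjoint f @: S k & f @: S l].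
  move=> k9 l9 kl; apply: contr_disjoint; first exact: (cr_disj cr).
    by rewrite (negPf (nS _ _ uC k9)).
  by rewrite (negPf (nS _ _ wC k9)).
have dC c j k : j != k -> [disjoint f @: C c j & f @: C c k].
  move=> jk; apply: contr_disjoint; first exact: (cr_Cdisj cr).
    by apply: contraNN jk => /andP[/same h /h->].
  by rewrite eq_sym in jk; apply: contraNN jk => /andP[h /same/(_ h)->].
have dCS c j k : k < 9 -> [disjoint f @: C c j & f @: S k].
  move=> k9; apply: contr_disjoint; first exact: (cr_CS cr).
    by rewrite (negPf (nS _ _ wC k9)) andbF.
  by rewrite (negPf (nS _ _ uC k9)) andbF.
have fU c : \bigcup_j f @: C c j = f @: \bigcup_j C c j.
  apply/setP=> z; apply/bigcupP/imsetP => [[j _ /imsetP[x xC ->]]|[x /bigcupP[j _ xC ->]]].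
    by exists x => //; apply/bigcupP; exists j.
  by exists j => //; apply: imset_f.
have lt : @linkage_size (contr_graph uw) (fun b i => f @: C b i) < linkage_size C.
  rewrite /linkage_size !fU.
  have le c : #|f @: \bigcup_j C c j| <= #|\bigcup_j C c j| by apply: leq_imset_card.
  have ltb : #|f @: \bigcup_j C b j| < #|\bigcup_j C b j|.
    by apply: card_contr_lt; apply/bigcupP; exists i.
  by case: b ltb {uC wC nS} => ltb; [have := le false|have := le true]; lia.
split=> //; first exact: contr_minor.
split=> //.
- by move=> k k9; apply: contr_connected; apply: (cr_conn cr).
- by move=> k k6; apply: contr_adj; [apply: dS; lia|apply: (cr_path cr)].
- by move=> c j; apply: contr_connected; apply: (cr_Cconn cr).
- move=> c j; apply: contr_adj; last exact: (cr_anchor cr).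
  by rewrite disjoint_sym; apply: dCS; apply: anchor_lt.
- move=> c j; apply: contr_adj; last exact: (cr_hub cr).
  by apply: dCS; apply: hub_lt.
- move=> X Y cX cY sX sY dXY.
  apply: (cr_cross cr (contr_preim_connected cX) (contr_preim_connected cY)).
  + apply/subsetP=> x xS; rewrite inE (subsetP sX) //.
    by case/setUP: xS => xS; apply/setUP; [left|right]; apply: imset_f.
  + apply/subsetP=> x xS; rewrite inE (subsetP sY) //.
    by case/setUP: xS => xS; apply/setUP; [left|right]; apply: imset_f.
  + apply/pred0P => x /=; rewrite !inE.
    by apply/negP => /andP[xX]; rewrite (disjointFr dXY xX).
Qed.

(** Re-routing the linkages inside their own union preserves the crossing condition,
which only mentions anchors and hubs. *)
Lemma crossing_reroute (H : sgraph) S (C C' : bool -> 'I_3 -> {set H}) :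
    crossing S C ->
    (forall b i, connected_set (C' b i)) ->
    (forall b i j, i != j -> [disjoint C' b i & C' b j]) ->
    (forall b i, C' b i \subset \bigcup_j C b j) ->
    (forall b (i : 'I_3), adj (S (anchor b i)) (C' b i)) ->
    (forall b i, adj (C' b i) (S (hub b))) ->
  crossing S C' /\ linkage_size C' <= linkage_size C.
Proof.
move=> cr cC dC sC aC hC.
have sU b : \bigcup_i C' b i \subset \bigcup_i C b i by apply/bigcupsP => i _.
split; last by apply: leq_add; apply: subset_leq_card.
have dCS := cr_CS cr; case: cr => *; split=> // b i k k9; apply/pred0P => x /=.
apply/negP => /andP[/(subsetP (sC b i))/bigcupP[j _ xj]].
by apply/negP; rewrite (disjointFr (dCS b j k k9) xj).
Qed.

Section MinimalCrossing.
Variables (H : sgraph) (S : nat -> {set H}) (C : bool -> 'I_3 -> {set H}).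
Hypothesis cr : crossing S C.
Hypothesis minC : forall (H' : sgraph) S' (C' : bool -> 'I_3 -> {set H'}),
  is_minor H' H -> crossing S' C' -> linkage_size C <= linkage_size C'.

(** In a smallest crossing an edge inside a linked set joins two different sets
of the other linkage: otherwise it could be contracted. *)
Lemma edge_inside_split C' b i u w :
    crossing S C' -> linkage_size C' <= linkage_size C ->
    edge u w -> u \in C' b i -> w \in C' b i ->
  exists j j', [/\ j != j', u \in C' (~~ b) j & w \in C' (~~ b) j'].
Proof.
move=> cr' le uw uC wC; apply: contrapT => noj.
case: (crossing_contr cr' uw uC wC) => [c j k uj wk|H' [S' [C'' [mH cr'' lt]]]].
  apply: contrapT => /eqP jk; have [cb|cb] := eqVneq c b; last first.
    by apply: noj; exists j, k; rewrite -(_ : c = ~~ b) //; case: (c) (b) cb => -[].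
  have eqi l x : x \in C' c l -> x \in C' b i -> l = i.
    move=> xl xi; apply: contrapT => /eqP li; subst c.
    by rewrite (disjointFr (cr_Cdisj cr' b li) xl) in xi.
  by rewrite (eqi _ _ uj uC) (eqi _ _ wk wC) eqxx in jk.
by have := minC mH cr''; lia.
Qed.

Lemma linked_set_minimal b (i : 'I_3) (X : {set H}) :
    X \subset C b i -> connected_set X -> adj (S (anchor b i)) X ->
    adj X (S (hub b)) -> X = C b i.
Proof.
move=> sX cX aX hX; apply/eqP; rewrite eqEsubset sX /=; apply/subsetP => x xC.
apply: contraT => xX.
pose C' c j := if (c == b) && (j == i) then X else C c j.
have sC' c j : C' c j \subset C c j.
  by rewrite /C'; case: ifP => // /andP[/eqP-> /eqP->].
have [cr' _] : crossing S C' /\ linkage_size C' <= linkage_size C.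
  apply: crossing_reroute (cr) _ _ _ _ _; rewrite /C'.
  - by move=> c j; case: ifP => // _; exact: cr_Cconn cr _ _.
  - move=> c j k jk; apply: disjointWl (sC' c j) _.
    by apply: disjointWr (sC' c k) _; exact: cr_Cdisj cr _ _ _ _.
  - by move=> c j; apply: subset_trans (sC' c j) _; apply: bigcup_sup.
  - by move=> c j; case: ifP => [/andP[/eqP cb /eqP ji]|_]; [rewrite cb ?ji|exact: cr_anchor cr _ _].
  - by move=> c j; case: ifP => [/andP[/eqP cb /eqP ji]|_]; [rewrite cb ?ji|exact: cr_hub cr _ _].
have := minC (is_minor_refl H) cr'; rewrite leqNgt => /negP[].
have le c : \bigcup_j C' c j \subset \bigcup_j C c j.
  by apply/bigcupsP => j _; apply: subset_trans (sC' c j) _; apply: bigcup_sup.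
have ltb : \bigcup_j C' b j \proper \bigcup_j C b j.
  apply/properP; split=> //; exists x; first by apply/bigcupP; exists i.
  apply/bigcupP => -[j _]; rewrite /C' eqxx /=; case: eqP => [_|/eqP ji].
    by rewrite (negPf xX).
  by rewrite (disjointFl (cr_Cdisj cr b ji) xC).
move/proper_card: ltb; rewrite /linkage_size.
have := subset_leq_card (le true); have := subset_leq_card (le false).
by case: (b); lia.
Qed.

Definition is_linking_path b (i : 'I_3) (s : seq H) := exists x p, [/\ s = x :: p,
  path (@edge H) x p, uniq s, C b i = [set v in s] &
  adj (S (anchor b i)) [set x] /\ adj [set last x p] (S (hub b))].

(** A simple path inside a linked set that joins its two ends does the job of the
set, so by minimality it uses all vertices. *)
Lemma linking_path_exists b i : exists s, is_linking_path b i s.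
Proof.
have /adjP[a [x [aS xC ax]]] := cr_anchor cr b i.
have /adjP[y [h [yC hS yh]]] := cr_hub cr b i.
have [p [pp lp up sp]] := connected_simple (cr_Cconn cr (b := b) (i := i)) xC yC.
exists (x :: p), x, p; split=> //; last first.
  by split; apply/adjP; [exists a, x|exists y, h]; rewrite ?inE ?lp.
apply/esym/linked_set_minimal.
- by apply/subsetP => v; rewrite inE => /sp.
- exact: connected_path.
- by apply/adjP; exists a, x; rewrite !inE eqxx.
- by apply/adjP; exists y, h; split; rewrite // inE -lp; exact: mem_last.
Qed.

Lemma S_connected_seg a b : a <= b -> b <= 6 ->
  connected_set (\bigcup_(a <= k < b.+1) S k).
Proof.
elim: b => [|b IH] ab b6.
  have -> : a = 0 by lia.
  by rewrite big_nat1; apply: (cr_conn cr).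
have [lt|ge] := ltnP b a.
  have -> : a = b.+1 by lia.
  by rewrite big_nat1; apply: (cr_conn cr); lia.
rewrite big_nat_recr; last by lia.
apply: connectedU_adj; [by apply: IH; lia|by apply: (cr_conn cr); lia|].
apply: adj_sub (cr_path cr (i := b) _) => //.
by rewrite big_nat_recr /= ?subsetUr //; lia.
Qed.

(** How the crossing property is used: a set linking the [i]-th anchor to the
first hub meets every set linking a later anchor to the second hub. *)
Lemma no_parallel i j (X Y : {set H}) :
    i < j -> j <= 6 -> connected_set X -> connected_set Y ->
    (forall k, k < 9 -> [disjoint X & S k]) ->
    (forall k, k < 9 -> [disjoint Y & S k]) ->
    adj (S i) X -> adj X (S 7) -> adj (S j) Y -> adj Y (S 8) ->
  ~ [disjoint X & Y].
Proof.
move=> ij j6 cX cY XS YS iX X7 jY Y8 dXY.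
pose A := \bigcup_(0 <= k < i.+1) S k; pose B := \bigcup_(j <= k < 7) S k.
have inseg a b v : reflect (exists2 k, a <= k < b & v \in S k)
    (v \in \bigcup_(a <= k < b) S k).
  apply: (iffP idP) => [|[k kab vk]].
    rewrite big_nat_cond; elim/big_ind: _ => [|P Q hP hQ|k].
    - by rewrite inE.
    - by case/setUP.
    - by rewrite andbT => kab vk; exists k.
  have -> : \bigcup_(a <= k < b) S k = S k :|: \bigcup_(a <= l < b | l != k) S l.
    by rewrite (bigD1_seq k) ?mem_index_iota ?iota_uniq.
  by rewrite inE vk.
have cA : connected_set A by apply: S_connected_seg; lia.
have cB : connected_set B by apply: (@S_connected_seg j 6); lia.
apply: (cr_cross cr (X := A :|: X :|: S 7) (Y := B :|: Y :|: S 8)).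
- apply: connectedU_adj; [|exact: (cr_conn cr)|]; last first.
    by apply: adj_sub X7; rewrite ?subsetUr.
  apply: connectedU_adj => //; apply: adj_sub iX => //.
  by apply/subsetP => v vi; apply/inseg; exists i; rewrite ?leqnn.
- apply: connectedU_adj; [|exact: (cr_conn cr)|]; last first.
    by apply: adj_sub Y8; rewrite ?subsetUr.
  apply: connectedU_adj => //; apply: adj_sub jY => //.
  by apply/subsetP => v vi; apply/inseg; exists j; rewrite ?leqnn //; lia.
- rewrite setUSS // subsetU // (_ : _ \subset A) //.
  by apply/subsetP => v v0; apply/inseg; exists 0.
- rewrite setUSS // subsetU // (_ : _ \subset B) //.
  by apply/subsetP => v v0; apply/inseg; exists 6; lia.
have SS k l v : k < 9 -> l < 9 -> v \in S k -> v \in S l -> k = l.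
  move=> k9 l9 vk vl; apply: contrapT => /eqP kl.
  by rewrite (disjointFr (cr_disj cr k9 l9 kl) vk) in vl.
apply/pred0P => v /=; apply/negP; rewrite !inE -!orbA => /andP[].
have XSv k : k < 9 -> v \in X -> v \in S k -> False.
  by move=> k9 vX; rewrite (disjointFr (XS _ k9) vX).
have YSv k : k < 9 -> v \in Y -> v \in S k -> False.
  by move=> k9 vY; rewrite (disjointFr (YS _ k9) vY).
case/or3P=> [/inseg[k kk vk]|vX|v7]; case/or3P=> [/inseg[l ll vl]|vY|v8].
- by have := SS k l v _ _ vk vl; lia.
- by apply: (YSv k _ vY vk); lia.
- by have := SS k 8 v _ _ vk v8; lia.
- by apply: (XSv l _ vX vl); lia.
- by rewrite (disjointFr dXY vX) in vY.
- exact: (XSv 8 isT vX v8).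
- by have := SS 7 l v _ _ v7 vl; lia.
- exact: (YSv 7 isT vY v7).
- by have := SS 7 8 v isT isT v7 v8.
Qed.

End MinimalCrossing.

Lemma connected_sorted (G : sgraph) (s : seq G) :
  sorted (@edge G) s -> connected_set [set v in s].
Proof.
case: s => [_ x y|x p]; first by rewrite inE.
exact: connected_path.
Qed.

Section LinkingPaths.
Variables (H : sgraph) (S : nat -> {set H}) (C : bool -> 'I_3 -> {set H}).
Hypothesis cr : crossing S C.
Hypothesis minC : forall (H' : sgraph) S' (C' : bool -> 'I_3 -> {set H'}),
  is_minor H' H -> crossing S' C' -> linkage_size C <= linkage_size C'.
Variable d : bool -> 'I_3 -> seq H.
Hypothesis dP : forall b i, is_linking_path S C b i (d b i).

Notation row := (C true).
Notation col := (C false).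
Let pos b i x := index x (d b i).

Lemma mem_d b i x : (x \in d b i) = (x \in C b i).
Proof. by have [y [p [-> _ _ -> _]]] := dP b i; rewrite in_set. Qed.

Lemma uniq_d b i : uniq (d b i).
Proof. by have [y [p [-> _ ? _ _]]] := dP b i. Qed.

Lemma sorted_d b i : sorted (@edge H) (d b i).
Proof. by have [y [p [-> ? _ _ _]]] := dP b i. Qed.

Lemma C_inj b i j x : x \in C b i -> x \in C b j -> i = j.
Proof.
move=> xi xj; apply: contrapT => /eqP ij.
by rewrite (disjointFr (cr_Cdisj cr b ij) xi) in xj.
Qed.

Lemma pos_inj b i x y : x \in C b i -> pos b i x = pos b i y -> x = y.
Proof.
rewrite -mem_d => xd e; have := nth_index x xd; rewrite -/(pos b i x) e => <-.
by rewrite nth_index // -index_mem -[index _ _]e index_mem.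
Qed.

Lemma pos_nth b i m x0 : m < size (d b i) -> pos b i (nth x0 (d b i) m) = m.
Proof. by move=> ms; rewrite /pos index_uniq ?uniq_d. Qed.

Lemma pos_lt b i x : (pos b i x < size (d b i)) = (x \in C b i).
Proof. by rewrite index_mem mem_d. Qed.

Lemma pos_edge b i x y :
  x \in C b i -> y \in C b i -> pos b i y = (pos b i x).+1 -> edge x y.
Proof.
move=> xC yC e; have /(sortedP x)/(_ (pos b i x)) := sorted_d b i.
by rewrite -e pos_lt yC !nth_index ?mem_d //; exact.
Qed.

Definition upto b i m := [set x in take m (d b i)].
Definition from b i m := [set x in drop m (d b i)].

Lemma in_upto b i m x : (x \in upto b i m) = (x \in C b i) && (pos b i x < m).
Proof.
rewrite inE -mem_d; have [xd|xd] /= := boolP (x \in d b i); first by rewrite in_take.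
by apply: contraNF xd; exact: mem_take.
Qed.

Lemma in_from b i m x : (x \in from b i m) = (x \in C b i) && (m <= pos b i x).
Proof.
rewrite inE -mem_d -{2}(cat_take_drop m (d b i)) mem_cat.
have := uniq_d b i; rewrite -{1}(cat_take_drop m (d b i)) cat_uniq.
case/and3P=> _ /hasPn dis _; have [xd|xd] := boolP (x \in drop m (d b i)).
  by rewrite orbT leqNgt -in_take ?dis // (mem_drop xd).
rewrite orbF; have [xt|//] := boolP (x \in take _ _).
by apply/esym/negbTE; rewrite -ltnNge /= -in_take // (mem_take xt).
Qed.

Lemma upto_connected b i m : connected_set (upto b i m).
Proof. by apply/connected_sorted/take_sorted/sorted_d. Qed.

Lemma from_connected b i m : connected_set (from b i m).
Proof. by apply/connected_sorted/drop_sorted/sorted_d. Qed.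

Lemma anchor_upto b (i : 'I_3) m : 0 < m -> adj (S (anchor b i)) (upto b i m).
Proof.
rewrite /upto; have [x [p [-> _ _ _ [ax _]]]] := dP b i; case: m => //= m _.
by apply: adj_sub ax => //; apply/subsetP => y /set1P->; rewrite inE mem_head.
Qed.

Lemma from_hub b i x : x \in C b i -> adj (from b i (pos b i x)) (S (hub b)).
Proof.
rewrite -pos_lt /from; move: (pos b i x) => m {x}.
have [x [p [-> _ _ _ [_ px]]]] := dP b i => ms; apply: adj_sub px => //.
apply/subsetP => y /set1P->; rewrite inE /= (last_nth x).
have -> : nth x (x :: p) (size p) = nth x (drop m (x :: p)) (size p - m).
  by rewrite nth_drop subnKC.
by apply: mem_nth; rewrite size_drop /=; move: ms => /=; lia.
Qed.

Lemma pos_first b (i : 'I_3) x : pos b i x = 0 -> adj (S (anchor b i)) [set x].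
Proof.
rewrite /pos; have [y [p [-> _ _ _ [ay _]]]] := dP b i => /=.
by case: eqP => [<-|//] _.
Qed.

(** [no_parallel] for sets made of pieces of the linked sets. *)
Lemma no_parallel_rows i j (X Y : {set H}) :
    i < j -> j <= 6 -> connected_set X -> connected_set Y ->
    (forall v, v \in X -> exists b i, v \in C b i) ->
    (forall v, v \in Y -> exists b i, v \in C b i) ->
    adj (S i) X -> adj X (S 7) -> adj (S j) Y -> adj Y (S 8) ->
  exists v, v \in X /\ v \in Y.
Proof.
move=> ij j6 cX cY XC YC iX X7 jY Y8.
have free (A : {set H}) : (forall v, v \in A -> exists b i, v \in C b i) ->
    forall k, k < 9 -> [disjoint A & S k].
  move=> AC k k9; apply/pred0P => v /=; apply/negP => /andP[/AC[b [l vC]]].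
  by rewrite (disjointFr (cr_CS cr b l k9) vC).
apply: contrapT => no.
refine (no_parallel cr ij j6 cX cY (free _ XC) (free _ YC) iX X7 jY Y8 _).
apply/pred0P => v /=; apply/negP => /andP[vX vY]; apply: no; by exists v.
Qed.

Let inC b i (v : H) : v \in C b i -> exists b i, v \in C b i.
Proof. by move=> vC; exists b, i. Qed.

Lemma row_col_meet i j : exists x, x \in row i /\ x \in col j.
Proof.
apply: (@no_parallel_rows i (4 + j)).
- by have := ltn_ord i; lia.
- by have := ltn_ord j; lia.
- exact: (cr_Cconn cr).
- exact: (cr_Cconn cr).
- exact: inC.
- exact: inC.
- exact: (cr_anchor cr true).
- exact: (cr_hub cr true).
- exact: (cr_anchor cr false).
- exact: (cr_hub cr false).
Qed.

(** A vertex of a linked set with an edge inside this set lies in the other linkage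
by [edge_inside_split]; a linked set with one vertex meets the other linkage
anyway. *)
Lemma covered b i x : x \in C b i -> exists j, x \in C (~~ b) j.
Proof.
move=> xC; have [y [yC yj]] : exists y, y \in C b i /\ exists j, y \in C (~~ b) j.
  by case: b {xC} => /=; [have [y []] := row_col_meet i ord0|
    have [y []] := row_col_meet ord0 i] => ? ?; exists y; split=> //; eexists; eassumption.
have [->|xy] := eqVneq x y; first by [].
have yx : y \notin [set x] by rewrite inE eq_sym.
have [u [v [/setIP[uC /set1P ux] /setDP[vC _] uv _]]] :=
  connected_exit (cr_Cconn cr (b := b) (i := i)) xC yC (set11 x) yx.
have [j [_ [_ uj _]]] := edge_inside_split minC cr (leqnn _) uv uC vC.
by exists j; rewrite -ux.
Qed.

Lemma no_edge_in_cell b i j x y : edge x y ->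
  x \in C b i -> y \in C b i -> x \in C (~~ b) j -> y \in C (~~ b) j -> False.
Proof.
move=> xy xi yi xj yj.
have [k [l [kl xk yl]]] := edge_inside_split minC cr (leqnn _) xy xi yi.
by rewrite (C_inj xk xj) (C_inj yl yj) eqxx in kl.
Qed.

(** Otherwise the lower row [i'], continued along the column after [w], would lead
from anchor [i'] to the second hub and miss the row [i]. *)
Lemma later_upper_row (i i' j : 'I_3) w :
    i < i' -> w \in row i' -> w \in col j ->
  exists z, [/\ z \in row i, z \in col j & pos false j w < pos false j z].
Proof.
move=> ii' wi wj.
have [z [zX]] : exists v, v \in row i /\ v \in row i' :|: from false j (pos false j w).
  apply: (no_parallel_rows ii').
  - by have := ltn_ord i'; lia.
  - exact: (cr_Cconn cr).
  - apply: connectedU_meet wi _; rewrite ?in_from ?wj ?leqnn //.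
      exact: (cr_Cconn cr).
    exact: from_connected.
  - by move=> v; exact: inC.
  - by move=> v; rewrite inE in_from => /orP[/inC|/andP[/inC]].
  - exact: (cr_anchor cr true).
  - exact: (cr_hub cr true).
  - by apply: adj_sub (cr_anchor cr true i'); rewrite ?subsetUl.
  - by apply: adj_sub (from_hub wj); rewrite ?subsetUr.
case/setUP => [zi'|]; first by have := C_inj zX zi'; move: ii' => /[swap] ->; rewrite ltnn.
rewrite in_from => /andP[zj le]; exists z; split=> //; rewrite ltn_neqAle le andbT.
apply/eqP => e; have wz := pos_inj wj e.
by have := C_inj zX (etrans (congr1 _ (esym wz)) wi); move: ii' => /[swap] ->; rewrite ltnn.
Qed.


(** The last vertex of a column in a row avoids every lower row afterwards. *)
Lemma last_in_row (i j : 'I_3) : exists z, [/\ z \in row i, z \in col j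
  & forall i' : 'I_3, i < i' -> [disjoint from false j (pos false j z) & row i']].
Proof.
have [x [xi xj]] := row_col_meet i j.
case: (@arg_maxnP _ x [pred v | (v \in row i) && (v \in col j)] (pos false j));
  first by rewrite /= xi xj.
move=> z /andP[zi zj] zmax; exists z; split=> // i' ii'.
apply/pred0P => v /=; apply/negP => /andP[]; rewrite in_from => /andP[vj le] vi'.
have [w [wi wj lt]] := later_upper_row ii' vi' vj.
by have := zmax w; rewrite /= wi wj => /(_ isT); lia.
Qed.

(** Otherwise the second hub could be reached from the anchor of the column without
meeting the lower row [i']: along the column up to [w], then through the row [i] to
its last vertex on the column, and along the rest of the column. *)
Lemma earlier_lower_row (i i' j : 'I_3) w :
    i < i' -> w \in row i -> w \in col j ->
  exists z, [/\ z \in row i', z \in col j & pos false j z < pos false j w].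
Proof.
move=> ii' wi wj; have [y [yi yj yd]] := last_in_row i j.
pose Y := upto false j (pos false j w).+1 :|: row i :|: from false j (pos false j y).
have [v [vX]] : exists v, v \in row i' /\ v \in Y.
  apply: (@no_parallel_rows i' (4 + j)).
  - by have := ltn_ord i'; lia.
  - by have := ltn_ord j; lia.
  - exact: (cr_Cconn cr).
  - apply: (@connectedU_meet _ _ _ y); last 2 first.
    + by rewrite inE yi orbT.
    + by rewrite in_from yj leqnn.
    + apply: connectedU_meet (_ : w \in _) wi; first exact: upto_connected.
        exact: (cr_Cconn cr).
      by rewrite in_upto wj /=.
    + exact: from_connected.
  - by move=> v; exact: inC.
  - by move=> v; rewrite !in_setU in_upto in_from => /orP[/orP[/andP[/inC]|/inC]|/andP[/inC]].
  - exact: (cr_anchor cr true).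
  - exact: (cr_hub cr true).
  - apply: adj_sub (anchor_upto false j (ltn0Sn (pos false j w))) => //.
    by rewrite /Y -setUA subsetUl.
  - by apply: adj_sub (from_hub yj); rewrite ?subsetUr.
rewrite !in_setU -orbA => /or3P[|vi|vY].
- rewrite in_upto ltnS leq_eqVlt => /andP[vj /orP[/eqP/(pos_inj vj) vw|lt]].
    by have := C_inj wi (etrans (congr1 _ (esym vw)) vX); move: ii' => /[swap] ->; rewrite ltnn.
  by exists v.
- by have := C_inj vi vX; move: ii' => /[swap] ->; rewrite ltnn.
- by rewrite (disjointFr (yd _ ii') vY) in vX.
Qed.

(** With an edge between the outer rows, the last row, the first row and the final
part of a column would avoid the middle row. *)
Lemma no_edge_outer_rows (i0 i1 i2 : 'I_3) x y :
  i0 < i1 -> i1 < i2 -> edge x y -> x \in row i0 -> y \in row i2 -> False.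
Proof.
move=> i01 i12 xy x0 y2; have [z [z0 zj zd]] := last_in_row i0 ord0.
pose Y := row i2 :|: row i0 :|: from false ord0 (pos false ord0 z).
have [v [vX]] : exists v, v \in row i1 /\ v \in Y.
  apply: (@no_parallel_rows i1 i2) => //.
  - by have := ltn_ord i2; lia.
  - exact: (cr_Cconn cr).
  - apply: (@connectedU_meet _ _ _ z); last 2 first.
    + by rewrite inE z0 orbT.
    + by rewrite in_from zj leqnn.
    + apply: connectedU_adj; [exact: (cr_Cconn cr)|exact: (cr_Cconn cr)|].
      by apply/adjP; exists y, x; rewrite edge_sym.
    + exact: from_connected.
  - by move=> v; exact: inC.
  - by move=> v; rewrite !in_setU in_from => /orP[/orP[/inC|/inC]|/andP[/inC]].
  - exact: (cr_anchor cr true).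
  - exact: (cr_hub cr true).
  - by apply: adj_sub (cr_anchor cr true i2); rewrite // /Y -setUA subsetUl.
  - by apply: adj_sub (from_hub zj); rewrite ?subsetUr.
rewrite !in_setU -orbA => /or3P[v2|v0|vY].
- by have := C_inj v2 vX; move: i12 => /[swap] ->; rewrite ltnn.
- by have := C_inj v0 vX; move: i01 => /[swap] <-; rewrite ltnn.
- by rewrite (disjointFr (zd _ i01) vY) in vX.
Qed.

(** Two links between two rows do not cross: otherwise exchanging the tails of
the rows along the links gives another smallest crossing, in which the first
link lies inside one row and inside one column. *)
Lemma no_crossing_links (i i' j j' : 'I_3) a b a' b' :
    i != i' -> a \in row i -> a' \in row i -> b \in row i' -> b' \in row i' ->
    a \in col j -> b \in col j -> a' \in col j' -> b' \in col j' ->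
    edge a b -> edge a' b' ->
  pos true i a < pos true i a' -> pos true i' b' < pos true i' b -> False.
Proof.
move=> ii' ai ai' bi bi' aj bj aj' bj' ab ab' lta ltb.
pose R := upto true i (pos true i a).+1 :|: from true i' (pos true i' b).
pose R' := upto true i' (pos true i' b').+1 :|: from true i (pos true i a').
pose C' c k := if ~~ c then C c k else
  if k == i then R else if k == i' then R' else C c k.
have memR v : v \in R = (v \in row i) && (pos true i v <= pos true i a)
    || (v \in row i') && (pos true i' b <= pos true i' v).
  by rewrite inE in_upto in_from.
have memR' v : v \in R' = (v \in row i') && (pos true i' v <= pos true i' b')
    || (v \in row i) && (pos true i a' <= pos true i v).
  by rewrite inE in_upto in_from.
have subR v : v \in R -> v \in row i \/ v \in row i'.
  by rewrite memR => /orP[]/andP[]; auto.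
have subR' v : v \in R' -> v \in row i \/ v \in row i'.
  by rewrite memR' => /orP[]/andP[]; auto.
have dRR' : [disjoint R & R'].
  apply/pred0P => v /=; apply/negP; rewrite memR memR' => /andP[].
  case/orP=> /andP[v1 p1] /orP[]/andP[v2 p2].
  - by rewrite (C_inj v1 v2) eqxx in ii'.
  - by have := leq_trans (leq_trans lta p2) p1; rewrite ltnn.
  - by have := leq_trans (leq_trans ltb p1) p2; rewrite ltnn.
  - by rewrite (C_inj v1 v2) eqxx in ii'.
have dR k : k != i -> k != i' -> [disjoint R & row k].
  move=> ki ki'; apply/pred0P => v /=; apply/negP => /andP[/subR[]v1 v2].
    by rewrite (C_inj v1 v2) eqxx in ki.
  by rewrite (C_inj v1 v2) eqxx in ki'.
have dR' k : k != i -> k != i' -> [disjoint R' & row k].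
  move=> ki ki'; apply/pred0P => v /=; apply/negP => /andP[/subR'[]v1 v2].
    by rewrite (C_inj v1 v2) eqxx in ki.
  by rewrite (C_inj v1 v2) eqxx in ki'.
have [cr' le] : crossing S C' /\ linkage_size C' <= linkage_size C.
  apply: crossing_reroute (cr) _ _ _ _ _; rewrite /C'.
  - move=> [] k /=; last exact: (cr_Cconn cr).
    case: eqP => [_|_]; last case: eqP => [_|_]; last exact: (cr_Cconn cr).
      apply: connectedU_adj; [exact: upto_connected|exact: from_connected|].
      by apply/adjP; exists a, b; rewrite in_upto in_from ai bi ltnS !leqnn.
    apply: connectedU_adj; [exact: upto_connected|exact: from_connected|].
    by apply/adjP; exists b', a'; rewrite in_upto in_from ai' bi' ltnS !leqnn edge_sym.
  - move=> [] k l /= kl; last exact: (cr_Cdisj cr).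
    case: (eqVneq k i) => [ki|ki]; case: (eqVneq l i) => [li|li].
    + by rewrite ki li eqxx in kl.
    + by case: (eqVneq l i') => // li'; exact: dR.
    + by case: (eqVneq k i') => ki'; rewrite disjoint_sym //; exact: dR.
    + case: (eqVneq k i') => [ki'|ki']; case: (eqVneq l i') => [li'|li'].
      * by rewrite ki' li' eqxx in kl.
      * exact: dR'.
      * by rewrite disjoint_sym; exact: dR'.
      * exact: (cr_Cdisj cr).
  - move=> [] k /=; last exact: bigcup_sup.
    apply/subsetP => v; case: eqP => _; last case: eqP => _.
    + by case/subR => vi; apply/bigcupP; eexists; eauto.
    + by case/subR' => vi; apply/bigcupP; eexists; eauto.
    + by move=> vk; apply/bigcupP; exists k.
  - move=> [] k /=; last exact: (cr_anchor cr false).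
    case: eqP => [->|_]; last case: eqP => [->|_]; last exact: (cr_anchor cr true).
      by apply: (adj_sub _ _ (anchor_upto true i (ltn0Sn (pos true i a)))); rewrite // /R subsetUl.
    by apply: (adj_sub _ _ (anchor_upto true i' (ltn0Sn (pos true i' b')))); rewrite // /R' subsetUl.
  - move=> [] k /=; last exact: (cr_hub cr false).
    case: eqP => _; last case: eqP => _; last exact: (cr_hub cr true).
      by apply: (adj_sub _ _ (from_hub bi)); rewrite // /R subsetUr.
    by apply: (adj_sub _ _ (from_hub ai')); rewrite // /R' subsetUr.
have aR : a \in C' true i by rewrite /C' /= eqxx memR ai leqnn.
have bR : b \in C' true i by rewrite /C' /= eqxx memR bi leqnn orbT.
have [k [l [kl ak bl]]] := edge_inside_split minC cr' le ab aR bR.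
by rewrite (C_inj (ak : a \in col k) aj) (C_inj (bl : b \in col l) bj) eqxx in kl.
Qed.

Definition col_next j x y := [/\ x \in col j, y \in col j &
  pos false j y = (pos false j x).+1 \/ pos false j x = (pos false j y).+1].

Lemma col_next_edge j x y : col_next j x y -> edge x y.
Proof. by case=> xj yj [] /pos_edge; [|rewrite edge_sym]; exact. Qed.

(** If a column turned in [c] from the row [i] back to the row [i], a vertex [v] of
this row between [a] and [a'] would have a link to the row [i'], on one side of [c],
and this link would cross one of the two links of [c]. *)
Lemma no_turn (i i' : 'I_3) : i != i' ->
    (forall v, v \in row i -> exists j w, w \in row i' /\ col_next j v w) ->
  forall j a c a', a \in row i -> a' \in row i -> c \in row i' -> a != a' ->
  col_next j a c -> col_next j a' c -> False.
Proof.
move=> ii' nb j.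
suff main a c a' : a \in row i -> a' \in row i -> c \in row i' ->
    pos true i a < pos true i a' -> col_next j a c -> col_next j a' c -> False.
  move=> a c a' ai ai' ci aa' ac ac'.
  have [lt|lt|/(pos_inj ai) e] := ltngtP (pos true i a) (pos true i a').
  - exact: main ai ai' ci lt ac ac'.
  - exact: main ai' ai ci lt ac' ac.
  - by rewrite e eqxx in aa'.
move=> ai ai' ci lt ac ac'.
have [aj cj _] := ac; have [aj' _ _] := ac'.
have [e|gap] := eqVneq (pos true i a') (pos true i a).+1.
  exact: no_edge_in_cell (pos_edge ai ai' e) ai ai' aj aj'.
pose v := nth a (d true i) (pos true i a).+1.
have pv : pos true i v = (pos true i a).+1.
  by apply: pos_nth; apply: leq_trans (_ : pos true i a' < _); rewrite ?pos_lt.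
have vi : v \in row i by rewrite -pos_lt pv; apply: leq_trans (_ : pos true i a' < _); rewrite ?pos_lt.
have [j' [w [wi vw]]] := nb v vi; have [vj' wj' _] := vw.
have [ltw|ltw|/(pos_inj wi) e] := ltngtP (pos true i' w) (pos true i' c).
- apply: (no_crossing_links ii' ai vi ci wi aj cj vj' wj') => //.
  + exact: col_next_edge ac.
  + exact: col_next_edge vw.
  + by rewrite pv.
- apply: (no_crossing_links ii' vi ai' wi ci vj' wj' aj' cj) => //.
  + exact: col_next_edge vw.
  + exact: col_next_edge ac'.
  + by rewrite pv; lia.
- subst w; have jj' : j' = j := C_inj wj' cj; subst j'.
  have [av|av] := eqVneq (pos false j v) (pos false j a).
    by move/(pos_inj vj')/(congr1 (pos true i)): av; lia.
  have [av'|av'] := eqVneq (pos false j v) (pos false j a').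
    by move/(pos_inj vj')/(congr1 (pos true i)): av'; lia.
  have aa' : pos false j a <> pos false j a'.
    by move/(pos_inj aj)/(congr1 (pos true i)); lia.
  by case: ac ac' vw => [_ _ h1] [_ _ h2] [_ _ h3]; lia.
Qed.

End LinkingPaths.

Section GridFromMinimalCrossing.
Variables (H : sgraph) (S : nat -> {set H}) (C : bool -> 'I_3 -> {set H}).
Hypothesis cr : crossing S C.
Hypothesis minC : forall (H' : sgraph) S' (C' : bool -> 'I_3 -> {set H'}),
  is_minor H' H -> crossing S' C' -> linkage_size C <= linkage_size C'.
Variable d : bool -> 'I_3 -> seq H.
Hypothesis dP : forall b i, is_linking_path S C b i (d b i).

Notation row := (C true).
Notation col := (C false).
Let pos b i x := index x (d b i).
Let r0 : 'I_3 := @Ordinal 3 0 isT.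
Let r1 : 'I_3 := @Ordinal 3 1 isT.
Let r2 : 'I_3 := @Ordinal 3 2 isT.

Let ord3 (i : 'I_3) : [\/ i = r0, i = r1 | i = r2].
Proof.
by case: i => [[|[|[|//]]] i3]; [constructor 1|constructor 2|constructor 3]; apply: val_inj.
Qed.

Let row_disj x : x \in row r0 -> x \in row r1 -> False.
Proof. by move=> /(C_inj cr) h /h. Qed.
Let row_disj12 x : x \in row r1 -> x \in row r2 -> False.
Proof. by move=> /(C_inj cr) h /h. Qed.
Let row_disj02 x : x \in row r0 -> x \in row r2 -> False.
Proof. by move=> /(C_inj cr) h /h. Qed.

Lemma col_next_row j x y : col_next C d j x y -> x \in row r1 \/ y \in row r1.
Proof.
move=> nxt; have e := col_next_edge dP nxt; have [xj yj _] := nxt.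
have [i xi] := covered cr minC xj; have [i' yi] := covered cr minC yj.
have same k : x \in row k -> y \in row k -> False.
  by move=> xk yk; apply: (no_edge_in_cell cr minC e xk yk xj yj).
have e' : edge y x by rewrite edge_sym.
rewrite /= in xi yi.
case: (ord3 i) (ord3 i') xi yi => -> [] -> xi yi; auto; case: (same _ xi yi) ||
  by [case: (no_edge_outer_rows cr dP (_ : r0 < r1) (_ : r1 < r2) e xi yi)
     |case: (no_edge_outer_rows cr dP (_ : r0 < r1) (_ : r1 < r2) e' yi xi)].
Qed.

Lemma pos_gt0 j x : x \in col j -> x \notin row r2 -> 0 < pos false j x.
Proof.
move=> xj x2; have [i xi] := covered cr minC xj.
have i2 : i < r2 by case: (ord3 i) xi x2 => -> //= ->.
by have [z [_ _]] := earlier_lower_row cr dP i2 xi xj; apply: leq_ltn_trans.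
Qed.

Lemma pos_lt_last j x :
  x \in col j -> x \notin row r0 -> (pos false j x).+1 < size (d false j).
Proof.
move=> xj x0; have [i xi] := covered cr minC xj.
have i0 : r0 < i by case: (ord3 i) xi x0 => -> //= ->.
have [z [_ zj lt]] := later_upper_row cr dP i0 xi xj.
by apply: leq_ltn_trans lt _; rewrite index_mem (mem_d dP).
Qed.

Lemma col_succ j x : x \in col j -> (pos false j x).+1 < size (d false j) ->
  exists y, col_next C d j x y /\ pos false j y = (pos false j x).+1.
Proof.
move=> xj lt; exists (nth x (d false j) (pos false j x).+1).
rewrite /col_next /pos index_uniq ?(uniq_d dP) //; split=> //; split=> //; last by left.
by rewrite -(mem_d dP) mem_nth.
Qed.

Lemma col_pred j x : x \in col j -> 0 < pos false j x ->
  exists y, col_next C d j x y /\ pos false j x = (pos false j y).+1.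
Proof.
move=> xj lt; exists (nth x (d false j) (pos false j x).-1).
have ls : (pos false j x).-1 < size (d false j).
  by apply: leq_ltn_trans (leq_pred _) _; rewrite index_mem (mem_d dP).
have e : pos false j (nth x (d false j) (pos false j x).-1) = (pos false j x).-1.
  by rewrite [LHS]index_uniq ?(uniq_d dP).
rewrite /col_next -/(pos _ _ _) -/(pos _ _ _) e prednK //; split=> //; split=> //.
  by rewrite -(mem_d dP) mem_nth.
by right.
Qed.

Lemma col_next_sym j x y : col_next C d j x y -> col_next C d j y x.
Proof. by case=> ? ? [?|?]; split=> //; [right|left]. Qed.

Lemma outer_next_middle i v :
  i != r1 -> v \in row i -> exists j w, w \in row r1 /\ col_next C d j v w.
Proof.
move=> i1 vi; have [j vj] := covered cr minC vi; exists j.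
suff [w vw] : exists w, col_next C d j v w.
  exists w; split=> //; case: (col_next_row vw) => // v1.
  by rewrite (C_inj cr vi v1) eqxx in i1.
have [v0|v0] := boolP (v \in row r0).
  have v2 : v \notin row r2 by apply/negP => /(row_disj02 v0).
  by have [w [vw _]] := col_pred vj (pos_gt0 vj v2); exists w.
by have [w [vw _]] := col_succ vj (pos_lt_last vj v0); exists w.
Qed.

Lemma no_turn_outer i j a c a' : i != r1 -> a \in row i -> a' \in row i ->
  c \in row r1 -> a != a' -> col_next C d j a c -> col_next C d j a' c -> False.
Proof.
move=> i1; apply: (no_turn cr minC dP i1).
by move=> v; apply: outer_next_middle.
Qed.

(** A vertex of the middle row is not an end of its column, and its two neighbours
there lie in different rows because columns do not turn in the middle row. *)
Lemma middle_next_outer i v :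
  i != r1 -> v \in row r1 -> exists j w, w \in row i /\ col_next C d j v w.
Proof.
move=> i1 v1; have [j vj] := covered cr minC v1; exists j.
have v0 : v \notin row r0 by apply/negP => v0; exact: (row_disj v0 v1).
have v2 : v \notin row r2 by apply/negP => v2; exact: (row_disj12 v1 v2).
have [a [va pa]] := col_pred vj (pos_gt0 vj v2).
have [b [vb pb]] := col_succ vj (pos_lt_last vj v0).
have ab : a != b by apply/eqP => e; move: pa pb; rewrite e => ->; lia.
have outer w : col_next C d j v w -> exists k, k != r1 /\ w \in row k.
  move=> vw; have [_ wj _] := vw; have [k wk] := covered cr minC wj; exists k.
  split=> //; apply: contraTneq v1 => k1; subst k; apply/negP => v1.
  exact: (no_edge_in_cell cr minC (col_next_edge dP vw) v1 wk vj wj).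
have [k [k1 ak]] := outer _ va; have [l [l1 bl]] := outer _ vb.
have kl : k != l.
  apply/eqP => kl; rewrite -kl in bl.
  exact: (no_turn_outer k1 ak bl v1 ab (col_next_sym va) (col_next_sym vb)).
case: (ord3 i) (ord3 k) (ord3 l) i1 k1 l1 kl ak bl => -> [] -> [] -> //= _ _ _ _ ak bl;
  by [exists a|exists b].
Qed.

Lemma no_turn_middle i j a c a' : i != r1 -> a \in row r1 -> a' \in row r1 ->
  c \in row i -> a != a' -> col_next C d j a c -> col_next C d j a' c -> False.
Proof.
move=> i1; apply: (no_turn cr minC dP); first by rewrite eq_sym.
by move=> v; apply: middle_next_outer.
Qed.

(** Without turns a column walks straight from the last row to the first. *)
Lemma col_three j : exists a b c, [/\ d false j = [:: a; b; c],
  a \in row r2, b \in row r1 & c \in row r0].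
Proof.
have sd := mem_d dP; have ud := uniq_d dP false j.
have [a aj pa] : exists2 a, a \in col j & pos false j a = 0.
  have [a [_ aj]] := row_col_meet cr r0 j; exists (head a (d false j)).
    by rewrite -sd -nth0 mem_nth // -has_predT; apply/hasP; exists a; rewrite ?sd.
  by rewrite /pos; case: (d false j) => //= x s; rewrite eqxx.
have a2 : a \in row r2.
  by apply: contraT => /(pos_gt0 aj); rewrite pa.
have a0 : a \notin row r0 by apply/negP => a0; exact: (row_disj02 a0 a2).
have a1 : a \notin row r1 by apply/negP => a1; exact: (row_disj12 a1 a2).
have [b [ab pb]] := col_succ aj (pos_lt_last aj a0).
have b1 : b \in row r1 by case: (col_next_row ab) => // a1'; rewrite a1' in a1.
have b0 : b \notin row r0 by apply/negP => b0; exact: (row_disj b0 b1).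
have [_ bj _] := ab; have [c [bc pc]] := col_succ bj (pos_lt_last bj b0).
have [_ cj _] := bc.
have c0 : c \in row r0.
  have [i /= ci] := covered cr minC cj; case: (ord3 i) ci => -> // ci.
    by case: (no_edge_in_cell cr minC (col_next_edge dP bc) b1 ci bj cj).
  have ac : a != c by apply/eqP => e; move: pc; rewrite -e pb pa.
  by case: (@no_turn_outer r2 j a b c isT a2 ci b1 ac ab (col_next_sym bc)).
have size3 : size (d false j) <= 3.
  rewrite leqNgt; apply/negP => lt; have lt' : (pos false j c).+1 < size (d false j).
    by rewrite pc pb pa.
  have [e [ce pe]] := col_succ cj lt'; have [_ ej _] := ce.
  have e1 : e \in row r1 by case: (col_next_row ce) => // c1; case: (row_disj c0 c1).
  have be : b != e by apply/eqP => e'; move: pe; rewrite -e' pc pb pa.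
  exact: (@no_turn_middle r0 j b c e isT b1 e1 c0 be bc (col_next_sym ce)).
exists a, b, c; split=> //; move: pa pb pc size3 aj bj cj; rewrite -!sd /pos.
move: ud; case: (d false j) => // x [|y [|z [|//]]] //= ud; rewrite !inE;
  repeat case: eqP => //=; move=> *; subst => //.
Qed.

End GridFromMinimalCrossing.

(** Each row meets each column in exactly one vertex [c i j]. In the last row these
vertices come in the order of the columns, since otherwise a row tail and a column
would avoid each other; the other rows inherit the order because links do not
cross. *)
Lemma grid_of_minimal_crossing (H : sgraph) (S : nat -> {set H})
    (C : bool -> 'I_3 -> {set H}) :
    crossing S C ->
    (forall (H' : sgraph) S' (C' : bool -> 'I_3 -> {set H'}),
      is_minor H' H -> crossing S' C' -> linkage_size C <= linkage_size C') ->
  is_minor (grid 4 4) H.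
Proof.
move=> cr minC.
have [d0 dP0] : exists f : bool * 'I_3 -> seq H,
    forall bi, is_linking_path S C bi.1 bi.2 (f bi).
  apply: (fin_all_exists (P := fun bi s => is_linking_path S C bi.1 bi.2 s)) => bi.
  exact: (linking_path_exists cr minC).
pose d b i := d0 (b, i).
have dP b i : is_linking_path S C b i (d b i) := dP0 (b, i).
pose r0 : 'I_3 := @Ordinal 3 0 isT.
pose r1 : 'I_3 := @Ordinal 3 1 isT.
pose r2 : 'I_3 := @Ordinal 3 2 isT.
have ord3 (i : 'I_3) : [\/ i = r0, i = r1 | i = r2].
  by case: i => [[|[|[|//]]] i3]; [constructor 1|constructor 2|constructor 3]; apply: val_inj.
have [x0 _] := row_col_meet cr r0 r0.
pose c (i j : 'I_3) := nth x0 (d false j) (2 - i).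
pose p i j := index (c i j) (d true i).
have cC i j : c i j \in C true i /\ c i j \in C false j.
  rewrite -[_ \in C false j](mem_d dP).
  have [x [y [z [e x2 y1 z0]]]] := col_three cr minC dP j; rewrite /c e.
  by case: (ord3 i) => -> /=; rewrite ?x2 ?y1 ?z0 !inE eqxx ?orbT.
have c_row i j : c i j \in C true i by case: (cC i j).
have c_col i j : c i j \in C false j by case: (cC i j).
have c_uniq i j x : x \in C true i -> x \in C false j -> x = c i j.
  rewrite -[_ \in C false j](mem_d dP) => xi.
  have [a [b [z [e a2 b1 z0]]]] := col_three cr minC dP j; rewrite /c e !inE.
  have inj := C_inj cr xi.
  case: (ord3 i) xi inj => -> xi inj /or3P[]/eqP xe; subst x => //=;
    by [have := inj _ a2|have := inj _ b1|have := inj _ z0].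
have c_edge (i i' : 'I_3) j : i = i'.+1 :> nat -> edge (c i j) (c i' j).
  move=> ii; apply: (pos_edge dP (c_col _ _) (c_col _ _)).
  have [a [b [z [e _ _ _]]]] := col_three cr minC dP j.
  have s3 : size (d false j) = 3 by rewrite e.
  have := ltn_ord i; have := ltn_ord i' => lt' lt.
  by rewrite /c !index_uniq ?(uniq_d dP) ?s3; lia.
have c_head (j : 'I_3) : adj (S (4 + j)) [set c r2 j].
  apply: (pos_first dP (b := false)); rewrite /c index_uniq ?(uniq_d dP) //.
  by have [a [b [z [-> _ _ _]]]] := col_three cr minC dP j.
have p_neq i j k : j != k -> p i j != p i k.
  move=> jk; apply: contra_neq jk => /(pos_inj dP (c_row i j)) e.
  by apply: (C_inj cr (c_col i j)); rewrite e.
have mono2 (j k : 'I_3) : j < k -> p r2 j < p r2 k.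
  move=> jk; have jk' : j != k by rewrite neq_ltn jk.
  rewrite ltn_neqAle p_neq //= leqNgt; apply/negP => lt.
  have [v [vX vY]] : exists v, v \in from d true r2 (p r2 j) /\ v \in C false k.
    apply: (no_parallel_rows cr (i := 4 + j) (j := 4 + k)).
    - by rewrite ltn_add2l.
    - by have := ltn_ord k; lia.
    - exact: (from_connected dP).
    - exact: (cr_Cconn cr).
    - by move=> v; rewrite (in_from dP) => /andP[v2 _]; exists true, r2.
    - by move=> v vk; exists false, k.
    - apply: (adj_sub _ _ (c_head j)) => //; apply/subsetP => v /set1P->.
      by rewrite (in_from dP) c_row leqnn.
    - exact: (from_hub dP (c_row r2 j)).
    - exact: (cr_anchor cr false).
    - exact: (cr_hub cr false).
  move: vX; rewrite (in_from dP) => /andP[v2]; rewrite (c_uniq _ _ _ v2 vY).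
  by rewrite leqNgt lt.
have mono_down (i i' : 'I_3) : i = i'.+1 :> nat ->
    (forall j k : 'I_3, j < k -> p i j < p i k) ->
    forall j k : 'I_3, j < k -> p i' j < p i' k.
  move=> ii mono j k jk; have jk' : j != k by rewrite neq_ltn jk.
  rewrite ltn_neqAle p_neq //= leqNgt; apply/negP => lt.
  have ine : i != i' by apply: contra_eqN ii => /eqP->; rewrite neq_ltn ltnSn.
  exact: (no_crossing_links cr minC dP ine (c_row i j) (c_row i k) (c_row i' j)
    (c_row i' k) (c_col _ _) (c_col _ _) (c_col _ _) (c_col _ _)
    (c_edge _ _ j ii) (c_edge _ _ k ii) (mono _ _ jk) lt).
have mono1 := mono_down r2 r1 erefl mono2.
have mono0 := mono_down r1 r0 erefl mono1.
have p_eq i (j : 'I_3) : p i j = j.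
  have mono (k l : 'I_3) : k < l -> p i k < p i l.
    by case: (ord3 i) => ->; [apply: mono0|apply: mono1|apply: mono2].
  have s3 : size (d true i) <= 3.
    apply: (@uniq_leq_size _ _ [:: c i r0; c i r1; c i r2]); first exact: (uniq_d dP).
    move=> x; rewrite (mem_d dP) => xi; have [k xk] := covered cr minC xi.
    rewrite (c_uniq _ _ _ xi xk) !inE.
    by case: (ord3 k) => ->; rewrite eqxx ?orbT.
  have p3 : p i r2 < size (d true i) by rewrite (pos_lt dP) c_row.
  have := mono r0 r1 isT; have := mono r1 r2 isT.
  by case: (ord3 j) => -> /=; lia.
have row_edge i (j k : 'I_3) : k = j.+1 :> nat -> edge (c i j) (c i k).
  move=> jk; apply: (pos_edge dP (c_row i j) (c_row i k)).
  by rewrite -/(p i j) -/(p i k) !p_eq.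
have row_head (i : 'I_3) : adj (S i) [set c i r0].
  by apply: (pos_first dP (b := true)); exact: p_eq.
have inord3 : ((inord 0 = r0) * (inord 1 = r1) * (inord 2 = r2))%type.
  by split; [split|]; apply: val_inj; rewrite /= inordK.
(* The first row of the grid lies on the path of the anchors 3 to 6, and its
   first column on the anchors 3 to 0. *)
pose g r k : {set H} := if r == 0 then S (3 + k) else
  if k == 0 then S (3 - r) else [set c (inord (3 - r)) (inord k.-1)].
have g_hor r k : r < 4 -> k < 3 -> adj (g r k) (g r k.+1).
  case: r => [|r] r4 k3; first by rewrite /g /= addnS; apply: (cr_path cr); lia.
  rewrite /g /=; case: k k3 => [|k] k3 /=.
    by rewrite !inord3; have := row_head (inord (3 - r.+1)); rewrite inordK //; lia.
  apply/adjP; exists (c (inord (3 - r.+1)) (inord k)), (c (inord (3 - r.+1)) (inord k.+1)).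
  by rewrite !inE; split=> //; apply: row_edge; rewrite !inordK //; lia.
have g_ver r k : r < 3 -> k < 4 -> adj (g r k) (g r.+1 k).
  move=> r3; rewrite /g; case: k => [|k] k4 /=.
    have -> : (if r == 0 then S (3 + 0) else S (3 - r)) = S (3 - r).
      by case: r r3.
    have -> : 3 - r = (3 - r.+1).+1 by lia.
    by rewrite adj_sym; apply: (cr_path cr); lia.
  case: r r3 => [|r] r3 /=.
    by rewrite inord3; have := c_head (inord k); rewrite inordK // addnS.
  apply/adjP; exists (c (inord (3 - r.+1)) (inord k)), (c (inord (3 - r.+2)) (inord k)).
  by rewrite !inE; split=> //; apply: c_edge; rewrite !inordK //; lia.
have S0 k : k < 9 -> S k != set0.
  move=> k9; have nz (A B : {set H}) : adj A B -> A != set0 /\ B != set0.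
    by case/adjP => a [b [aA bB _]]; split; apply/set0Pn; [exists a|exists b].
  have [k6|k6] := ltnP k 6; first by case: (nz _ _ (cr_path cr k6)).
  have [->|[->|->]] : k = 6 \/ k = 7 \/ k = 8 by lia.
  - by case: (nz _ _ (cr_path cr (i := 5) isT)).
  - by case: (nz _ _ (cr_hub cr true r0)).
  - by case: (nz _ _ (cr_hub cr false r0)).
exists (fun v : 'I_4 * 'I_4 => g v.1 v.2); split.
- case=> [[r r4] [k k4]] /=; rewrite /g; case: r r4 => [|r] r4 /=; first by apply: S0; lia.
  case: k k4 => [|k] k4 /=; first by apply: S0; lia.
  by apply/set0Pn; eexists; apply: set11.
- case=> [[r r4] [k k4]] /=; rewrite /g; case: r r4 => [|r] r4 /=.
    by apply: (cr_conn cr); lia.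
  case: k k4 => [|k] k4 /=; first by apply: (cr_conn cr); lia.
  exact: connected1.
- case=> [[r r4] [k k4]] [[r' r4'] [k' k4']] /= ne.
  have {ne} : ~ (r = r' /\ k = k').
    move=> [rr kk]; subst; case/eqP: ne; congr pair; exact: val_inj.
  have cS i j n : n < 9 -> [disjoint [set c i j] & S n].
    by move=> n9; rewrite disjoints1 (disjointFr (cr_CS cr true i n9) (c_row i j)).
  rewrite /g; case: r r4 => [|r] r4; case: r' r4' => [|r'] r4' /=.
  + by move=> ne; apply: (cr_disj cr); lia.
  + case: k' k4' => [|k'] k4' ne /=; first by apply: (cr_disj cr); lia.
    by rewrite disjoint_sym; apply: cS; lia.
  + by case: k k4 => [|k] k4 ne /=; [apply: (cr_disj cr); lia|apply: cS; lia].
  + case: k k4 => [|k] k4; case: k' k4' => [|k'] k4' ne /=.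
    * by apply: (cr_disj cr); lia.
    * by rewrite disjoint_sym; apply: cS; lia.
    * by apply: cS; lia.
    * rewrite disjoints1 inE; apply/eqP => e.
      have := C_inj cr (c_row (inord (3 - r.+1)) (inord k)).
      rewrite e => /(_ _ (c_row _ _))/(congr1 val) /=; rewrite !inordK; [|lia..].
      have := C_inj cr (c_col (inord (3 - r.+1)) (inord k)).
      rewrite e => /(_ _ (c_col _ _))/(congr1 val) /=; rewrite !inordK; [|lia..].
      lia.
- case=> [[r r4] [k k4]] [[r' r4'] [k' k4']] /= e.
  apply/adjP; move: e; rewrite /edge /= /cartesian_rel /path_rel /= -!val_eqE /=.
  case/orP=> /andP[/eqP/= e0 /orP[]/eqP/= e]; subst.
  + by apply: g_hor => //; lia.
  + by rewrite adj_sym; apply: g_hor => //; lia.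
  + by apply: g_ver => //; lia.
  + by rewrite adj_sym; apply: g_ver => //; lia.
Qed.

(** A smallest crossing among those in minors of [H] is a grid already. *)
Theorem grid_of_crossing (H : sgraph) (S : nat -> {set H})
    (C : bool -> 'I_3 -> {set H}) :
  crossing S C -> is_minor (grid 4 4) H.
Proof.
have [n] := ubnP (linkage_size C); elim: n H S C => // n IH H S C le cr.
apply: contrapT => no; apply: (no); apply: (grid_of_minimal_crossing cr).
move=> H' S' C' mH cr'; rewrite leqNgt; apply/negP => lt; apply: no.
by apply: is_minor_trans mH; apply: IH cr'; lia.
Qed.

(** * Menger's theorem *)

Lemma split_first (T : Type) (a : pred T) s : has a s ->
  exists s1 z s2, [/\ s = s1 ++ z :: s2, a z & ~~ has a s1].
Proof.
elim: s => //= x s IH; case: (boolP (a x)) => ax /=.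
  by move=> _; exists [::], x, s.
by case/IH=> s1 [z [s2 [-> az ns]]]; exists (x :: s1), z, s2; rewrite /= negb_or ax.
Qed.

Lemma split_last (T : Type) (a : pred T) s : has a s ->
  exists s1 z s2, [/\ s = s1 ++ z :: s2, a z & ~~ has a s2].
Proof.
elim: s => //= x s IH; case: (boolP (has a s)) => [/IH[s1 [z [s2 [-> az ns]]]] _|ns].
  by exists (x :: s1), z, s2.
by rewrite orbF => ax; exists [::], x, s.
Qed.

Section Menger.
Variable T : finType.
Implicit Types (e : rel T) (A B S : {set T}).

Definition abpath e A B x p :=
  [/\ x \in A, path e x p, last x p \in B & uniq (x :: p)].

Lemma walk_abpath e A B x p : x \in A -> path e x p -> last x p \in B ->
  exists q, abpath e A B x q /\ {subset x :: q <= x :: p}.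
Proof.
move=> xA pp; case: (shortenP pp) => q qp uq sq lB; exists q; split=> // z.
by rewrite !inE => /orP[->//|/sq->]; rewrite orbT.
Qed.

Lemma abpath_sub e e' A B x p : (forall u v, u \in x :: p -> v \in p -> e u v -> e' u v) ->
  abpath e A B x p -> abpath e' A B x p.
Proof.
move=> h [xA pp lB up]; split=> //.
elim: p x h pp {xA lB up} => //= z p IH x h /andP[xz zp].
rewrite h ?mem_head //=; apply: IH => // u v uz vp.
by apply: h; rewrite inE ?uz ?vp orbT.
Qed.

Definition has_avoiding_path e A B S :=
  exists x p, abpath e A B x p /\ {in x :: p, forall v, v \notin S}.

(** Menger's theorem for directed graphs, by induction on the number of edges (proof of
Goering). If deleting the edge [x y] creates a separator [S] of fewer than [k]
vertices, then [x |: S] and [y |: S] have exactly [k] vertices, and paths from [A] to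
the first and from the second to [B] that avoid the edge meet only in [S]; they are
joined there and along the edge. *)
Lemma menger e A B k :
    (forall S, #|S| < k -> has_avoiding_path e A B S) ->
  exists (h : 'I_k -> T) (t : 'I_k -> seq T),
    (forall i, abpath e A B (h i) (t i)) /\
    (forall i j v, v \in h i :: t i -> v \in h j :: t j -> i = j).
Proof.
have [n] := ubnP #|[set z : T * T | e z.1 z.2]|; elim: n e A B => // n IH e A B len hyp.
have [[x [y exy]]|noe] := pselect (exists x y, e x y); last first.
  have kAB : k <= #|A :&: B|.
    rewrite leqNgt; apply/negP => /hyp[x [[|y p] [[xA pp lB _] av]]].
      by have := av x (mem_head _ _); rewrite inE xA lB.
    by apply: noe; exists x, y; case/andP: pp.
  exists (fun i => enum_val (widen_ord kAB i)), (fun _ => [::]); split.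
    move=> i; have := enum_valP (widen_ord kAB i); rewrite inE => /andP[? ?].
    by split.
  move=> i j v; rewrite !inE => /eqP-> /eqP/enum_val_inj/(congr1 val) /=.
  exact: val_inj.
pose e' u v := e u v && ((u, v) != (x, y)).
have ee' : subrel e' e by move=> u v /andP[].
have len' : #|[set z : T * T | e' z.1 z.2]| < n.
  rewrite -ltnS; apply: leq_trans len; rewrite ltnS; apply: proper_card.
  apply/properP; split; first by apply/subsetP => -[u v]; rewrite !inE => /ee'.
  by exists (x, y); rewrite inE /= ?/e' ?eqxx ?andbF.
have [hyp'|] := pselect (forall S, #|S| < k -> has_avoiding_path e' A B S).
  have [h [t [ht dt]]] := IH e' A B len' hyp'; exists h, t; split=> // i.
  by apply: abpath_sub (ht i) => u v _ _ /ee'.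
move=> /existsNP[S] /not_implyP[Sk sep].
have sep' z p : abpath e' A B z p -> {in z :: p, forall v, v \notin S} -> False.
  by move=> zp av; apply: sep; exists z, p.
have uses z p : abpath e A B z p -> {in z :: p, forall v, v \notin S} ->
    (x \in z :: p) /\ (y \in z :: p).
  move=> zp av; split; apply: contrapT => /negP nx; apply: (sep' z p) => //;
    apply: abpath_sub zp => u v uz vz euv; rewrite /e' euv /=.
  - by apply: contraNneq nx => -[<- _].
  - by apply: contraNneq nx => -[_ <-]; rewrite inE vz orbT.
have big z : (forall w p, abpath e A B w p -> {in w :: p, forall v, v \notin S} ->
    z \in w :: p) -> z \notin S /\ #|z |: S| = k.
  move=> hz; have : k <= #|z |: S|.
    rewrite leqNgt; apply/negP => /hyp[w [p [wp av]]].
    have av' : {in w :: p, forall v, v \notin S}.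
      by move=> v /av; rewrite !inE negb_or => /andP[].
    by have := av z (hz w p wp av'); rewrite !inE eqxx.
  by rewrite cardsU1; case: (z \in S) => /=; lia.
have [xS xk] := big x (fun w p wp av => (uses w p wp av).1).
have [yS yk] := big y (fun w p wp av => (uses w p wp av).2).
set P := x |: S in xk; set Q := y |: S in yk.
have meetS z p (R : {set T}) : abpath e A B z p -> S \subset R ->
    x \in R \/ y \in R -> ~~ has (mem R) (z :: p) -> False.
  move=> zp SR xyR /hasPn no.
  have av : {in z :: p, forall v, v \notin S}.
    by move=> v vz; apply: contra (no v vz) => /(subsetP SR).
  have [xz yz] := uses z p zp av.
  by case: xyR => [xR|yR]; [have := no x xz|have := no y yz]; rewrite /= ?xR ?yR.
(* the part of a path up to its first vertex in [P] does not use the edge *)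
have [hp [tp [pP pD]]] : exists (h : 'I_k -> T) (t : 'I_k -> seq T),
    (forall i, abpath e' A P (h i) (t i)) /\
    (forall i j v, v \in h i :: t i -> v \in h j :: t j -> i = j).
  apply: IH len' _ => W /hyp[z [p [zp av]]].
  have [no|/negPn/split_first[s1 [w [s2 [es wP ns1]]]]] := boolP (~~ has (mem P) (z :: p)).
    by case: (meetS z p P zp (subsetUr _ _) _ no); left; rewrite inE set11.
  have [zA pp lB up] := zp.
  case: s1 es ns1 => [|z' s1] /= [ez ep] ns1; subst.
    exists w, [::]; split; first by split.
    by move=> v; rewrite inE => /eqP->; apply: av; rewrite mem_head.
  exists z', (rcons s1 w); split; last first.
    move=> v vz; apply: av; move: vz.
    by rewrite !inE mem_rcons mem_cat !inE => /or3P[]->; rewrite ?orbT.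
  move: up; rewrite -cat_rcons -cat_cons cat_uniq => /andP[u1 _].
  move: pp; rewrite -cat_rcons cat_path => /andP[pr _].
  split; rewrite ?last_rcons //; move: pr ns1.
  elim: s1 z' {u1 av zp lB zA} => [|a s1 IHs] z' /=.
    rewrite andbT /e' => ->; rewrite orbF => zP; rewrite andbT /=.
    by apply: contraNneq zP => -[-> _]; rewrite inE set11.
  case/andP=> za pa; rewrite negb_or => /andP[zP ns]; rewrite IHs // andbT /e' za /=.
  by apply: contraNneq zP => -[-> _]; rewrite inE set11.
(* the part of a path from its last vertex in [Q] does not use the edge *)
have [hq [tq [qQ qD]]] : exists (h : 'I_k -> T) (t : 'I_k -> seq T),
    (forall i, abpath e' Q B (h i) (t i)) /\
    (forall i j v, v \in h i :: t i -> v \in h j :: t j -> i = j).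
  apply: IH len' _ => W /hyp[z [p [zp av]]].
  have [no|/negPn/split_last[s1 [w [s2 [es wQ ns2]]]]] := boolP (~~ has (mem Q) (z :: p)).
    by case: (meetS z p Q zp (subsetUr _ _) _ no); right; rewrite inE set11.
  have [zA pp lB up] := zp; exists w, s2; split; last first.
    by move=> v vz; apply: av; rewrite es mem_cat vz orbT.
  have lw : last z p = last w s2 by rewrite -[LHS](last_cons z) es last_cat.
  have pw : path e w s2.
    case: s1 es => [[<- <-//]|z' s1 [_ ep]].
    by move: pp; rewrite ep cat_path /= => /and3P[].
  have : abpath e Q B w s2.
    split=> //; first by rewrite -lw.
    by move: up; rewrite es cat_uniq => /and3P[].
  apply: abpath_sub => u v _ vs; rewrite /e' => ->; apply: contraNneq ns2 => -[_ vy].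
  by apply/hasP; exists v; rewrite // vy; exact: setU11.
pose lp i := last (hp i) (tp i).
have lp_in i : lp i \in hp i :: tp i by apply: mem_last.
have lp_inj : injective lp by move=> i j e0; apply: (pD i j (lp i)); rewrite // e0.
have hq_inj : injective hq by move=> i j e0; apply: (qD i j (hq i)); rewrite ?mem_head // e0 mem_head.
have onto (f : 'I_k -> T) (R : {set T}) : injective f -> (forall i, f i \in R) ->
    #|R| = k -> forall v, v \in R -> exists i, v = f i.
  move=> fi fR Rk v; have : f @: [set: 'I_k] == R.
    rewrite eqEcard card_imset // cardsT card_ord Rk leqnn andbT.
    by apply/subsetP => _ /imsetP[i _ ->].
  by move/eqP<- => /imsetP[i _ ->]; exists i.
have lp_onto := onto lp P lp_inj (fun i => let: And4 _ _ l _ := pP i in l) xk.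
have hq_onto := onto hq Q hq_inj (fun i => let: And4 l _ _ _ := qQ i in l) yk.
have p_meet i v : v \in hp i :: tp i -> v \in P -> v = lp i.
  by move=> vp /lp_onto[j vj]; rewrite (pD i j v vp) // vj.
have q_meet i v : v \in hq i :: tq i -> v \in Q -> v = hq i.
  by move=> vp /hq_onto[j vj]; rewrite (qD i j v vp) // vj mem_head.
have common i j v : v \in hp i :: tp i -> v \in hq j :: tq j -> v \in S.
  move=> vp vq; apply: contraT => vS; exfalso.
  have [hA pp _ up] := pP i; have [hQ pq lB uq] := qQ j.
  have vSP w : w \in S -> w \in P by move=> wS; rewrite inE wS orbT.
  have vSQ w : w \in S -> w \in Q by move=> wS; rewrite inE wS orbT.
  have [r1 [p1 l1 s1]] : exists r, [/\ path e' (hp i) r, last (hp i) r = v &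
      {in hp i :: r, forall w, w \notin S}].
    case/splitPl: {-1}(tp i) / vp (erefl (tp i)) => r1 r2 l1 et.
    exists r1; split=> //; first by move: pp; rewrite et cat_path => /andP[].
    move=> w wr; apply/negP => wS.
    have wl : w = lp i by apply: p_meet (vSP _ wS); rewrite et -cat_cons mem_cat wr.
    move: up; rewrite et -cat_cons cat_uniq => /and3P[_ /hasPn no _].
    have vw : v <> w by move=> vw; rewrite vw wS in vS.
    case: r2 et no => [|b r2] et no; first by apply: vw; rewrite wl /lp et cats0 l1.
    have /no : lp i \in b :: r2 by rewrite /lp et last_cat /= mem_last.
    by rewrite /= -wl wr.
  have [r2 [p2 l2 s2]] : exists r, [/\ path e' v r, last v r = last (hq j) (tq j) &
      {in v :: r, forall w, w \notin S}].
    case/splitPl: {-1}(tq j) / vq (erefl (tq j)) => r2 r3 l2 et.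
    exists r3; split=> [||w]; [by move: pq; rewrite et cat_path l2 => /andP[]|by rewrite last_cat l2|].
    rewrite inE => /orP[/eqP->//|wr]; apply/negP => wS.
    have wl : w = hq j by apply: q_meet (vSQ _ wS); rewrite et -cat_cons mem_cat wr orbT.
    move: uq; rewrite et -cat_cons cat_uniq => /and3P[_ /hasPn/(_ w wr) no _].
    by rewrite /= wl mem_head in no.
  have [r [ab sr]] : exists r, abpath e' A B (hp i) r /\ {subset hp i :: r <= hp i :: r1 ++ r2}.
    by apply: walk_abpath; rewrite ?cat_path ?last_cat ?l1 ?p1 ?l2.
  apply: (sep' _ _ ab) => w /sr; rewrite -cat_cons mem_cat => /orP[/s1//|wr].
  by apply: s2; rewrite inE wr orbT.
pose tgt i := if lp i \in S then lp i else y.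
have tgtQ i : tgt i \in Q by rewrite /tgt; case: ifP => [lS|_]; rewrite !inE ?lS ?eqxx ?orbT.
have [sg sgP] : exists sg : 'I_k -> 'I_k, forall i, tgt i = hq (sg i).
  by apply: (fin_all_exists (P := fun i j => tgt i = hq j)) => i; apply: hq_onto.
have lpx i : lp i \notin S -> lp i = x.
  by have [_ _] := pP i; rewrite -/(lp i) inE => /orP[/set1P//|->].
have sg_inj : injective sg.
  move=> i j /(congr1 hq); rewrite -!sgP /tgt.
  case: ifP => li; case: ifP => lj e0.
  - exact: lp_inj.
  - by rewrite -e0 li in yS.
  - by rewrite e0 lj in yS.
  - by apply: lp_inj; rewrite (lpx i) ?li // (lpx j) ?lj.
pose t i := tp i ++ (if lp i \in S then tq (sg i) else hq (sg i) :: tq (sg i)).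
have in_t i v : v \in hp i :: t i -> v \in hp i :: tp i \/ v \in hq (sg i) :: tq (sg i).
  rewrite -cat_cons mem_cat => /orP[|]; first by left.
  by case: ifP => _ vq; right; rewrite // inE vq orbT.
have cross i j v : v \in hp i :: tp i -> v \in hq (sg j) :: tq (sg j) -> i = j /\ v = lp i /\ v \in S.
  move=> vp vq; have vS := common _ _ _ vp vq.
  have vl : v = lp i by apply: p_meet vp _; rewrite inE vS orbT.
  have vh : v = hq (sg j) by apply: q_meet vq _; rewrite inE vS orbT.
  split=> //; move: vh; rewrite -sgP /tgt; case: ifP => _ vh.
    by apply: (pD i j v vp); rewrite vh.
  by rewrite -vh vS in yS.
exists hp, t; split=> [i|i j v /in_t[vi|vi] /in_t[vj|vj]]; last first.
- exact/sg_inj/(qD _ _ v).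
- by case: (cross j i v vj vi) => ->.
- by case: (cross i j v vi vj) => ->.
- exact: pD vi vj.
have [hA pp _ up] := pP i; have [hQ pq lB uq] := qQ (sg i).
rewrite /t; have := sgP i; rewrite /tgt; case: ifP => li hy.
  split=> //; rewrite ?cat_path ?last_cat -/(lp i) ?hy //.
  - by rewrite (sub_path ee' pp) (sub_path ee' pq).
  - rewrite -cat_cons cat_uniq up; move: uq => /= /andP[hn ->]; rewrite andbT /=.
    apply/hasPn => v vq; apply/negP => /= vp.
    have [_ [vl _]] := cross i i v vp (mem_behead (s := _ :: _) vq).
    by rewrite -hy -vl vq in hn.
have lx : lp i = x by apply: lpx; rewrite li.
split=> //; rewrite ?cat_path ?last_cat -/(lp i) //.
- by rewrite (sub_path ee' pp) /= (sub_path ee' pq) -hy lx exy.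
- rewrite -cat_cons cat_uniq up uq andbT; apply/hasPn => v vq; apply/negP => vp.
  by have [_ [vl vS]] := cross i i v vp vq; rewrite -vl vS in li.
Qed.

Lemma menger_all e A B :
    (forall S, #|S| < #|A| -> has_avoiding_path e A B S) ->
  exists t : T -> seq T, (forall x, x \in A -> abpath e A B x (t x)) /\
    (forall x y v, x \in A -> y \in A -> v \in x :: t x -> v \in y :: t y -> x = y).
Proof.
case/menger=> h [t [ht dt]].
have h_inj : injective h.
  by move=> i j e0; apply: (dt i j (h i)); rewrite ?mem_head // e0 mem_head.
have hA : h @: [set: 'I_#|A|] = A.
  apply/eqP; rewrite eqEcard card_imset // cardsT card_ord leqnn andbT.
  by apply/subsetP => _ /imsetP[i _ ->]; case: (ht i).
pose g x := if [pick i | h i == x] is Some i then t i else [::].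
have gE i : g (h i) = t i.
  by rewrite /g; case: pickP => [j /eqP/h_inj->//|/(_ i)]; rewrite eqxx.
exists g; split=> [x|x y v]; rewrite -{1}hA => /imsetP[i _ ->]; first by rewrite gE.
by rewrite -{1}hA => /imsetP[j _ ->]; rewrite !gE => vi vj; rewrite (dt i j v).
Qed.

End Menger.

Lemma disjoint_setUr (T : finType) (A B C : {set T}) :
  [disjoint A & B :|: C] = [disjoint A & B] && [disjoint A & C].
Proof. by rewrite -!setI_eq0 setIUr setU_eq0. Qed.

(** * Brambles and the components they select *)

Definition bramble (G : sgraph) (BB : {set {set G}}) : Prop :=
  [/\ forall b, b \in BB -> b != set0, forall b, b \in BB -> connected_set b
    & {in BB &, forall b c, touch b c}].

Section Bramble.
Variables (G : sgraph) (BB : {set {set G}}) (K : nat).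
Hypothesis brBB : bramble BB.
Hypothesis large : forall Y : {set G}, #|Y| <= K ->
  exists2 b, b \in BB & [disjoint b & Y].
Implicit Types (S X Y Z Q A : {set G}).

(** The union of the components of the graph without [Y] that contain an element of
the bramble. As the elements touch, this is a single component; it is empty exactly
when [Y] covers the bramble. Locked, to keep membership in it folded. *)
Fact beta_key : unit. Proof. exact: tt. Qed.
Definition beta Y : {set G} := locked_with beta_key [set v | [exists b in BB,
  [disjoint b & Y] && [exists u in b, connect (inside (~: Y)) u v]]].

Lemma betaP Y v : reflect (exists b u, [/\ b \in BB, [disjoint b & Y], u \in b
    & connect (inside (~: Y)) u v]) (v \in beta Y).
Proof.
rewrite /beta locked_withE inE; apply: (iffP existsP).
  by case=> b /and3P[bB bY /existsP[u /andP[ub uv]]]; exists b, u.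
case=> b [u [bB bY ub uv]]; exists b; rewrite bB bY /=.
by apply/existsP; exists u; rewrite ub.
Qed.

Lemma beta_elem b Y : b \in BB -> [disjoint b & Y] -> b \subset beta Y.
Proof.
by move=> bB bY; apply/subsetP => u ub; apply/betaP; exists b, u; split.
Qed.

Lemma betaE b u Y : b \in BB -> [disjoint b & Y] -> u \in b ->
  beta Y = component (~: Y) u.
Proof.
move=> bB bY ub; apply/setP => v; rewrite [RHS]inE; apply/betaP/idP; last first.
  by move=> uv; exists b, u.
case=> c [w [cB cY wc]]; apply: connect_trans.
have [_ conn touching] := brBB.
have /connect_inside_sub : b :|: c \subset ~: Y.
  by rewrite subUset -!disjoints_subset bY.
apply; apply: connectedU; rewrite ?inE ?ub ?wc ?orbT //.
- exact: conn.
- exact: conn.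
- exact: touching.
Qed.

Lemma beta_inh Y v : v \in beta Y -> exists b u, [/\ b \in BB, [disjoint b & Y] & u \in b].
Proof. by case/betaP=> b [u [? ? ? _]]; exists b, u. Qed.

Lemma beta_disjoint Y : [disjoint beta Y & Y].
Proof.
apply/pred0P => v /=; apply/negP => /andP[/betaP[b [u [bB bY ub]]]] /connect_insideE h vY.
by move: h; rewrite !inE (disjointFr bY ub) vY => /(_ isT).
Qed.

Lemma notin_beta Y v : v \in beta Y -> v \notin Y.
Proof. by move=> vb; rewrite (disjointFr (beta_disjoint Y) vb). Qed.

Lemma beta_connected Y : connected_set (beta Y).
Proof.
move=> x y xb; have [b [u [bB bY ub]]] := beta_inh xb.
by move: xb; rewrite (betaE bB bY ub); apply: component_connected.
Qed.

Lemma beta_closed Y v w : v \in beta Y -> edge v w -> w \notin Y -> w \in beta Y.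
Proof.
move=> vb vw wY; have vY := notin_beta vb; have [b [u [bB bY ub]]] := beta_inh vb.
move: vb; rewrite (betaE bB bY ub) !inE => uv; apply: (connect_trans uv).
by apply: connect_edge; rewrite ?inE.
Qed.

Lemma beta_absorb A Y x : connected_set A -> [disjoint A & Y] -> x \in A ->
  x \in beta Y -> A \subset beta Y.
Proof.
move=> cA AY xA xb; apply/subsetP => v vA; apply: contraT => vb.
have [u [w [/setIP[uA ub] /setDP[wA wb] uw _]]] := connected_exit cA xA vA xb vb.
by rewrite (beta_closed ub uw) // (disjointFr AY wA) in wb.
Qed.

Lemma beta_anti Y Y' : Y \subset Y' -> beta Y' \subset beta Y.
Proof.
move=> YY; apply/subsetP => v vb; have [b [u [bB bY ub]]] := beta_inh vb.
have bY0 : [disjoint b & Y] by apply: disjointWr bY.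
apply: (subsetP (@beta_absorb _ _ u (@beta_connected Y') _ _ _)) vb.
- by apply: disjointWr YY _; apply: beta_disjoint.
- exact: (subsetP (beta_elem bB bY)).
- exact: (subsetP (beta_elem bB bY0)).
Qed.

Lemma beta_avoid Y Y' : beta Y != set0 -> [disjoint beta Y & Y'] -> beta Y \subset beta Y'.
Proof.
case/set0Pn=> v vb dis; have [b [u [bB bY ub]]] := beta_inh vb.
have uY := subsetP (beta_elem bB bY) u ub.
apply: beta_absorb (dis) uY _; first exact: beta_connected.
apply: (subsetP (beta_elem bB _)) ub.
by apply: disjointWl dis; apply: beta_elem.
Qed.

Lemma beta_neq0 Y : #|Y| <= K -> beta Y != set0.
Proof.
case/large=> b bB bY; have [nz _ _] := brBB; have [u ub] := set0Pn _ (nz b bB).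
by apply/set0Pn; exists u; apply: (subsetP (beta_elem bB bY)).
Qed.

(** [X] is well linked to the bramble in the graph without [Z]: fewer than [#|X|]
further vertices cannot separate it from the bramble. *)
Definition linked Z X := forall S, #|S| < #|X| -> exists2 x, x \in X & x \in beta (Z :|: S).

Definition linked_plus Z X := forall v, v \in beta (Z :|: X) -> linked Z (v |: X).

Definition noncover Z m := forall S, #|S| <= m -> beta (Z :|: S) != set0.

Lemma noncover_sub Z Z' m m' : Z \subset Z' -> m <= m' -> noncover Z' m' -> noncover Z m.
Proof.
move=> ZZ mm nc S Sm; have /set0Pn[v vb] := nc S (leq_trans Sm mm).
by apply/set0Pn; exists v; apply: (subsetP (beta_anti _)) vb; apply: setSU.
Qed.

(** [m] vertices separate [Z] from the bramble, so deleting [Z] costs at most [m]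
vertices in a count of covers. *)
Definition sealed Z m := exists2 S : {set G}, #|S| <= m & [disjoint beta S & Z].

Lemma sealed_noncover Z m n : sealed Z m -> m + n <= K -> noncover Z n.
Proof.
case=> S0 S0m dis mn S Sn; have : beta (S0 :|: S) != set0.
  by apply: beta_neq0; rewrite cardsU; lia.
move=> nz; have /set0Pn[v vb] := nz.
apply/set0Pn; exists v; apply: (subsetP (beta_avoid nz _)) vb.
have sub : beta (S0 :|: S) \subset beta S0 by apply: beta_anti; apply: subsetUl.
rewrite disjoint_setUr (disjointWl sub dis) /=.
by apply: disjointWr (beta_disjoint (S0 :|: S)); apply: subsetUr.
Qed.

Lemma linked_notin Z X x : linked Z X -> x \in X -> x \in beta (Z :|: (X :\ x)).
Proof.
move=> lk xX; have [|y yX yb] := lk (X :\ x); first by rewrite (cardsD1 x X) xX.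
have := notin_beta yb; rewrite !inE yX andbT negb_or negbK => /andP[_ /eqP yx].
by move: yb; rewrite yx.
Qed.

Lemma linked_notinZ Z X x : linked Z X -> x \in X -> x \notin Z.
Proof. by move=> lk /(linked_notin lk)/notin_beta; rewrite inE negb_or => /andP[]. Qed.

Lemma linked_neighbor Z X x : linked Z X -> beta (Z :|: X) != set0 -> x \in X ->
  exists2 v, v \in beta (Z :|: X) & edge x v.
Proof.
move=> lk /set0Pn[w wb] xX; have xb := linked_notin lk xX.
have sub : beta (Z :|: X) \subset beta (Z :|: (X :\ x)).
  by apply/beta_anti/setUS/subD1set.
have xU : x \notin beta (Z :|: X) by apply: contraL xX => /notin_beta; rewrite inE negb_or => /andP[].
have [u [v [/setIP[_ ub] /setDP[vb vU] uv _]]] :=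
  connected_exit (@beta_connected _) (subsetP sub w wb) xb wb xU.
exists u => //; rewrite edge_sym.
have : v \in Z :|: X by apply: contraT => vn; rewrite (beta_closed ub uv vn) in vU.
have := notin_beta vb; rewrite !inE negb_or negb_and negbK => /andP[/negPf-> /=].
by case/orP=> [/eqP<-//|/negPf->].
Qed.

(** If [S] separated [X] from the bramble once [Q] is deleted, the bramble side of
[S] would lie in that of [X]. A path of the side of [Z :|: S] from there to [X] leaves
it through [Q], but [Q] does not meet the side of [X]. *)
Lemma linked_delete Z X Q : linked Z X -> [disjoint Q & X] ->
    [disjoint Q & beta (Z :|: X)] -> noncover (Z :|: Q) #|X| -> linked (Z :|: Q) X.
Proof.
move=> lk QX QU nc S SX; apply: contrapT => no.
have nz : beta (Z :|: Q :|: S) != set0 by apply: nc; exact: ltnW.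
have RX : [disjoint beta (Z :|: Q :|: S) & X].
  by apply/pred0P => x /=; apply/negP => /andP[xb xX]; apply: no; exists x.
have RZ : [disjoint beta (Z :|: Q :|: S) & Z].
  by apply: disjointWr (beta_disjoint _); rewrite -setUA subsetUl.
have RU : beta (Z :|: Q :|: S) \subset beta (Z :|: X).
  by apply: beta_avoid => //; rewrite disjoint_setUr RZ.
have RS : beta (Z :|: Q :|: S) \subset beta (Z :|: S).
  by apply: beta_anti; rewrite setSU // subsetUl.
have [x xX xb] := lk S SX; have /set0Pn[r rR] := nz.
have xR : x \notin beta (Z :|: Q :|: S) by rewrite (disjointFl RX xX).
have [u [v [/setIP[_ uR] /setDP[vb vR] uv _]]] :=
  connected_exit (@beta_connected _) (subsetP RS r rR) xb rR xR.
have vQ : v \in Q.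
  apply: contraT => vQ; move: vR; rewrite (beta_closed uR uv) //.
  by have := notin_beta vb; rewrite !inE (negPf vQ) orbF.
have vU : v \notin Z :|: X.
  rewrite inE (disjointFr QX vQ) orbF.
  by have := notin_beta vb; rewrite inE negb_or => /andP[].
by have := disjointFr QU vQ; rewrite (beta_closed (subsetP RU u uR) uv vU).
Qed.

(** Among the sets of at most [#|X|] vertices that separate [X] from the bramble,
one that leaves the smallest side to the bramble can be enlarged by any vertex of
that side. *)
Lemma linked_closure Z X : linked Z X -> noncover Z #|X| ->
  exists X', [/\ #|X'| = #|X|, beta (Z :|: X') \subset beta (Z :|: X),
    X' \subset beta (Z :|: X) :|: X, linked Z X' & linked_plus Z X'].
Proof.
move=> lk nc.
pose P Y := (#|Y| <= #|X|) && [disjoint beta (Z :|: Y) & X].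
have PX : P X.
  rewrite /P leqnn /=; apply: disjointWr (beta_disjoint _); exact: subsetUr.
case: (@arg_minnP _ X P (fun Y => #|beta (Z :|: Y)|) PX) => X' /andP[X'X disX'] min.
have full S : #|S| <= #|X| -> [disjoint beta (Z :|: S) & X] -> #|S| = #|X|.
  move=> le dis; apply/eqP; rewrite eqn_leq le leqNgt; apply/negP => /lk[x xX xb].
  by rewrite (disjointFr dis xb) in xX.
have cX' := full X' X'X disX'.
have nzZ Y Y' : [disjoint beta (Z :|: Y) & Y'] -> [disjoint beta (Z :|: Y) & Z :|: Y'].
  move=> dis; rewrite disjoint_setUr dis andbT.
  by apply: disjointWr (beta_disjoint _); apply: subsetUl.
have sub : beta (Z :|: X') \subset beta (Z :|: X).
  by apply: beta_avoid; [apply: nc|apply: nzZ].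
have lkp : linked_plus Z X'.
  move=> v vU S; rewrite cardsU1.
  have := notin_beta vU; rewrite inE negb_or => /andP[_ ->]; rewrite ltnS cX' => Sle.
  apply: contrapT => no.
  have dis : [disjoint beta (Z :|: S) & X'].
    apply/pred0P => x /=; apply/negP => /andP[xb xX]; apply: no.
    by exists x; rewrite // inE xX orbT.
  have subU : beta (Z :|: S) \subset beta (Z :|: X').
    by apply: beta_avoid; [apply: nc|apply: nzZ].
  have PS : P S by rewrite /P Sle (disjointWl subU disX').
  have := min S PS; rewrite leqNgt; apply/negP; rewrite negbK.
  apply: proper_card; apply/properP; split=> //; exists v => //.
  by apply/negP => vb; apply: no; exists v; rewrite // inE set11.
have /set0Pn[v vU] : beta (Z :|: X') != set0 by apply: nc; rewrite cX'.
have lk' : linked Z X'.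
  move=> S SX; apply: contrapT => no.
  have dis : [disjoint beta (Z :|: S) & X'].
    by apply/pred0P => x /=; apply/negP => /andP[xb xX]; apply: no; exists x.
  have Sle : #|S| <= #|X| by rewrite -cX' ltnW.
  have subU : beta (Z :|: S) \subset beta (Z :|: X').
    by apply: beta_avoid; [apply: nc|apply: nzZ].
  by have := full S Sle (disjointWl subU disX'); rewrite -cX' => e; rewrite e ltnn in SX.
exists X'; split=> //; apply/subsetP => x xX'.
have nz : beta (Z :|: X') != set0 by apply/set0Pn; exists v.
have [w wU xw] := linked_neighbor lk' nz xX'.
rewrite inE; case: (boolP (x \in X)) => xX; rewrite ?orbT // orbF.
apply: (beta_closed (subsetP sub w wU)); first by rewrite edge_sym.
by rewrite inE negb_or xX (linked_notinZ lk' xX').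
Qed.

(** Menger's theorem in the strip between [X] and the smaller side of [X']. For a set
[S] of fewer than [#|X|] vertices, the side of [Z :|: S] contains a vertex of [X] and
the side of [X']; going from the latter to the former, [X'] is met first and the
path can be stopped at its first vertex in [X]. *)
Lemma linked_legs Z X X' : linked Z X ->
    beta (Z :|: X') \subset beta (Z :|: X) -> beta (Z :|: X') != set0 ->
    X' \subset beta (Z :|: X) :|: X ->
  exists t : G -> seq G, (forall x, x \in X -> [/\ path (@edge G) x (t x),
      last x (t x) \in X', uniq (x :: t x)
      & {subset x :: t x <= (beta (Z :|: X) :|: X) :\: beta (Z :|: X')}]) /\
    (forall x y v, x \in X -> y \in X -> v \in x :: t x -> v \in y :: t y -> x = y).
Proof.
move=> lk sub nzU' X'sub.
set U := beta (Z :|: X) in sub X'sub *; set U' := beta (Z :|: X') in sub nzU' *.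
pose W := (U :|: X) :\: U'.
have XW : X \subset W.
  apply/subsetP => x xX; rewrite !inE xX orbT andbT; apply/negP => /(subsetP sub).
  by move/notin_beta; rewrite inE xX orbT.
pose e := fun u v => (v \in W) && edge u v.
have [S SX|t [tP tD]] := @menger_all _ e X X'.
  have [x xX xb] := lk (S :\: U') (leq_ltn_trans (subset_leq_card (subsetDl _ _)) SX).
  set R := beta (Z :|: (S :\: U')) in xb.
  have U'R : U' \subset R.
    apply: beta_avoid => //; rewrite disjoint_setUr.
    rewrite (disjointWr (subsetUl Z X') (beta_disjoint _)) /= disjoint_sym.
    by apply/pred0P => v /=; rewrite in_setD -/U'; case: (v \in U') => /=; rewrite ?andbF.
  have /set0Pn[z zU'] := nzU'.
  have xU' : x \notin U'.
    by apply/negP => /(subsetP sub)/notin_beta; rewrite inE xX orbT.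
  have xR' : x \in ~: U' by rewrite inE.
  have zR' : z \notin ~: U' by rewrite inE negbK.
  have [w [u [/setIP[wR wU'] /setDP[uR uU'] wu xw]]] :=
    connected_exit (@beta_connected _) xb (subsetP U'R z zU') xR' zR'.
  rewrite !inE in wU' uU'; rewrite negbK in uU'.
  have wZ : w \notin Z by have := notin_beta wR; rewrite inE negb_or => /andP[].
  have wX' : w \in X'.
    apply: contraT => wX'; move: wU'; rewrite (@beta_closed _ u) //.
      by rewrite edge_sym.
    by rewrite inE negb_or wZ.
  have avS v : v \in R -> v \notin U' -> v \notin S.
    by move=> /notin_beta; rewrite !inE negb_or negb_and negbK => /andP[_ /orP[->|]].
  have [wX|wX] := boolP (w \in X).
    exists w, [::]; split; first by split.
    by move=> v; rewrite inE => /eqP->; apply: avS.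
  have wU : w \in U by have := subsetP X'sub w wX'; rewrite inE (negPf wX) orbF.
  have xU : x \notin U by apply/negP => /notin_beta; rewrite inE xX orbT.
  rewrite inside_csym in xw.
  have [a [b [aU bU /and3P[aR bR ab] wa]]] := connect_exit xw wU xU.
  have bX : b \in X.
    apply: contraT => bX; move: bU; rewrite (beta_closed aU ab) // inE negb_or bX andbT.
    by move: bR; rewrite inE => /andP[/notin_beta + _]; rewrite inE negb_or => /andP[].
  have [p [pp lp up]] : exists p, [/\ path (inside (R :&: ~: U' :&: U)) a p, last a p = w & uniq (a :: p)].
    apply: connect_simple; rewrite inside_csym.
    apply: connect_sub wa => u1 u2 /and3P[u1U u2U /and3P[u1R u2R u12]].
    by apply: connect_edge; rewrite // inE ?u1R ?u2R ?u1U ?u2U.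
  have ap : {in a :: p, forall v, [/\ v \in R, v \notin U' & v \in U]}.
    have ain : a \in R :&: ~: U' :&: U by rewrite inE aR aU.
    have h u1 u2 : inside (R :&: ~: U' :&: U) u1 u2 -> mem (R :&: ~: U' :&: U) u2.
      by case/and3P.
    have /allP hp := path_all h ain pp.
    by move=> v /hp /=; rewrite !in_setI in_setC => /andP[/andP[]].
  have eW v : v \in a :: p -> v \in W by case/ap => _ vU' vU; rewrite !inE vU' vU.
  have [||q [qP qs]] := @walk_abpath _ e X X' b (a :: p) bX _ _.
  - rewrite /= /e eW ?mem_head // edge_sym ab /=.
    elim: p (a) pp eW {lp up ap wa ab aU aR} => //= u1 p IHp a0 /andP[/and3P[_ _ h] pp] eW.
    rewrite h eW ?inE ?eqxx ?orbT // IHp // => v vp; apply: eW.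
    by rewrite inE vp orbT.
  - by rewrite /= lp.
  exists b, q; split=> // v /qs; rewrite inE => /orP[/eqP->|/ap[]]; last by move=> ? ? _; apply: avS.
  by apply: avS; move: bR; rewrite !inE => /andP[].
exists t; split=> // x xX; have [_ tp tl tu] := tP x xX; split=> //.
  by apply: sub_path tp => u v /andP[].
apply/allP; apply: (path_all (a := mem W) _ (subsetP XW x xX) tp).
by move=> u v /andP[].
Qed.

End Bramble.

(** * Growing disjoint connected sets towards the bramble *)

Definition update (T : Type) (f : nat -> T) k a i := if i == k then a else f i.

Lemma update_eq (T : Type) (f : nat -> T) k a : update f k a k = a.
Proof. by rewrite /update eqxx. Qed.

Lemma update_lt (T : Type) (f : nat -> T) k a i : i < k -> update f k a i = f i.
Proof. by rewrite /update => /ltn_eqF->. Qed.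

Section Growth.
Variables (G : sgraph) (BB : {set {set G}}) (K : nat).
Hypothesis brBB : bramble BB.
Hypothesis large : forall Y : {set G}, #|Y| <= K ->
  exists2 b, b \in BB & [disjoint b & Y].
Implicit Types (S X Y Z Q A : {set G}) (x : nat -> G) (F : nat -> {set G}).

Notation beta := (beta BB).
Notation linked := (linked BB).
Notation linked_plus := (linked_plus BB).
Notation noncover := (noncover BB).
Notation sealed := (sealed BB).

Definition tips x k : {set G} := [set x (val i) | i : 'I_k].

Lemma tipsP x k v : reflect (exists2 i, i < k & v = x i) (v \in tips x k).
Proof.
apply: (iffP imsetP) => [[i _ ->]|[i ik ->]]; first by exists i.
by exists (Ordinal ik).
Qed.

Lemma tips_in x k i : i < k -> x i \in tips x k.
Proof. by move=> ik; apply/tipsP; exists i. Qed.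

(** Disjoint connected sets [F 0], ..., [F k.-1], each with a tip, in the graph without
the deleted set [Z]. They lie outside the bramble side of the tips, so further growth
happens on that side only, and the tips are well linked to the bramble. *)
Record state Z k x F : Prop := State {
  st_tip : forall i, i < k -> x i \in F i;
  st_conn : forall i, i < k -> connected_set (F i);
  st_disj : forall i j v, i < k -> j < k -> v \in F i -> v \in F j -> i = j;
  st_out : forall i v, i < k -> v \in F i -> v \notin Z;
  st_beta : forall i v, i < k -> v \in F i -> v \notin beta (Z :|: tips x k);
  st_linked : linked Z (tips x k) }.

Lemma card_tips Z k x F : state Z k x F -> #|tips x k| = k.
Proof.
move=> st; rewrite card_imset ?card_ord // => i j /= xij; apply: val_inj => /=.
apply: (st_disj st (v := x i)) => //; first exact: (st_tip st).
by rewrite xij; apply: (st_tip st).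
Qed.

Lemma st_tip_eq Z k x F i j : state Z k x F -> i < k -> j < k -> x j \in F i -> i = j.
Proof. by move=> st ik jk xj; apply: (st_disj st ik jk xj); apply: (st_tip st). Qed.

(** The tips move along disjoint paths towards the bramble until they sit on the
separator of [linked_closure]; then new tips can be added. *)
Lemma state_close Z k x F : state Z k x F -> noncover Z k ->
  exists x' t, [/\ state Z k x' (fun i => F i :|: [set v in x i :: t i]),
    linked_plus Z (tips x' k)
    & forall i, i < k -> [/\ path (@edge G) (x i) (t i), last (x i) (t i) = x' i
        & uniq (x i :: t i)]].
Proof.
move=> st nc; have cX := card_tips st; have lk := st_linked st.
have nc' : noncover Z #|tips x k| by rewrite cX.
have [X' [cX' sub X'sub lk' lkp]] := linked_closure brBB lk nc'.
have nz : beta (Z :|: X') != set0 by apply: nc'; rewrite cX'.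
have [t0 [t0P t0D]] := linked_legs brBB lk sub nz X'sub.
pose t i := t0 (x i); pose x' i := last (x i) (t i).
have tP i ik := t0P (x i) (tips_in x (ik : i < k)).
have tD i j v : i < k -> j < k -> v \in x i :: t i -> v \in x j :: t j -> i = j.
  move=> ik jk vi vj; apply: (st_tip_eq st ik jk).
  rewrite -(t0D (x i) (x j) v) ?tips_in //; exact: (st_tip st).
have eX' : tips x' k = X'.
  apply/eqP; rewrite eqEcard cX' cX; apply/andP; split.
    by apply/subsetP => _ /tipsP[i ik ->]; case: (tP i ik).
  rewrite card_imset ?card_ord // => i j /= e; apply: val_inj.
  by apply: (tD _ _ (x' (val i))) => //; rewrite ?mem_last //= e mem_last.
have legF i j v : i < k -> j < k -> v \in F i -> v \in x j :: t j -> i = j.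
  move=> ik jk vi vj; have [_ _ _ sj] := tP j jk; have := sj v vj.
  rewrite in_setD in_setU => /andP[_ /orP[vU|/tipsP[m mk vm]]].
    by have := st_beta st ik vi; rewrite vU.
  have im : i = m by apply: (st_tip_eq st ik mk); rewrite -vm.
  by apply: (tD i j v) => //; rewrite vm -im mem_head.
exists x', t; split; last by move=> i ik; case: (tP i ik).
  split; rewrite ?eX' //.
  - by move=> i ik; rewrite in_setU in_set mem_last orbT.
  - move=> i ik; have [pt _ _ _] := tP i ik.
    apply: (connectedU_meet (st_conn st ik) (connected_path pt) (st_tip st ik)).
    by rewrite in_set mem_head.
  - move=> i j v ik jk; rewrite !in_setU !in_set => /orP[vi|vi] /orP[vj|vj].
    + exact: (st_disj st ik jk vi).
    + exact: legF vj.
    + by apply/esym; apply: legF vi.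
    + exact: tD vi vj.
  - move=> i v ik; rewrite in_setU in_set => /orP[/(st_out st ik)//|vi].
    have [_ _ _ si] := tP i ik; have := si v vi.
    rewrite in_setD in_setU => /andP[_ /orP[vU|/tipsP[m mk vm]]].
      by have := notin_beta vU; rewrite in_setU negb_or => /andP[].
    by rewrite vm; apply: (st_out st mk); apply: (st_tip st).
  - move=> i v ik; rewrite in_setU in_set => /orP[/(st_beta st ik)|vi].
      by apply: contra => /(subsetP sub).
    by have [_ _ _ si] := tP i ik; have := si v vi; rewrite in_setD => /andP[].
by rewrite eX'.
Qed.

Lemma tips_update x k v : tips (update x k v) k.+1 = v |: tips x k.
Proof.
apply/setP => w; apply/tipsP/setU1P => [[i ik ->]|[->|/tipsP[i ik ->]]].
- have [->|ne] := eqVneq i k; first by rewrite update_eq; left.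
  have ik' : i < k by lia.
  by rewrite update_lt //; right; apply: tips_in.
- by exists k; rewrite ?update_eq.
- by exists i; rewrite ?update_lt //; lia.
Qed.

Lemma state_fork Z k x F v : state Z k x F -> linked_plus Z (tips x k) ->
  v \in beta (Z :|: tips x k) -> state Z k.+1 (update x k v) (update F k [set v]).
Proof.
move=> st lkp vb.
have cases i : i < k.+1 -> i = k \/ i < k by lia.
have vF i : i < k -> v \notin F i by move=> ik; apply/negP => /(st_beta st ik); rewrite vb.
split.
- move=> i /cases[->|ik]; first by rewrite !update_eq set11.
  by rewrite !update_lt //; apply: (st_tip st).
- move=> i /cases[->|ik]; first by rewrite update_eq; apply: connected1.
  by rewrite update_lt //; apply: (st_conn st).
- move=> i j w /cases[->|ik] /cases[->|jk] //; rewrite ?update_eq ?update_lt //.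
  + by move=> /set1P-> vj; rewrite (negPf (vF j jk)) in vj.
  + by move=> vi /set1P wv; rewrite wv (negPf (vF i ik)) in vi.
  + exact: (st_disj st).
- move=> i w /cases[->|ik]; rewrite ?update_eq ?update_lt //; last exact: (st_out st).
  by move=> /set1P->; have := notin_beta vb; rewrite in_setU negb_or => /andP[].
- move=> i w ik wF; rewrite tips_update; apply/negP => wb.
  move: wF; case: (cases i ik) => [->|ik']; rewrite ?update_eq ?update_lt //.
    move=> /set1P wv; have := notin_beta wb; by rewrite wv in_setU in_setU1 eqxx orbT.
  move=> /(st_beta st ik'); rewrite (subsetP (beta_anti _ _) w wb) //.
  by apply/setUS/subsetUr.
- by rewrite tips_update; apply: lkp.
Qed.

(** Deleting the last tip in favour of a new vertex [v] keeps the tips well linked,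
since even the old tips together with [v] are. *)
Lemma state_swap Z k x F v : state Z k.+1 x F -> linked_plus Z (tips x k.+1) ->
    v \in beta (Z :|: tips x k.+1) ->
  state (x k |: Z) k.+1 (update x k v) (update F k [set v]).
Proof.
move=> st lkp vb.
have cases i : i < k.+1 -> i = k \/ i < k by lia.
have vF i : i < k.+1 -> v \notin F i by move=> ik; apply/negP => /(st_beta st ik); rewrite vb.
have vn := notin_beta vb.
have tipsE : tips x k.+1 = x k |: tips x k.
  apply/setP => w; apply/tipsP/setU1P => [[i /cases[->|ik] ->]|[->|/tipsP[i ik ->]]].
  - by left.
  - by right; apply: tips_in.
  - by exists k.
  - by exists i => //; lia.
have sub : beta (x k |: Z :|: tips (update x k v) k.+1) \subset beta (Z :|: tips x k.+1).
  apply: (beta_anti brBB); rewrite tips_update tipsE; apply/subsetP => w.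
  by rewrite !inE => /or3P[->|->|->]; rewrite ?orbT.
split.
- move=> i /cases[->|ik]; first by rewrite !update_eq set11.
  by rewrite !update_lt //; apply: (st_tip st); lia.
- move=> i /cases[->|ik]; first by rewrite update_eq; apply: connected1.
  by rewrite update_lt //; apply: (st_conn st); lia.
- move=> i j w /cases[->|ik] /cases[->|jk] //; rewrite ?update_eq ?update_lt //.
  + by move=> /set1P-> vj; rewrite (negPf (vF j _)) // in vj; lia.
  + by move=> vi /set1P wv; rewrite wv (negPf (vF i _)) // in vi; lia.
  + by apply: (st_disj st); lia.
- move=> i w /cases[->|ik]; rewrite ?update_eq ?update_lt // in_setU1 negb_or.
    move=> /set1P->; move: vn; rewrite in_setU negb_or => /andP[-> vX]; rewrite andbT.
    by apply: contraNneq vX => ->; apply: tips_in.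
  move=> wi; rewrite (st_out st _ wi) ?andbT; last by lia.
  apply/eqP => wx; have : i = k by apply: (st_tip_eq st) => //; [lia|rewrite -wx].
  lia.
- move=> i w ik wF; apply/negP => wb; move: wF; case: (cases i ik) => [->|ik'].
    rewrite update_eq => /set1P wv; have := notin_beta wb.
    by rewrite wv tips_update in_setU !in_setU1 eqxx /= orbT.
  by rewrite update_lt // => wi; move: (st_beta st ik wi); rewrite (subsetP sub).
- have c1 := card_tips st.
  have vX : v \notin tips x k by apply: contra vn => vX; rewrite tipsE in_setU in_setU1 vX !orbT.
  have xX : x k \notin tips x k.
    apply/negP => /tipsP[i ik e]; have : k = i; last by lia.
    by apply: (st_tip_eq st) => //; [lia|rewrite -e; apply: (st_tip st)].
  move: c1; rewrite tipsE cardsU1 xX tips_update => c1 S; rewrite cardsU1 vX => SX.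
  have [|y yX yb] := lkp v vb (x k |: S).
    have vt : v \notin tips x k.+1 by apply: contra vn => vt; rewrite in_setU vt orbT.
    by rewrite !cardsU1 vt tipsE cardsU1 xX; case: (_ \notin S); lia.
  have yn := notin_beta yb; exists y; last by rewrite -setUA setUCA.
  move: yX yn; rewrite tipsE !inE => /or3P[->//|/eqP->|->]; last by rewrite orbT.
  by rewrite eqxx !orbT.
Qed.

Lemma state_delete Z k x F Q F' : state Z k x F ->
    (forall i, i < k -> F' i \subset F i) ->
    (forall i, i < k -> x i \in F' i) -> (forall i, i < k -> connected_set (F' i)) ->
    (forall i, i < k -> [disjoint F' i & Q]) ->
    [disjoint Q & beta (Z :|: tips x k)] -> noncover (Q :|: Z) k ->
  state (Q :|: Z) k x F'.
Proof.
move=> st sF xF cF dF dQ nc; split=> //.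
- move=> i j v ik jk /(subsetP (sF i ik)) vi /(subsetP (sF j jk)).
  exact: (st_disj st ik jk vi).
- move=> i v ik vi; rewrite in_setU (disjointFr (dF i ik) vi) /=.
  by apply: (st_out st ik); apply: (subsetP (sF i ik)).
- move=> i v ik /(subsetP (sF i ik))/(st_beta st ik); apply: contra.
  by apply/subsetP/(beta_anti brBB)/setSU/subsetUr.
- rewrite setUC; apply: (linked_delete brBB (st_linked st)) => //.
    apply/pred0P => v /=; apply/negP => /andP[vQ /tipsP[i ik vx]].
    by rewrite vx (disjointFr (dF i ik) (xF i ik)) in vQ.
  by rewrite setUC (card_tips st).
Qed.

(** The last set of the state is a path; its first vertex can always be deleted,
after prolonging the path if this is its only vertex. *)
Lemma state_advance Z k x F a q : state Z k.+1 x F -> F k = [set v in a :: q] ->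
    path (@edge G) a q -> last a q = x k -> uniq (a :: q) -> noncover (a |: Z) k.+1 ->
  exists x' F' b q', [/\ state (a |: Z) k.+1 x' F', edge a b,
    [/\ F' k = [set v in b :: q'], path (@edge G) b q', last b q' = x' k & uniq (b :: q')]
    & forall i, i < k -> F i \subset F' i].
Proof.
move=> st Fk pq lq uq nc.
have shift x0 F0 b r : state Z k.+1 x0 F0 -> F0 k = [set v in [:: a, b & r]] ->
    path (@edge G) a (b :: r) -> last b r = x0 k -> uniq [:: a, b & r] ->
    (forall i, i < k -> F i \subset F0 i) ->
  exists x' F' b q', [/\ state (a |: Z) k.+1 x' F', edge a b,
    [/\ F' k = [set v in b :: q'], path (@edge G) b q', last b q' = x' k & uniq (b :: q')]
    & forall i, i < k -> F i \subset F' i].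
  move=> st0 F0k /= /andP[ab pr] lr /andP[abr ubr] sub.
  exists x0, (update F0 k [set v in b :: r]), b, r; rewrite update_eq; split=> //; last first.
    by move=> i ik; rewrite update_lt //; apply: sub.
  have aF0 : a \in F0 k by rewrite F0k in_set mem_head.
  have cases i : i < k.+1 -> i = k \/ i < k by lia.
  apply: (state_delete st0) => //.
  - move=> i /cases[->|ik]; rewrite ?update_eq ?update_lt // F0k.
    by apply/subsetP => v; rewrite !in_set => vb; rewrite inE vb orbT.
  - move=> i /cases[->|ik]; rewrite ?update_eq ?update_lt //.
      by rewrite in_set -lr mem_last.
    by apply: (st_tip st0); lia.
  - move=> i /cases[->|ik]; rewrite ?update_eq ?update_lt //.
      exact: connected_path.
    by apply: (st_conn st0); lia.
  - move=> i /cases[->|ik]; rewrite ?update_eq ?update_lt // disjoint_sym disjoints1.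
      by rewrite in_set.
    by apply/negP => aFi; have : i = k; [apply: (st_disj st0 _ _ aFi aF0); lia|lia].
  - by rewrite disjoints1; apply: (st_beta st0 _ aF0).
case: q pq lq uq Fk => [|b r] pq lq uq Fk; last exact: (shift x F b r).
rewrite /= in lq.
have nc' : noncover Z k.+1 by apply: noncover_sub nc => //; rewrite subsetUr.
have [x' [t [st' lkp tP]]] := state_close st nc'.
have [pt lt ut] := tP k (ltnSn k).
pose F' i := F i :|: [set v in x i :: t i].
have F'k : F' k = [set v in x k :: t k].
  by rewrite /F' Fk -lq; apply/setP => v; rewrite !inE; case: (v == a).
have sub i : F i \subset F' i by apply: subsetUl.
case et : (t k) pt lt ut F'k => [|b r] pt lt ut F'k; last first.
  by apply: (shift x' F' b r) => //; rewrite lq.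
have ak : x' k = a by rewrite -lt lq.
have nz : beta (Z :|: tips x' k.+1) != set0 by apply: nc'; rewrite (card_tips st').
have [v vb av] := linked_neighbor brBB (st_linked st') nz (tips_in x' (ltnSn k)).
have stS := state_swap st' lkp vb; rewrite ak in av stS.
exists (update x' k v), (update F' k [set v]), v, [::]; rewrite !update_eq; split=> //.
- by split=> //; apply/setP => w; rewrite !inE.
- by move=> i ik; rewrite update_lt.
Qed.

Variable l : nat.

(** A part of a future cycle: its inner vertices lie in the deleted set, and the last
condition, that fewer than [l] vertices do not separate it from the bramble, passes to
every cycle containing it. *)
Definition ear Z X Y := exists s p, [/\ s \in X, last s p \in Y,
  path (@edge G) s p /\ uniq (s :: p),
  forall v, v \in p -> v != last s p -> v \in Z
  & forall S, #|S| < l -> ~~ [disjoint beta S & [set v in s :: p]]].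

Lemma ear_sub Z X Y Z' X' Y' : Z \subset Z' -> X \subset X' -> Y \subset Y' ->
  ear Z X Y -> ear Z' X' Y'.
Proof.
move=> /subsetP ZZ /subsetP XX /subsetP YY [s [p [sX lY ps pZ pS]]].
by exists s, p; split; auto.
Qed.

(** The path [s :: rcons p a] is prolonged vertex by vertex, and stops as soon as [l]
vertices are needed to separate it from the bramble. Before the last step fewer than
[l] vertices separate it, which is what seals the deleted vertices; one more vertex is
deleted in each step, so the process ends. *)
Lemma grow_ear_aux Z0 m k i n Z x F s p a q : m + (l - 1) + k.+1 <= K -> i < k ->
    #|~: Z| < n -> sealed Z0 m -> Z = Z0 :|: [set v in p] ->
    {in p, forall v, v \notin Z0} ->
    state Z k.+1 x F -> F k = [set v in a :: q] -> path (@edge G) a q ->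
    last a q = x k -> uniq (a :: q) ->
    s \in F i -> path (@edge G) s (rcons p a) -> uniq (s :: rcons p a) ->
    (exists2 S : {set G}, #|S| < l & [disjoint beta S & [set v in s :: rcons p a]]) ->
  exists Z' x' F', [/\ Z \subset Z', state Z' k.+1 x' F', forall j, j < k -> F j \subset F' j,
    ear (Z' :\: Z0) (F' i) (F' k) & sealed Z' (m + (l - 1))].
Proof.
move=> mK ik; elim: n Z x F p a q => // n IH Z x F p a q Zn seal ZE pZ0 st Fk pq lq uq sF ps us.
case=> S Sl Sdis.
have sealZ : sealed (a |: Z) (m + (l - 1)).
  case: seal => S0 S0m dis0; exists (S0 :|: S); first by rewrite cardsU; lia.
  apply/pred0P => v /=; apply/negP => /andP[vb]; rewrite ZE.
  have v0 : v \in beta S0 by apply: (subsetP (beta_anti brBB _)) vb; apply: subsetUl.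
  have vS : v \in beta S by apply: (subsetP (beta_anti brBB _)) vb; apply: subsetUr.
  rewrite !inE (disjointFr dis0 v0) /= -in_cons => vp.
  by move: (disjointFr Sdis vS); rewrite in_set inE mem_rcons vp orbT.
have nc : noncover (a |: Z) k.+1 by apply: sealed_noncover mK.
have [x' [F' [b [q' [st' ab [F'k pq' lq' uq'] sub]]]]] := state_advance st Fk pq lq uq nc.
have sF' : s \in F' i by apply: (subsetP (sub i ik)).
have bF' : b \in F' k by rewrite F'k in_set mem_head.
have ik1 : i < k.+1 by lia.
have bZ := st_out st' (ltnSn k) bF'.
have bnp : b \notin rcons p a.
  apply: contra bZ; rewrite mem_rcons ZE !inE => /orP[->//|->]; by rewrite !orbT.
have bs : b != s.
  by apply: contraTneq ik => bs; rewrite (st_disj st' ik1 (ltnSn k) sF') ?ltnn // -bs.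
have ps' : path (@edge G) s (rcons (rcons p a) b).
  by rewrite rcons_path ps last_rcons.
have us' : uniq (s :: rcons (rcons p a) b).
  by rewrite -rcons_cons rcons_uniq us andbT inE negb_or bs.
have ZE' : a |: Z = Z0 :|: [set v in rcons p a].
  by apply/setP => v; rewrite ZE !inE mem_rcons inE orbCA.
have aZ : a \notin Z by apply: (st_out st (ltnSn k)); rewrite Fk in_set mem_head.
have paZ0 : {in rcons p a, forall v, v \notin Z0}.
  move=> v; rewrite mem_rcons inE => /orP[/eqP->|/pZ0//].
  by apply: contra aZ; rewrite ZE in_setU => ->.
have [fat|] := boolP [forall S : {set G}, (#|S| < l) ==>
    ~~ [disjoint beta S & [set v in s :: rcons (rcons p a) b]]].
  exists (a |: Z), x', F'; split=> //; first exact: subsetUr.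
  exists s, (rcons (rcons p a) b); rewrite last_rcons; split=> //.
    move=> v; rewrite mem_rcons inE => /orP[->//|vp _].
    by rewrite in_setD ZE' in_setU in_set vp orbT andbT paZ0.
  by move=> S' S'l; have /forallP/(_ S')/implyP := fat; apply.
rewrite negb_forall => /existsP[S']; rewrite negb_imply negbK => /andP[S'l S'dis].
have Zn' : #|~: (a |: Z)| < n.
  rewrite -ltnS; apply: leq_trans Zn; rewrite ltnS; apply: proper_card.
  rewrite properE setCS subsetUr /=; apply/negP => /subsetP/(_ a).
  by rewrite !inE aZ eqxx /= => /(_ isT).
have [Z2 [x2 [F2 [ZZ2 st2 sub2 ear2 seal2]]]] := IH (a |: Z) x' F' (rcons p a) b q' Zn' seal
  ZE' paZ0 st' F'k pq' lq' uq' sF' ps' us' (ex_intro2 _ _ S' S'l S'dis).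
exists Z2, x2, F2; split=> //; first by apply: subset_trans ZZ2; apply: subsetUr.
by move=> j jk; apply: subset_trans (sub j jk) (sub2 j jk).
Qed.

Hypothesis l3 : 2 < l.

Lemma grow_ear Z m k i x F : m + (l - 1) + k.+1 <= K -> i < k -> sealed Z m ->
    state Z k x F ->
  exists Z' x' F', [/\ Z \subset Z', state Z' k.+1 x' F', forall j, j < k -> F j \subset F' j,
    ear (Z' :\: Z) (F' i) (F' k) & sealed Z' (m + (l - 1))].
Proof.
move=> mK ik seal st0.
have nc : noncover Z k by apply: (sealed_noncover brBB large seal); lia.
have [x1 [t [st lkp _]]] := state_close st0 nc.
set F1 := fun i : nat => _ in st.
have nz : beta (Z :|: tips x1 k) != set0 by apply: nc; rewrite (card_tips st).
have [v vb xv] := linked_neighbor brBB (st_linked st) nz (tips_in x1 ik).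
have stF := state_fork st lkp vb.
have sF := st_tip st ik; have vF : v != x1 i.
  by apply: contraTneq vb => ->; apply: (st_beta st ik sF).
have [//|||||||||||||Z' [x' [F' [ZZ st' sub ear' seal']]]] :=
  @grow_ear_aux Z m k i #|~: Z|.+1 Z (update x1 k v) (update F1 k [set v]) (x1 i) [::] v [::] mK ik.
- exact: seal.
- by apply/setP => w; rewrite !inE orbF.
- by [].
- exact: stF.
- by rewrite update_eq; apply/setP => w; rewrite !inE.
- by [].
- by rewrite update_eq.
- by [].
- by rewrite update_lt.
- by rewrite /= xv.
- by rewrite /= inE eq_sym vF.
- exists [set v; x1 i]; first by rewrite cards2 vF /=.
  apply/pred0P => w /=; apply/negP => /andP[/notin_beta + wp]; apply/negP; rewrite negbK.
  by move: wp; rewrite !inE orbC.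
exists Z', x', F'; split=> // j jk; apply: subset_trans (sub j jk).
by rewrite update_lt // /F1 subsetUl.
Qed.

End Growth.

(** * Two linked cycles contain a twisted prism *)

Lemma nth_filter_count (T : eqType) (a : pred T) (x : T) s k :
  k < size s -> a (nth x s k) ->
  nth x (filter a s) (count a (take k s)) = nth x s k.
Proof.
move=> ks ak; rewrite -{1}(cat_take_drop k s) (drop_nth x ks) filter_cat /= ak.
by rewrite nth_cat size_filter ltnn subnn.
Qed.

Section CycleBlocks.
Variables (G : sgraph) (l : nat) (A : {set G}).

(** The cycle is cut in front of each vertex of [A]: the number of vertices of [A] up
to a given vertex is the index of its block. *)
Lemma cycle_blocks_rooted x s :
    path.cycle (@edge G) (x :: s) -> uniq (x :: s) -> x \in A ->
    {subset A <= x :: s} -> #|A| = l ->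
  exists (f : 'I_l -> G) (blk : 'I_l -> {set G}),
    [/\ forall j, f j \in blk j, forall a, a \in A -> exists j, f j = a,
        forall j v, v \in blk j -> v \in x :: s, forall j, connected_set (blk j)
      & (forall i j v, v \in blk i -> v \in blk j -> i = j) /\
        (forall i, ordS i != i -> adj (blk i) (blk (ordS i)))].
Proof.
set c := x :: s => cyc uc xA Ac Al.
pose g k := (count (mem A) (take k.+1 c)).-1.
have fA : size (filter (mem A) c) = l.
  rewrite -Al cardE; apply: perm_size; apply: uniq_perm; [exact: filter_uniq|exact: enum_uniq|].
  move=> v; rewrite mem_filter mem_enum /=; apply: andb_idr; exact: Ac.
pose f0 j := nth x (filter (mem A) c) j.
have take_cnt k : k < size c -> count (mem A) (take k.+1 c) =
    count (mem A) (take k c) + (nth x c k \in A).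
  by move=> kc; rewrite (take_nth x kc) -cats1 count_cat /= addn0.
have cnt_pos k : 0 < count (mem A) (take k.+1 c) by rewrite /= xA.
have gS k : k.+1 < size c -> g k.+1 = g k + (nth x c k.+1 \in A).
  by move=> kc; rewrite /g take_cnt //; have := cnt_pos k; lia.
have g0 : g 0 = 0 by rewrite /g /= take0 /= xA.
have gf k : k < size c -> nth x c k \in A -> f0 (g k) = nth x c k.
  move=> kc kA; rewrite /f0 /g take_cnt // kA addn1 /=.
  exact: nth_filter_count.
have gl k : k < size c -> g k < l.
  move=> kc; rewrite /g prednK // -fA size_filter -{2}(cat_take_drop k.+1 c) count_cat.
  exact: leq_addr.
have f0A j : j < l -> f0 j \in A /\ f0 j \in c.
  move=> jl; have : f0 j \in filter (mem A) c by rewrite mem_nth ?fA.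
  by rewrite mem_filter => /andP[].
have gidx j : j < l -> g (index (f0 j) c) = j.
  move=> jl; have [fjA fjc] := f0A j jl; have ic : index (f0 j) c < size c by rewrite index_mem.
  have := gf _ ic; rewrite nth_index // => /(_ fjA)/eqP.
  by rewrite nth_uniq ?fA ?filter_uniq ?gl // => /eqP.
have sorted_c : path (@edge G) x s by move: cyc; rewrite /= rcons_path => /andP[].
have step k : k.+1 < size c -> edge (nth x c k) (nth x c k.+1).
  by move=> kc; have /(sortedP x) := (sorted_c : sorted (@edge G) c); apply.
pose blk (j : 'I_l) := [set v in c | g (index v c) == j].
have in_blk k (kc : k < size c) (j : 'I_l) : g k = j -> nth x c k \in blk j.
  by move=> e; rewrite in_set mem_nth // index_uniq // e eqxx.
exists (fun j => f0 j), blk; split.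
- by move=> j; rewrite in_set gidx // (f0A j _).2 ?eqxx.
- move=> a aA; have ic : index a c < size c by rewrite index_mem Ac.
  exists (Ordinal (gl _ ic)); rewrite /= gf ?nth_index ?Ac //.
- by move=> j v; rewrite in_set => /andP[].
- move=> j; apply: (@connected_root _ _ (f0 j)) => v; rewrite in_set => /andP[vc /eqP gv].
  rewrite -(nth_index x vc); have ic : index v c < size c by rewrite index_mem.
  elim: (index v c) ic gv => [|k IH] kc gk.
    by rewrite -gk gf // /= connect0.
  have [kA|kA] := boolP (nth x c k.+1 \in A); first by rewrite -gk gf // connect0.
  have gk' : g k = j by move: gk; rewrite gS // (negPf kA) addn0.
  apply: connect_trans (IH (ltnW kc) gk') _.
  by apply: connect_edge; rewrite ?in_blk //; [apply: ltnW|apply: step].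
- split=> [i j v|i]; first by rewrite !in_set => /andP[_ /eqP e] /andP[_ /eqP]; rewrite e => /val_inj.
  move=> ne; have [lt|ge] := ltnP i.+1 l.
    have eS : ordS i = i.+1 :> nat by rewrite /= modn_small.
    have [kA kc] := f0A _ lt; have gk := gidx _ lt; rewrite -index_mem in kc.
    have nk : nth x c (index (f0 i.+1) c) = f0 i.+1 by rewrite nth_index // -index_mem.
    case: (index (f0 i.+1) c) kc gk nk => [|k] kc gk nk; first by rewrite g0 in gk.
    apply/adjP; exists (nth x c k), (nth x c k.+1); split; last exact: step.
      by apply: in_blk; [apply: ltnW|move: gk; rewrite gS // nk kA; lia].
    by apply: in_blk; rewrite // gk eS.
  have il : i.+1 = l by have := ltn_ord i; lia.
  have eS : ordS i = 0 :> nat by rewrite /= il modnn.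
  apply/adjP; exists (last x s), x; split.
  + rewrite (last_nth x); apply: (in_blk (size s)) => //.
    by rewrite /g take_oversize // -size_filter fA; lia.
  + by rewrite -[x]/(nth x c 0); apply: in_blk; rewrite // g0 eS.
  + by move: cyc; rewrite /= rcons_path => /andP[].
Qed.

Lemma cycle_blocks c :
    path.cycle (@edge G) c -> uniq c -> {subset A <= c} -> #|A| = l -> 0 < l ->
  exists (f : 'I_l -> G) (blk : 'I_l -> {set G}),
    [/\ forall j, f j \in blk j, forall a, a \in A -> exists j, f j = a,
        forall j v, v \in blk j -> v \in c, forall j, connected_set (blk j)
      & (forall i j v, v \in blk i -> v \in blk j -> i = j) /\
        (forall i, ordS i != i -> adj (blk i) (blk (ordS i)))].
Proof.
move=> cyc uc Ac Al l0; have /card_gt0P[a aA] : 0 < #|A| by rewrite Al.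
have [i s es] := rot_to (Ac a aA).
have mem_s : a :: s =i c by move=> v; rewrite -es mem_rot.
have [|||f [blk [h1 h2 h3 h4 h5]]] := @cycle_blocks_rooted a s _ _ aA _ Al.
- by rewrite -es rot_cycle.
- by rewrite -es rot_uniq.
- by move=> v /Ac; rewrite mem_s.
by exists f, blk; split=> // j v /h3; rewrite mem_s.
Qed.

End CycleBlocks.

(** By Menger's theorem there are [l] disjoint paths between the cycles, with no inner
vertex on them. Each cycle is cut into [l] blocks with one foot of a path each, and a
block of the first cycle is enlarged by the path that starts in it. *)
Lemma prism_of_cycles (G : sgraph) (l : nat) (c1 c2 : seq G) :
    0 < l -> ucycle (@edge G) c1 -> ucycle (@edge G) c2 ->
    (forall v, v \in c1 -> v \in c2 -> False) ->
    (forall S : {set G}, #|S| < l -> exists R : {set G}, [/\ connected_set R,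
      [disjoint R & S], exists2 x, x \in R & x \in c1 & exists2 y, y \in R & y \in c2]) ->
  exists s : {perm 'I_l}, is_minor (twisted_prism s) G.
Proof.
move=> l0 /andP[cyc1 u1] /andP[cyc2 u2] dis sep.
pose e : rel G := fun u v => [&& v \notin c1, u \notin c2 & edge u v].
have [S Sl|h [t [tP tD]]] := @menger _ e [set v in c1] [set v in c2] l.
  have [R [cR RS [x xR xc] [y yR yc]]] := sep S Sl.
  have [p [pp lp up sp]] := connected_simple cR xR yR.
  have h1 : has (mem c1) (x :: p) by rewrite /= xc.
  have [s1 [z [s2 [es zc1 ns2]]]] := split_last h1.
  have lz : last z s2 = y by rewrite -lp -[RHS](last_cons z) es last_cat.
  have ny : y \notin c1 by apply/negP => yc1; exact: dis yc1 yc.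
  have h2 : has (mem c2) s2.
    apply/hasP; exists y => //; rewrite -lz; case: s2 lz {es ns2} => [zy|w s2 _] /=.
      by rewrite -zy (_ : z \in c1) in ny.
    exact: mem_last.
  have [t1 [w [t2 [et wc2 nt1]]]] := split_first h2.
  have pz : path (@edge G) z s2.
    case: s1 es => [[<- <-//]|z' s1 [_ ep]].
    by move: pp; rewrite ep cat_path /= => /and3P[].
  have pe : path e z (rcons t1 w).
    move: pz ns2; rewrite et -cat_rcons cat_path has_cat negb_or => /andP[pz _] /andP[n1 _].
    have zc2 : z \notin c2 by apply/negP; exact: dis.
    elim: t1 (z) zc2 pz n1 nt1 {et} => [|a t1 IH] z' /= zc2.
      by rewrite !orbF /e !andbT => -> ->; rewrite zc2.
    case/andP=> za pa; rewrite !negb_or => /andP[na n1] /andP[nac2 nt1].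
    by rewrite /e na zc2 za /=; apply: IH.
  have [||q [qP qs]] := @walk_abpath _ e [set v in c1] [set v in c2] z (rcons t1 w) _ pe.
  - by rewrite in_set; exact: zc1.
  - by rewrite last_rcons in_set; exact: wc2.
  exists z, q; split=> // v /qs vq; rewrite (disjointFr RS) //; apply: sp.
  rewrite es mem_cat et -cat_rcons -cat_cons mem_cat.
  by rewrite vq orbT.
pose P i := [set v in h i :: t i].
have hc1 i : h i \in c1 by case: (tP i); rewrite in_set.
have lc2 i : last (h i) (t i) \in c2 by case: (tP i) => _ _; rewrite in_set.
have tc1 i v : v \in h i :: t i -> v \in c1 -> v = h i.
  rewrite inE => /orP[/eqP//|vt] vc1; have [_ pt _ _] := tP i.
  have : all (fun v => v \notin c1) (t i).
    by elim: (t i) (h i) pt {vt} => //= a s IH b /andP[/and3P[-> _ _] /IH].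
  by move/allP/(_ v vt); rewrite vc1.
have tE i : exists r w, [/\ t i = rcons r w, path (@edge G) (h i) r, edge (last (h i) r) w,
    w \in c2 & forall v, v \in h i :: r -> v \notin c2].
  have [_ pt _ _] := tP i; have := lc2 i.
  case: (lastP (t i)) pt => [_ /= hc2|r w]; first by case: (dis _ (hc1 i) hc2).
  rewrite last_rcons rcons_path => /andP[pr /and3P[_ nl ew]] wc2; exists r, w.
  split=> //; first by apply: sub_path pr => u v /and3P[].
  elim: r (h i) pr nl {ew} => [|a r IH] b /=.
    by move=> _ bc v; rewrite inE => /eqP->.
  move=> /andP[/and3P[_ bc _] pr] la v; rewrite inE => /orP[/eqP->//|].
  exact: IH.
have h_inj : injective h.
  by move=> i j e0; apply: (tD i j (h i)); rewrite ?mem_head // e0 mem_head.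
pose lt i := last (h i) (t i).
have l_inj : injective lt.
  by move=> i j e0; apply: (tD i j (lt i)); rewrite ?mem_last // e0 mem_last.
have cardI (f : 'I_l -> G) : injective f -> #|f @: [set: 'I_l]| = l.
  by move=> fi; rewrite card_imset // cardsT card_ord.
have sub1 : {subset h @: [set: 'I_l] <= c1} by move=> _ /imsetP[i _ ->].
have sub2 : {subset lt @: [set: 'I_l] <= c2}.
  by move=> _ /imsetP[i _ ->]; exact: lc2.
have [f1 [b1 [fb1 on1 bc1 cb1 [db1 ab1]]]] := cycle_blocks cyc1 u1 sub1 (cardI _ h_inj) l0.
have [f2 [b2 [fb2 on2 bc2 cb2 [db2 ab2]]]] := cycle_blocks cyc2 u2 sub2 (cardI _ l_inj) l0.
(* The blocks are matched with the paths through the feet that they contain. *)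
have [j1 j1P] : exists j1 : 'I_l -> 'I_l, forall i, f1 (j1 i) = h i.
  by apply: (fin_all_exists (P := fun i j => f1 j = h i)) => i; apply/on1/imset_f; rewrite inE.
have [j2 j2P] : exists j2 : 'I_l -> 'I_l, forall i, f2 (j2 i) = lt i.
  by apply: (fin_all_exists (P := fun i j => f2 j = lt i)) => i; apply/on2/imset_f; rewrite inE.
have j1_inj : injective j1 by move=> i j e0; apply: h_inj; rewrite -!j1P e0.
have j2_inj : injective j2 by move=> i j e0; apply: l_inj; rewrite -!j2P e0.
pose s : {perm 'I_l} := ((perm j1_inj)^-1 * perm j2_inj)%g.
pose k1 j := (perm j1_inj)^-1%g j.
have k1K j : j1 (k1 j) = j by have := permKV (perm j1_inj) j; rewrite permE.
have sE j : s j = j2 (k1 j) by rewrite permM permE.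
have hb j : h (k1 j) \in b1 j by rewrite -j1P k1K.
pose B (v : 'I_l + 'I_l) : {set G} := match v with
  | inl j => b1 j :|: [set v in P (k1 j) | v \notin c2]
  | inr j => b2 j end.
have Bl1 j v : v \in B (inl j) -> v \in c1 -> v \in b1 j.
  rewrite in_setU => /orP[//|]; rewrite !in_set => /andP[vP _] /(tc1 _ _ vP) ->; exact: hb.
have Bl2 j v : v \in B (inl j) -> v \notin c2.
  rewrite in_setU => /orP[/bc1 vc1|]; last by rewrite !in_set => /andP[].
  by apply/negP; exact: dis vc1.
have matched j : adj (B (inl j)) (B (inr (s j))).
  have [r [w [er pr ew wc2 nr]]] := tE (k1 j).
  apply/adjP; exists (last (h (k1 j)) r), w; split=> //.
    rewrite in_setU; apply/orP; right; rewrite !in_set nr ?mem_last // andbT er.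
    by rewrite -rcons_cons mem_rcons inE mem_last orbT.
  by have := fb2 (s j); rewrite sE j2P /lt er last_rcons.
have cyc_adj (b : 'I_l -> {set G}) (i j : 'I_l) :
    (forall i, ordS i != i -> adj (b i) (b (ordS i))) ->
    @edge (cycle_graph l) i j -> adj (b i) (b j).
  move=> ab /andP[ij /orP[/eqP e0|/eqP e0]].
    by rewrite -e0; apply: ab; rewrite e0 eq_sym.
  by rewrite adj_sym -e0; apply: ab; rewrite e0.
exists s, B; split.
- case=> j; apply/set0Pn; [exists (f1 j)|exists (f2 j)] => //.
  by rewrite in_setU fb1.
- case=> j /=; last exact: cb2.
  have [r [w [er pr ew wc2 nr]]] := tE (k1 j).
  have -> : [set v in P (k1 j) | v \notin c2] = [set v in h (k1 j) :: r].
    apply/setP => v; rewrite !in_set er -rcons_cons mem_rcons inE; apply/andP/idP.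
      by case=> /orP[/eqP->|//]; rewrite wc2.
    by move=> vr; rewrite vr orbT nr.
  apply: (connectedU_meet (cb1 j) (connected_path pr) (hb j)).
  by rewrite in_set mem_head.
- have main j j' : [disjoint B (inl j) & B (inr j')].
    by apply/pred0P => v /=; apply/negP => /andP[/Bl2/negP v2 /bc2].
  case=> i [] j ne; last 1 first.
  + apply/pred0P => v /=; apply/negP => /andP[vi vj].
    by rewrite (db2 _ _ _ vi vj) eqxx in ne.
  + apply/pred0P => v /=; apply/negP => /andP[vi vj].
    suff ij : i = j by rewrite ij eqxx in ne.
    have [vc1|vc1] := boolP (v \in c1); first by apply: (db1 i j v); apply: Bl1.
    have inP k : v \in B (inl k) -> v \in h (k1 k) :: t (k1 k).
      rewrite in_setU => /orP[/bc1|]; first by rewrite (negPf vc1).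
      by rewrite !in_set => /andP[].
    by rewrite -(k1K i) -(k1K j) (tD _ _ v (inP i vi) (inP j vj)).
  + exact: main.
  + by rewrite disjoint_sym.
- case=> i [] j ij; apply/adjP.
  + by apply: (adj_sub _ _ (cyc_adj b1 i j ab1 ij)); rewrite subsetUl.
  + by move/eqP: ij => <-.
  + by rewrite adj_sym; move/eqP: ij => <-.
  + exact: (cyc_adj b2 i j ab2 ij).
Qed.

(** * A large bramble forces a twisted prism or a grid *)

Section Keep.
Variables (G : sgraph) (W : {set G}).

Lemma keep_sym : symmetric (inside W).
Proof. by move=> u v; rewrite /inside edge_sym andbCA. Qed.
Lemma keep_irrefl : irreflexive (inside W).
Proof. by move=> u; rewrite /inside edge_irrefl !andbF. Qed.

(** The graph without the vertices outside [W]; they stay as isolated vertices, so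
that sets of vertices need no translation. *)
Definition keep : sgraph := SGraph keep_sym keep_irrefl.

Lemma keep_connected (S : {set G}) :
  S \subset W -> connected_set S -> @connected_set keep S.
Proof.
move=> /subsetP SW cS x y xS yS; apply: connect_sub (cS x y xS yS) => u v /and3P[uS vS uv].
by apply: connect1; rewrite /= uS vS !SW.
Qed.

Lemma connected_of_keep (S : {set G}) : @connected_set keep S -> connected_set S.
Proof.
move=> cS x y xS yS; apply: connect_sub (cS x y xS yS) => u v /and3P[uS vS /and3P[_ _ uv]].
by apply: connect1; rewrite /= uS vS.
Qed.

Lemma keep_adj (A B : {set G}) :
  A \subset W -> B \subset W -> adj A B -> @adj keep A B.
Proof.
move=> /subsetP AW /subsetP BW /adjP[u [v [uA vB uv]]]; apply/adjP; exists u, v.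
by split=> //=; rewrite AW ?BW.
Qed.

Lemma minor_of_keep F : is_minor F keep -> is_minor F G.
Proof.
case=> B [B0 Bc Bd Be]; exists B; split=> // [x|x y /Be[u [v [uB vB /and3P[_ _ uv]]]]].
  exact/connected_of_keep.
by exists u, v.
Qed.

Lemma connected_keep_sub (S : {set G}) x :
  @connected_set keep S -> x \in S -> x \in W -> S \subset W.
Proof.
move=> cS xS xW; apply/subsetP => y yS; apply: contraT => yW.
by have [u [v [_ /negP vW /and3P[_ _ /and3P[_ ? _]] _]]] := connect_exit (cS x y xS yS) xW yW.
Qed.

End Keep.

Section FromBramble.
Variables (G : sgraph) (BB : {set {set G}}) (l : nat).
Hypothesis l3 : 2 < l.
Hypothesis brBB : bramble BB.
Hypothesis large : forall Y : {set G}, #|Y| <= 2 * l + 11 ->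
  exists2 b, b \in BB & [disjoint b & Y].
Implicit Types (S X Y Z Q A : {set G}) (x : nat -> G) (F : nat -> {set G}).

(** A path inside [X] closes the ear to a cycle, which has at least three vertices
since one vertex separates a trivial ear from the bramble. *)
Lemma cycle_of_ear Z X : connected_set X -> [disjoint X & Z] -> ear BB l Z X X ->
  exists c, [/\ ucycle (@edge G) c, forall v, v \in c -> v \in X \/ v \in Z
    & forall S, #|S| < l -> ~~ [disjoint beta BB S & [set v in c]]].
Proof.
move=> cX dXZ [s [p [sX lX [ps us] pZ fat]]].
have [r [pr lr ur sr]] := connected_simple cX lX sX.
case: (lastP r) pr lr ur sr => [|r' w] pr lr ur sr.
  rewrite /= in lr; have p0 : p = [::].
    by case: p lr us {ps pZ lX fat pr ur sr} => //= a p <-; rewrite mem_last.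
  have s1 : #|[set s]| < l by rewrite cards1; lia.
  case/negP: (fat _ s1).
  apply/pred0P => v /=; apply/negP => /andP[/notin_beta].
  by rewrite p0 !inE => /negPf->.
rewrite last_rcons in lr; subst w.
move: ur; rewrite /= mem_rcons inE negb_or rcons_uniq => /andP[/andP[ls lr] /andP[sr' ur]].
exists (s :: p ++ r'); split.
- apply/andP; split.
    by rewrite /= rcons_cat cat_path ps.
  rewrite -cat_cons cat_uniq us ur andbT; apply/hasPn => v vr; apply/negP => /= vp.
  have vX : v \in X by apply: sr; rewrite inE mem_rcons inE vr !orbT.
  have vl : v != last s p by apply: contraNneq lr => <-.
  move: vp; rewrite inE => /orP[/eqP vs|vp]; first by rewrite -vs vr in sr'.
  by have := pZ v vp vl; rewrite (disjointFr dXZ vX).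
- move=> v; rewrite -cat_cons mem_cat inE => /orP[/orP[/eqP->|vp]|vr]; [by left| |].
    by have [->|ne] := eqVneq v (last s p); [left|right; apply: pZ].
  by left; apply: sr; rewrite inE mem_rcons inE vr !orbT.
- move=> S /fat; apply: contra; rewrite !(disjoint_sym (beta _ _)).
  apply: disjointWl; apply/subsetP => v; rewrite !in_set -cat_cons mem_cat.
  by move=> ->.
Qed.

Lemma prism_of_ears Z1 Z2 X Y : connected_set X -> connected_set Y ->
    [disjoint X & Y] -> [disjoint X & Z1 :|: Z2] -> [disjoint Y & Z1 :|: Z2] ->
    [disjoint Z1 & Z2] -> ear BB l Z1 X X -> ear BB l Z2 Y Y ->
  exists s : {perm 'I_l}, is_minor (twisted_prism s) G.
Proof.
rewrite !disjoint_setUr => cX cY dXY /andP[dX1 dX2] /andP[dY1 dY2] d12 e1 e2.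
have [c1 [cyc1 in1 fat1]] := cycle_of_ear cX dX1 e1.
have [c2 [cyc2 in2 fat2]] := cycle_of_ear cY dY2 e2.
apply: (@prism_of_cycles G l c1 c2) => //; first by lia.
  move=> v /in1[vX|v1] /in2[vY|v2].
  - by rewrite (disjointFr dXY vX) in vY.
  - by rewrite (disjointFr dX2 vX) in v2.
  - by rewrite (disjointFr dY1 vY) in v1.
  - by rewrite (disjointFr d12 v1) in v2.
have meet c S : ~~ [disjoint beta BB S & [set v in c]] -> exists2 x, x \in beta BB S & x \in c.
  by rewrite -setI_eq0 => /set0Pn[x /setIP[xb]]; rewrite in_set => xc; exists x.
move=> S Sl; exists (beta BB S); split; [exact: beta_connected|exact: beta_disjoint|..].
  by apply: meet; apply: fat1.
by apply: meet; apply: fat2.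
Qed.

Lemma fork_at Z k x F i : state BB Z k x F -> noncover BB Z k -> i < k ->
  exists x' F', [/\ state BB Z k.+1 x' F', forall j, j < k -> F j \subset F' j
    & adj (F' i) (F' k)].
Proof.
move=> st0 nc ik; have [x1 [t [st lkp _]]] := state_close brBB st0 nc.
set F1 := fun i : nat => _ in st.
have nz : beta BB (Z :|: tips x1 k) != set0 by apply: nc; rewrite (card_tips st).
have [v vb xv] := linked_neighbor brBB (st_linked st) nz (tips_in x1 ik).
exists (update x1 k v), (update F1 k [set v]); split; first exact: state_fork.
  by move=> j jk; rewrite update_lt // subsetUl.
rewrite update_eq update_lt //; apply/adjP; exists (x1 i), v; split=> //.
  exact: (st_tip st ik).
by rewrite inE.
Qed.

Lemma grow_chain n : n <= 6 -> exists x F, state BB set0 n.+1 x F /\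
  forall i, i < n -> adj (F i) (F i.+1).
Proof.
have seal0 : sealed BB set0 0.
  by exists set0; rewrite ?cards0 // -setI_eq0 setI0.
elim: n => [_|n IH n6].
  have /set0Pn[v vb] : beta BB set0 != set0 by apply: beta_neq0 large _ _; rewrite ?cards0.
  have tE : tips (fun=> v) 1 = [set v].
    apply/setP => w; rewrite in_set1.
    by apply/tipsP/eqP => [[i _ ->]|->]; last exists 0.
  exists (fun=> v), (fun=> [set v]); split=> //; split.
  - by move=> i _; rewrite set11.
  - by move=> i _; apply: connected1.
  - by move=> [|i] [|j].
  - by move=> i w _ _; rewrite inE.
  - move=> i w _ /set1P->; apply/negP => /notin_beta.
    by rewrite tE in_setU set11 orbT.
  - move=> S; rewrite tE cards1 ltnS leqn0 cards_eq0 => /eqP->.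
    by exists v; rewrite ?set11 ?setU0.
have [x [F [st ch]]] := IH (ltnW n6).
have nc : noncover BB set0 n.+1 by apply: (sealed_noncover brBB large seal0); lia.
have [x' [F' [st' sub an]]] := fork_at st nc (ltnSn n).
exists x', F'; split=> // i; rewrite ltnS leq_eqVlt => /orP[/eqP->//|ilt].
by apply: adj_sub (ch i ilt); apply: sub; lia.
Qed.

(** The anchors 0 to 6 arise by repeatedly forking from the last set. Two ears start at
the first and the last anchor and end in new sets 7 and 8, each of which is forked
once more to form a hub with two tips. Each ear is sealed by [l - 1] vertices, so a
cover of the rest of the bramble still needs more than
[2 * l + 11 - 2 * (l - 1) = 13] vertices. *)
Lemma grow_all : exists Z1 Z2 x F,
  [/\ state BB Z2 11 x F, linked_plus BB Z2 (tips x 11), noncover BB Z2 13,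
      [/\ forall i, i < 6 -> adj (F i) (F i.+1), adj (F 7) (F 9) & adj (F 8) (F 10)]
    & [/\ Z1 \subset Z2, ear BB l Z1 (F 0) (F 7) & ear BB l (Z2 :\: Z1) (F 6) (F 8)]].
Proof.
have seal0 : sealed BB set0 0.
  by exists set0; rewrite ?cards0 // -setI_eq0 setI0.
have [x0 [F0 [st0 ch]]] := grow_chain (leqnn 6).
have [||Z1 [x1 [F1 [_ st1 sub1 ear1 seal1]]]] :=
  @grow_ear G BB (2 * l + 11) brBB large l l3 set0 0 7 0 x0 F0 _ _ seal0 st0; [lia|by []|].
rewrite setD0 in ear1.
have [||Z2 [x2 [F2 [Z12 st2 sub2 ear2 seal2]]]] :=
  @grow_ear G BB (2 * l + 11) brBB large l l3 Z1 (0 + (l - 1)) 8 6 x1 F1 _ _ seal1 st1; [lia|by []|].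
have nc n : n <= 13 -> noncover BB Z2 n.
  by move=> n13; apply: (sealed_noncover brBB large seal2); lia.
have [x3 [F3 [st3 sub3 a79]]] := fork_at st2 (nc 9 isT) (isT : 7 < 9).
have [x4 [F4 [st4 sub4 a8]]] := fork_at st3 (nc 10 isT) (isT : 8 < 10).
have [x5 [t [st5 lkp _]]] := state_close brBB st4 (nc 11 isT).
set F5 := fun i : nat => _ in st5.
have sub5 i : F4 i \subset F5 i by apply: subsetUl.
have s35 i : i < 10 -> F3 i \subset F5 i by move=> i10; apply: subset_trans (sub4 i i10) (sub5 i).
have s25 i : i < 9 -> F2 i \subset F5 i.
  by move=> i9; apply: subset_trans (sub3 i i9) (s35 i _); lia.
have s15 i : i < 8 -> F1 i \subset F5 i.
  by move=> i8; apply: subset_trans (sub2 i i8) (s25 i _); lia.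
have s05 i : i < 7 -> F0 i \subset F5 i.
  by move=> i7; apply: subset_trans (sub1 i i7) (s15 i _); lia.
exists Z1, Z2, x5, F5; split=> //; first exact: nc.
  split.
  - by move=> i i6; apply: adj_sub (ch i i6); apply: s05; lia.
  - by apply: adj_sub a79; apply: s35.
  - by apply: adj_sub a8; apply: sub5.
split=> //.
  by apply: ear_sub ear1 => //; apply: s15.
by apply: ear_sub ear2 => //; apply: s25.
Qed.

(** By Menger's theorem it suffices to avoid a set [S] of two vertices. Some bramble
element avoids the eleven tips and [S]. Deleting [S] and the eight tips other than the
given three, at most ten vertices, leaves it connected to one of the three, and by
[linked_plus] deleting [S] and the nine tips outside the hub, at most eleven
vertices, leaves it connected to a neighbour of the hub. *)
Lemma linkage Z x F (ix : 'I_3 -> nat) (h1 h2 : nat) :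
    state BB Z 11 x F -> linked_plus BB Z (tips x 11) -> noncover BB Z 13 ->
    injective ix -> (forall i, ix i < 11) -> (forall i, ix i != h1) ->
    (forall i, ix i != h2) -> h1 < 11 -> h2 < 11 -> h1 != h2 ->
  exists D : 'I_3 -> {set G}, [/\ forall i, D i \subset beta BB (Z :|: tips x 11),
    forall i, connected_set (D i), forall i j v, v \in D i -> v \in D j -> i = j,
    forall i, adj [set x (ix i)] (D i) & forall i, adj (D i) [set x h1; x h2]].
Proof.
move=> st lkp nc ix_inj ix11 n1 n2 h11 h21 h12.
set X := tips x 11; set U := beta BB (Z :|: X).
have x_inj i j : i < 11 -> j < 11 -> x i = x j -> i = j.
  move=> i11 j11 e; apply: (st_disj st i11 j11 (v := x i)); first exact: (st_tip st).
  by rewrite e; apply: (st_tip st).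
have cX : #|X| = 11 := card_tips st.
pose A : {set G} := [set x (ix i) | i : 'I_3].
have AX : A \subset X by apply/subsetP => _ /imsetP[i _ ->]; apply: tips_in.
have cA : #|A| = 3.
  by rewrite card_imset ?card_ord // => i j /x_inj e; apply/ix_inj/e.
have UX v : v \in U -> v \notin X by move=> /notin_beta; rewrite in_setU negb_or => /andP[].
have exitU (R : {set G}) u v : R \subset ~: Z -> v \in R -> v \notin U -> u \in U -> edge u v -> v \in X.
  move=> RZ vR vU uU uv; apply: contraT => vX; move: vU.
  rewrite (beta_closed brBB uU uv) // in_setU negb_or vX andbT.
  by have := subsetP RZ v vR; rewrite in_setC.
pose Hb : {set G} := [set v in U | edge v (x h1) || edge v (x h2)].
pose e : rel G := fun u v => (v \in U) && edge u v.
have [S|t [tP tD]] := @menger_all _ e A Hb.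
  rewrite cA => S3.
  have /set0Pn[z zW] : beta BB (Z :|: (X :|: S)) != set0.
    by apply: nc; apply: leq_trans (leq_card_setU _ _) _; rewrite cX; lia.
  have zU : z \in U by apply: (subsetP (beta_anti brBB _)) zW; rewrite setUA subsetUl.
  have WR (C : {set G}) : C \subset X :|: S -> z \in beta BB (Z :|: C).
    by move=> CS; apply: (subsetP (beta_anti brBB _)) zW; apply: setUS.
  have RZ (C : {set G}) : beta BB (Z :|: C) \subset ~: Z.
    by apply/subsetP => v /notin_beta; rewrite in_setU negb_or in_setC => /andP[].
  have Ravoid (C : {set G}) v : v \in beta BB (Z :|: C) -> v \notin C.
    by move=> /notin_beta; rewrite in_setU negb_or => /andP[].
  have [u [v [uS uU vA vS [uv uz]]]] : exists u v, [/\ u \notin S, u \in U, v \in A, v \notin S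
      & edge v u /\ connect (inside (U :\: S)) u z].
    pose C := (X :\: A) :|: S.
    have Clt : #|C| < #|X|.
      apply: leq_ltn_trans (leq_card_setU _ _) _; rewrite cardsD (setIidPr AX) cX cA.
      lia.
    have zR : z \in beta BB (Z :|: C) by apply: WR; apply: setSU; apply: subsetDl.
    have [y yX yR] := st_linked st Clt.
    have yU : y \notin U by apply/negP => /UX; rewrite yX.
    have [u [v [/setIP[uR uU] /setDP[vR vU] uv zu]]] :=
      connected_exit (beta_connected brBB (Y := _)) zR yR zU yU.
    have vX := exitU _ u v (RZ C) vR vU uU uv.
    have := Ravoid _ _ vR; rewrite in_setU in_setD vX andbT negb_or negbK => /andP[vA vS].
    have := Ravoid _ _ uR; rewrite in_setU negb_or => /andP[_ uS].
    exists u, v; split=> //; split; first by rewrite edge_sym.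
    rewrite inside_csym; apply: connect_inside_sub zu; apply/subsetP => w /setIP[wR wU].
    by have := Ravoid _ _ wR; rewrite in_setU negb_or => /andP[_ wS]; rewrite in_setD wS.
  have [w [wH zw]] : exists w, w \in Hb /\ connect (inside (U :\: S)) z w.
    pose C := (X :\: [set x h1; x h2]) :|: S.
    have hX : [set x h1; x h2] \subset X.
      by rewrite subUset !sub1set !tips_in.
    have hne : x h1 != x h2 by apply: contra h12 => /eqP/(x_inj _ _ h11 h21)->.
    have Cle : #|C| <= 11.
      apply: leq_trans (leq_card_setU _ _) _; rewrite cardsD (setIidPr hX) cX cards2 hne.
      lia.
    have zR : z \in beta BB (Z :|: C) by apply: WR; apply: setSU; apply: subsetDl.
    have nzU : U != set0 by apply/set0Pn; exists z.
    have [v1 v1U hv] := linked_neighbor brBB (st_linked st) nzU (tips_in x h11).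
    have Clt : #|C| < #|v1 |: X| by rewrite cardsU1 (UX v1 v1U) cX.
    have subS w : connect (inside (beta BB (Z :|: C) :&: U)) z w ->
        connect (inside (U :\: S)) z w.
      apply: connect_inside_sub; apply/subsetP => a /setIP[aR aU].
      by have := Ravoid _ _ aR; rewrite in_setU negb_or => /andP[_ aS]; rewrite in_setD aS.
    have [RU|/subsetPn[y yR yU]] := boolP (beta BB (Z :|: C) \subset U).
      have [y yX yR] := lkp v1 v1U _ Clt; exists v1.
      have yv : y = v1.
        move: yX; rewrite in_setU1 => /orP[/eqP//|yX].
        by have := UX y (subsetP RU y yR); rewrite yX.
      rewrite in_set v1U edge_sym hv; split=> //; apply: subS.
      rewrite (setIidPl RU) -yv; exact: (beta_connected brBB).
    have [a [b [/setIP[aR aU] /setDP[bR bU] ab za]]] :=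
      connected_exit (beta_connected brBB (Y := _)) zR yR zU yU.
    have bX := exitU _ a b (RZ C) bR bU aU ab.
    have := Ravoid _ _ bR; rewrite in_setU in_setD bX andbT negb_or negbK in_set2.
    move=> /andP[/orP bh _]; exists a; split; last exact: subS.
    by rewrite in_set aU; case: bh => /eqP <-; rewrite ab ?orbT.
  have uw := connect_trans uz zw.
  have [p [pp lp up]] := connect_simple uw.
  have uUS : u \in U :\: S by rewrite in_setD uS uU.
  have pUS : all (mem (U :\: S)) (u :: p).
    by apply: path_all uUS pp => a b /and3P[].
  have pe : path e v (u :: p).
    rewrite /= {1}/e uU uv /=; apply: sub_path pp => a b /and3P[_ bU ab].
    by rewrite /e ab andbT; move: bU; rewrite in_setD => /andP[].
  have [|q [qP qs]] := @walk_abpath _ e A Hb v (u :: p) vA pe.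
    by rewrite /= lp.
  exists v, q; split=> // a /qs; rewrite inE => /orP[/eqP->//|/(allP pUS) /=].
  by rewrite in_setD => /andP[].
have xA i : x (ix i) \in A by apply: imset_f.
have tE i : exists b r, [/\ t (x (ix i)) = b :: r, edge (x (ix i)) b,
    path (@edge G) b r, last b r \in Hb & {subset b :: r <= U}].
  have [_ pt lt _] := tP _ (xA i).
  case: (t _) pt lt => [|b r] pt lt.
    move: lt => /=; rewrite in_set => /andP[/UX].
    by rewrite (tips_in x (ix11 i)).
  have /andP[/andP[bU xb] pr] := pt; exists b, r; split=> //.
    by apply: sub_path pr => u v /andP[].
  by apply/allP; apply: (path_all (a := mem U) _ bU pr) => u v /andP[].
exists (fun i => [set v in t (x (ix i))]); split.
- by move=> i; have [b [r [-> _ _ _ s]]] := tE i; apply/subsetP => v; rewrite in_set => /s.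
- by move=> i; have [b [r [-> _ pr _ _]]] := tE i; apply: connected_path.
- move=> i j v; rewrite !in_set => vi vj.
  apply/ix_inj/x_inj => //; apply: (tD _ _ v (xA i) (xA j)); by rewrite inE ?vi ?vj orbT.
- move=> i; have [b [r [-> xb _ _ _]]] := tE i; apply/adjP; exists (x (ix i)), b.
  by rewrite set11 in_set mem_head.
- move=> i; have [b [r [-> _ _ lr _]]] := tE i; move: lr; rewrite in_set => /andP[_].
  by case/orP=> lx; apply/adjP; exists (last b r);
    [exists (x h1)|exists (x h2)]; rewrite in_set mem_last in_set2 eqxx ?orbT.
Qed.

(** If disjoint connected sets joined the ends of the two ears outside the deleted
vertices, the ears would close up to disjoint cycles that fewer than [l] vertices do
not separate, and there would be a prism. Hence the structure of [grow_all] is a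
crossing. *)
Theorem prism_or_grid_of_bramble :
  (exists s : {perm 'I_l}, is_minor (twisted_prism s) G) \/ is_minor (grid 4 4) G.
Proof.
have [Z1 [Z2 [x [F [st lkp nc [ch a79 a8] [Z12 ear1 ear2]]]]]] := grow_all.
have [[s sP]|noprism] := pselect (exists s : {perm 'I_l}, is_minor (twisted_prism s) G).
  by left; exists s.
right; set X := tips x 11 in lkp; set U := beta BB (Z2 :|: X).
have [|||||||D [DU Dc Dd Da Dh]] :=
  @linkage Z2 x F (fun i : 'I_3 => i : nat) 7 9 st lkp nc => //.
- exact: val_inj.
- by move=> i; have := ltn_ord i; lia.
- by move=> i; have := ltn_ord i; lia.
- by move=> i; have := ltn_ord i; lia.
have [|||||||E [EU Ec Ed Ea Eh]] :=
  @linkage Z2 x F (fun i : 'I_3 => 4 + i) 8 10 st lkp nc => //.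
- by move=> i j /addnI/val_inj.
- by move=> i; have := ltn_ord i; lia.
- by move=> i; have := ltn_ord i; lia.
- by move=> i; have := ltn_ord i; lia.
pose S k := if k < 7 then F k else if k == 7 then F 7 :|: F 9 else F 8 :|: F 10.
pose C b := if b then D else E.
have CU b i : C b i \subset U by case: b.
have SF k v : k < 9 -> v \in S k -> exists2 m, m < 11 & v \in F m /\
    k = if m < 9 then m else m - 2.
  move=> k9; rewrite /S; case: ifP => k7; last case: eqP => [->|k8].
  - by exists k; [lia|rewrite k9].
  - by rewrite in_setU => /orP[?|?]; [exists 7|exists 9].
  - have -> : k = 8 by lia.
    by rewrite in_setU => /orP[?|?]; [exists 8|exists 10].
have SZ k : k < 9 -> S k \subset ~: Z2.
  move=> k9; apply/subsetP => v /(SF _ _ k9)[m m11 [vm _]]; rewrite in_setC.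
  exact: (st_out st m11 vm).
have CZ b i : C b i \subset ~: Z2.
  apply/subsetP => v /(subsetP (CU b i))/notin_beta.
  by rewrite in_setU negb_or in_setC => /andP[].
have FS m : m < 9 -> F m \subset S m.
  move=> m9; rewrite /S; case: ifP => // m7; case: eqP => [->|m8]; first exact: subsetUl.
  have -> : m = 8 by lia.
  exact: subsetUl.
apply: minor_of_keep; apply: (@grid_of_crossing (keep (~: Z2)) S C); split.
- move=> k k9; apply: keep_connected; first exact: SZ.
  rewrite /S; case: ifP => k7; first by apply: (st_conn st); lia.
  by case: eqP => _; apply: connectedU_adj => //; apply: (st_conn st).
- move=> i j i9 j9 ij; apply/pred0P => v /=; apply/negP => /andP[].
  move=> /(SF _ _ i9)[m m11 [vm im]] /(SF _ _ j9)[n n11 [vn jn]].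
  by rewrite im jn (st_disj st m11 n11 vm vn) eqxx in ij.
- move=> i i6; apply: keep_adj; [by apply: SZ; lia|by apply: SZ; lia|].
  by apply: adj_sub (ch i i6); apply: FS; lia.
- by move=> b i; apply: keep_connected; [apply: CZ|case: b].
- move=> b i j ij; apply/pred0P => v /=; apply/negP => /andP[vi vj]; case/eqP: ij.
  by case: b vi vj; [apply: Dd|apply: Ed].
- move=> b i k k9; apply/pred0P => v /=; apply/negP => /andP[/(subsetP (CU b i)) vU].
  by move=> /(SF _ _ k9)[m m11 [/(st_beta st m11)]]; rewrite vU.
- move=> b i; apply: keep_adj => //; first by apply: SZ; apply: anchor_lt.
  have i3 := ltn_ord i; case: b => /=.
    apply: adj_sub (Da i) => //; rewrite sub1set; apply: (subsetP (FS i _)); first lia.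
    by apply: (st_tip st); lia.
  apply: adj_sub (Ea i) => //; rewrite sub1set; apply: (subsetP (FS (4 + i) _)); first lia.
  by apply: (st_tip st); lia.
- move=> b i; apply: keep_adj => //; first by apply: SZ; apply: hub_lt.
  by case: b => /=; [apply: adj_sub (Dh i)|apply: adj_sub (Eh i)] => //;
    apply/subsetP => v; rewrite in_set2 in_setU => /orP[]/eqP->; rewrite !(st_tip st) ?orbT.
- move=> X' Y' cX cY sX sY dis; apply: noprism.
  have /subUsetP[X0 X7] := sX; have /subUsetP[Y6 Y8] := sY.
  have x0 : x 0 \in S 0 by apply: (st_tip st).
  have x6 : x 6 \in S 6 by apply: (st_tip st).
  have XZ := connected_keep_sub cX (subsetP X0 _ x0) (subsetP (SZ 0 isT) _ x0).
  have YZ := connected_keep_sub cY (subsetP Y6 _ x6) (subsetP (SZ 6 isT) _ x6).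
  have Z12' : Z1 :|: (Z2 :\: Z1) = Z2.
    by apply/setP => v; rewrite !inE; have := subsetP Z12 v; case: (v \in Z1) => //= ->.
  apply: (@prism_of_ears Z1 (Z2 :\: Z1) X' Y').
  + exact: connected_of_keep cX.
  + exact: connected_of_keep cY.
  + by [].
  + by rewrite Z12' disjoints_subset.
  + by rewrite Z12' disjoints_subset.
  + by apply/pred0P => v /=; rewrite in_setD; case: (v \in Z1).
  + by apply: ear_sub ear1 => //; apply: subset_trans (FS _ _) _.
  + by apply: ear_sub ear2 => //; apply: subset_trans (FS _ _) _.
Qed.

End FromBramble.

(** * Tree-decompositions as binary trees of bags *)

Section DTree.
Variable G : finType.

Inductive dtree := Leaf | Node of {set G} & dtree & dtree.

Fixpoint bags t : seq {set G} :=
  if t is Node b t1 t2 then b :: bags t1 ++ bags t2 else [::].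

Fixpoint verts t : {set G} :=
  if t is Node b t1 t2 then b :|: (verts t1 :|: verts t2) else set0.

Definition root_bag t : {set G} := if t is Node b _ _ then b else set0.

(** These inclusions express that the bags containing a given vertex form a subtree. *)
Fixpoint valid t : Prop :=
  if t is Node b t1 t2 then
    [/\ valid t1, valid t2, verts t1 :&: b \subset root_bag t1,
        verts t2 :&: b \subset root_bag t2 & verts t1 :&: verts t2 \subset b]
  else True.

Lemma vertsP t v : reflect (exists2 b, b \in bags t & v \in b) (v \in verts t).
Proof.
elim: t => [|b t1 IH1 t2 IH2] /=; first by rewrite inE; constructor; case.
rewrite !in_setU; apply: (iffP or3P).
  case=> [vb|/IH1[c c1 vc]|/IH2[c c2 vc]]; [exists b|exists c|exists c] => //;
  by rewrite inE ?eqxx // mem_cat ?c1 ?c2 ?orbT.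
case=> c; rewrite inE mem_cat => /or3P[/eqP->|c1|c2] vc.
- by constructor 1.
- by constructor 2; apply/IH1; exists c.
- by constructor 3; apply/IH2; exists c.
Qed.

Lemma bag_verts t b v : b \in bags t -> v \in b -> v \in verts t.
Proof. by move=> bt vb; apply/vertsP; exists b. Qed.

Lemma valid_swap b t1 t2 : valid (Node b t1 t2) -> valid (Node b t2 t1).
Proof. by case=> *; split=> //; rewrite setIC. Qed.

(** Rotation: the root moves to its first child, whose own children stay below
it; the old root becomes a grandchild behind a copy of the new root. *)
Lemma valid_rotate r b u1 u2 t : valid (Node r (Node b u1 u2) t) ->
  valid (Node b u1 (Node b u2 (Node r Leaf t))).
Proof.
case=> -[vu1 vu2 /subsetP u1b /subsetP u2b /subsetP u12] vt /subsetP h1 /subsetP tr /subsetP h2.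
rewrite /= in h1 h2; split=> //=.
- split=> //=.
  + by split=> //=; rewrite ?set0I ?sub0set //; apply/subsetP.
  + exact/subsetP.
  + apply/subsetP => v; rewrite !inE /= => /andP[/orP[//|vt'] vb].
    by apply: h2; rewrite !inE vb vt'.
  + apply/subsetP => v; rewrite !inE /= => /andP[v2 vr]; apply: h1.
    rewrite !inE v2 !orbT /=; case/orP: vr => // vt'.
    by apply: h2; rewrite !inE v2 vt' !orbT.
- exact/subsetP.
- exact: subsetIr.
- apply/subsetP => v; rewrite !inE /= => /andP[v1 /or3P[//|v2|vr]].
    by apply: u12; rewrite inE v1.
  apply: h1; rewrite !inE v1 !orbT /=; case/orP: vr => // vt'.
  by apply: h2; rewrite !inE v1 vt' !orbT.
Qed.

(** By induction on the subtree that contains the new root: after a rotation the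
new root lies in a smaller first subtree. *)
Lemma reroot_left r t1 t2 b : valid (Node r t1 t2) -> b \in bags t1 ->
  exists u1 u2, valid (Node b u1 u2) /\ bags (Node b u1 u2) =i bags (Node r t1 t2).
Proof.
elim: t1 r t2 => // b1 u1 IH1 u2 IH2 r t2 vt.
have -> : bags (Node b1 u1 u2) = b1 :: bags u1 ++ bags u2 by []; rewrite inE mem_cat.
case/or3P=> [/eqP->|bu1|bu2].
- exists u1, (Node b1 u2 (Node r Leaf t2)); split; first exact: valid_rotate.
  move=> c; rewrite /= !(inE, mem_cat).
  by case: (c == b1); case: (c == r); case: (c \in bags u1); case: (c \in bags u2).
- have [w1 [w2 [vw wE]]] := IH1 _ _ (valid_rotate vt) bu1; exists w1, w2; split=> // c.
  rewrite wE /= !(inE, mem_cat).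
  by case: (c == b1); case: (c == r); case: (c \in bags u1); case: (c \in bags u2).
- have vt' : valid (Node r (Node b1 u2 u1) t2).
    case: vt => v1 v2 h1 h2 h3; split=> //; first exact: valid_swap.
      by move: h1 => /=; rewrite [verts u1 :|: _]setUC.
    by move: h3 => /=; rewrite [verts u1 :|: _]setUC.
  have [w1 [w2 [vw wE]]] := IH2 _ _ (valid_rotate vt') bu2; exists w1, w2; split=> // c.
  rewrite wE /= !(inE, mem_cat).
  by case: (c == b1); case: (c == r); case: (c \in bags u1); case: (c \in bags u2).
Qed.

Lemma reroot t b : valid t -> b \in bags t ->
  exists u1 u2, valid (Node b u1 u2) /\ bags (Node b u1 u2) =i bags t.
Proof.
case: t => // r t1 t2 vt; rewrite inE mem_cat => /or3P[/eqP->|b1|b2].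
- by exists t1, t2.
- exact: reroot_left vt b1.
- have [u1 [u2 [vu uE]]] := reroot_left (valid_swap vt) b2; exists u1, u2; split=> // c.
  by rewrite uE /= !(inE, mem_cat) [(c \in bags t2) || _]orbC.
Qed.

End DTree.

Arguments Leaf {G}.

Section Attach.
Variables (T1 T2 : sgraph) (r1 : T1) (r2 : T2).

Definition attach_rel : rel (T1 + T2) := fun x y =>
  match x, y with
  | inl a, inl b => edge a b
  | inr a, inr b => edge a b
  | inl a, inr b => (a == r1) && (b == r2)
  | inr b, inl a => (a == r1) && (b == r2)
  end.
Lemma attach_sym : symmetric attach_rel.
Proof. by case=> a [] b //=; rewrite edge_sym. Qed.
Lemma attach_irrefl : irreflexive attach_rel.
Proof. by case=> a /=; rewrite edge_irrefl. Qed.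
Definition attach : sgraph := SGraph attach_sym attach_irrefl.

Lemma attach_connected (S1 : {set T1}) (S2 : {set T2}) (S : {set attach}) :
    connected_set S1 -> connected_set S2 ->
    (S1 != set0 -> S2 != set0 -> r1 \in S1 /\ r2 \in S2) ->
    (forall a, (inl a \in S) = (a \in S1)) -> (forall b, (inr b \in S) = (b \in S2)) ->
  connected_set S.
Proof.
move=> c1 c2 h e1 e2.
pose I1 : {set attach} := [set inl a | a in S1].
pose I2 : {set attach} := [set inr b | b in S2].
have cI1 : connected_set I1.
  by apply: (@connected_image T1 attach inl _ _ c1) => x y _ _ ?; right.
have cI2 : connected_set I2.
  by apply: (@connected_image T2 attach inr _ _ c2) => x y _ _ ?; right.
have -> : S = I1 :|: I2.
  apply/setP => -[a|b]; rewrite in_setU ?e1 ?e2.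
    rewrite mem_imset; last by move=> ? ? [].
    by rewrite [X in _ || X](_ : _ = false) ?orbF //; apply/imsetP => -[].
  rewrite [X in X || _](_ : _ = false) //; last by apply/imsetP => -[].
  by rewrite mem_imset //; move=> ? ? [].
have [S10|n1] := eqVneq S1 set0; first by rewrite /I1 S10 imset0 set0U.
have [S20|n2] := eqVneq S2 set0; first by rewrite /I2 S20 imset0 setU0.
have [h1 h2] := h n1 n2; apply: connectedU_adj => //.
by apply/adjP; exists (inl r1), (inr r2); rewrite !imset_f //= !eqxx.
Qed.

End Attach.

(** The parent function [par] and the height [h] witness that there are no cycles. *)
Definition rooted (T : sgraph) (r : T) (par : T -> T) (h : T -> nat) : Prop :=
  h r = 0 /\ forall x y, edge x y ->
    (par x = y /\ h y < h x) \/ (par y = x /\ h x < h y).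

(** At a highest vertex of a cycle both edges lead to the parent, so they coincide. *)
Lemma rooted_acyclic (T : sgraph) (r : T) (par : T -> T) (h : T -> nat) (c : seq T) :
  rooted r par h -> ucycle (@edge T) c -> size c < 3.
Proof.
move=> [_ hP] /andP[cyc uc]; case: c cyc uc => // x c cyc uc.
case: (@arg_maxnP _ x (mem (x :: c)) h (mem_head _ _)) => m mc max.
have [i s es] := rot_to mc.
have cyc' : path.cycle (@edge T) (m :: s) by rewrite -es rot_cycle.
have us : uniq (m :: s) by rewrite -es rot_uniq.
have sz : size (x :: c) = size (m :: s) by rewrite -es size_rot.
have below y : y \in m :: s -> edge m y -> y = par m.
  rewrite -es mem_rot => yc my; case: (hP _ _ my) => [[-> //]|[_]].
  by have := max y yc; lia.
rewrite sz; case: s cyc' us below {es sz} => // a s /= /andP[ma].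
rewrite rcons_path => /andP[_ lm] /and3P[_ as_ _] below.
have ea : a = par m by apply: below; rewrite // !inE eqxx orbT.
have el : last a s = par m by apply: below; rewrite 1?edge_sym // inE mem_last orbT.
by case: s as_ el {lm below} => // b s; rewrite -ea /= => /negP + e; rewrite -e mem_last.
Qed.

(** A node is attached to the realizations of its two subtrees; an empty subtree
contributes nothing. *)
Lemma realize (G : finType) (t : dtree G) : valid t -> t <> Leaf ->
  exists (T : sgraph) (r : T) (B : T -> {set G}) (par : T -> T) (h : T -> nat),
    [/\ rooted r par h, connected_set [set: T] /\ B r = root_bag t,
        forall n, B n \in bags t, forall b, b \in bags t -> exists n, B n = b
      & forall v, connected_set [set n | v \in B n]].
Proof.
have join (T1 T2 : sgraph) (r1 : T1) (r2 : T2) (B1 : T1 -> {set G}) (B2 : T2 -> {set G})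
    (par1 : T1 -> T1) (h1 : T1 -> nat) (par2 : T2 -> T2) (h2 : T2 -> nat) : rooted r1 par1 h1 -> rooted r2 par2 h2 ->
    connected_set [set: T1] -> connected_set [set: T2] ->
    (forall v, connected_set [set n | v \in B1 n]) ->
    (forall v, connected_set [set n | v \in B2 n]) ->
    (forall v n1 n2, v \in B1 n1 -> v \in B2 n2 -> v \in B1 r1 /\ v \in B2 r2) ->
  exists (T : sgraph) (r : T) (B : T -> {set G}) (par : T -> T) (h : T -> nat),
    [/\ rooted r par h, connected_set [set: T] /\ B r = B1 r1,
      forall n, (exists n1, B n = B1 n1) \/ (exists n2, B n = B2 n2),
      (forall n1, exists n, B n = B1 n1) /\ (forall n2, exists n, B n = B2 n2)
    & forall v, connected_set [set n | v \in B n]].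
  move=> [hr1 e1] [hr2 e2] cT1 cT2 c1 c2 hB.
  pose T := attach r1 r2.
  pose B (n : T) := match n with inl a => B1 a | inr b => B2 b end.
  pose par (n : T) : T := match n with
    inl a => inl (par1 a) | inr b => if b == r2 then inl r1 else inr (par2 b) end.
  pose h (n : T) := match n with inl a => h1 a | inr b => (h2 b).+1 end.
  exists T, (inl r1), B, par, h; split.
  - split=> //; case=> a [] b /=.
    + by case/e1 => -[<- lt]; [left|right].
    + by case/andP=> /eqP-> /eqP->; right; rewrite eqxx hr1.
    + by case/andP=> /eqP-> /eqP->; left; rewrite eqxx hr1.
    + case/e2 => -[<- lt]; [left|right]; case: eqP => [e|_]; try by split.
        by rewrite e hr2 in lt.
      by rewrite e hr2 in lt.
  - split=> //; apply: (attach_connected cT1 cT2) => [_ _|a|b]; rewrite ?inE //.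
  - by case=> [a|b]; [left; exists a|right; exists b].
  - by split=> n; [exists (inl n)|exists (inr n)].
  - move=> v; apply: (attach_connected (c1 v) (c2 v)) => [|a|b]; rewrite ?inE //.
    by move=> /set0Pn[n1 + ] /set0Pn[n2]; rewrite !inE => v1 v2; apply: hB v1 v2.
elim: t => // b t1 IH1 t2 IH2 [v1 v2 h1 h2 h12] _.
have bagv t n (B : n -> {set G}) (hB : forall k, B k \in bags t) k v : v \in B k -> v \in verts t.
  by apply: bag_verts.
have [T1 [r1 [B1 [p1 [g1 [R1 [c1 e1] i1 o1 q1]]]]]] : exists (T : sgraph) (r : T)
    (B : T -> {set G}) (par : T -> T) (h : T -> nat), [/\ rooted r par h, connected_set [set: T] /\ B r = b,
      forall n, B n \in b :: bags t1, forall c, c \in b :: bags t1 -> exists n, B n = c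
    & forall v, connected_set [set n | v \in B n]].
  pose Bp (_ : point_graph) := b.
  have Rp : @rooted point_graph tt id (fun=> 0) by split.
  have cp : connected_set [set: point_graph] by move=> [] [] _ _; exact: connect0.
  have qp v : connected_set [set n | v \in Bp n] by move=> [] [] _ _; exact: connect0.
  case: t1 IH1 v1 h1 h12 => [|b1 u1 u2] IH1 v1 h1 h12.
    exists point_graph, tt, Bp, id, (fun=> 0); split=> //.
      by move=> n; rewrite inE eqxx.
    by move=> c; rewrite inE => /eqP->; exists tt.
  have [|T [r [B [p [g [R [c e] i o q]]]]]] := IH1 v1 => //.
  have [|T' [r' [B' [p' [g' [R' [c' e'] i' o' q']]]]]] :=
    join point_graph T tt r Bp B id (fun=> 0) p g Rp R cp c qp q.
    move=> v [] n vb vn; split=> //; rewrite e; apply: (subsetP h1).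
    by rewrite inE (vb : v \in b) andbT; exact: (bagv _ _ B i n v vn).
  exists T', r', B', p', g'; split=> //.
  - move=> n; rewrite inE; case: (i' n) => -[m ->]; first by rewrite eqxx.
    by rewrite i orbT.
  - move=> d; rewrite inE => /orP[/eqP->|/o[m <-]]; first by have [n] := o'.1 tt; exists n.
    by have [n] := o'.2 m; exists n.
case: t2 IH2 v2 h2 h12 => [|b2 u1 u2] IH2 v2 h2 h12.
  by exists T1, r1, B1, p1, g1; rewrite /= cats0.
have [|T [r [B [p [g [R [c e] i o q]]]]]] := IH2 v2 => //.
have [|T' [r' [B' [p' [g' [R' [c' e'] i' o' q']]]]]] := join T1 T r1 r B1 B _ _ _ _ R1 R c1 c q1 q.
  move=> v n1 n vn1 vn; have vV : v \in verts (Node b2 u1 u2) by exact: (bagv _ _ B i n v vn).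
  have vb : v \in b.
    have := i1 n1; rewrite inE => /orP[/eqP <- //|m1]; apply: (subsetP h12).
    by rewrite inE vV andbT; apply: bag_verts m1 vn1.
  rewrite e1 e; split=> //; apply: (subsetP h2); by rewrite inE vV.
exists T', r', B', p', g'; rewrite e' e1; split=> //.
- move=> n; rewrite [bags _]/= -cat_cons mem_cat; case: (i' n) => -[m ->]; first by rewrite i1.
  by rewrite i orbT.
- move=> d; rewrite [bags _]/= -cat_cons mem_cat => /orP[/o1[m <-]|/o[m <-]].
    by have [n] := o'.1 m; exists n.
  by have [n] := o'.2 m; exists n.
Qed.

Lemma treewidth_le (G : sgraph) (t : dtree G) K : valid t -> verts t = [set: G] ->
    (forall u v, edge u v -> exists2 b, b \in bags t & (u \in b) && (v \in b)) ->
    (forall b, b \in bags t -> #|b| <= K.+1) -> t <> Leaf -> treewidth G <= K.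
Proof.
move=> vt Vt et le /(realize vt)[T [r [B [par [h [R [cT _] iB oB cB]]]]]].
rewrite /treewidth; case: ex_minnP => m _ /(_ (width B)) min.
apply: leq_trans (min _) _; last first.
  rewrite /width; case: (\max_t _) (@bigmax_leqP T xpredT K.+1 (fun t => #|B t|)) => //= k H.
  by have /H : forall i, true -> #|B i| <= K.+1 by move=> i _; apply: le.
apply/asboolP; exists T, B; split=> //; split=> //.
- split=> //; first by apply/card_gt0P; exists r.
  by move=> c; apply: rooted_acyclic R.
- move=> v; have : v \in verts t by rewrite Vt inE.
  by case/vertsP=> b /oB[n <-] vb; exists n.
- by move=> u v /et[b /oB[n <-] uv]; exists n.
Qed.

(** * Brambles without small covers are the only obstruction to small treewidth *)

Section Transfer.
Variables (G : sgraph) (C X b0 : {set G}).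
Hypothesis dCX : [disjoint C & X].
Implicit Types (t : dtree G) (b V W : {set G}).

(** The tree-decomposition that [t] induces on [C :|: X], with the vertices of [X]
pushed up to the root bag [b0], so that the new root bag is [X]. *)
Fixpoint transfer t : dtree G :=
  if t is Node b t1 t2 then
    Node ((b :&: C) :|: (X :&: verts t)) (transfer t1) (transfer t2)
  else Leaf.

Lemma verts_transfer t : verts (transfer t) = verts t :&: (C :|: X).
Proof.
elim: t => [|b t1 IH1 t2 IH2] /=; first by rewrite set0I.
rewrite IH1 IH2; apply/setP => v; rewrite !inE.
by case: (v \in b); case: (v \in C); case: (v \in X); case: (v \in verts t1);
  case: (v \in verts t2).
Qed.

Lemma root_transfer t v : v \in verts t -> v \in C :|: X ->
  (v \in C -> v \in root_bag t) -> v \in root_bag (transfer t).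
Proof.
case: t => [|b t1 t2]; first by rewrite /= inE.
move=> vV vCX h; rewrite [root_bag _]/= in_setU !in_setI vV andbT.
by move: vCX; rewrite in_setU => /orP[vC|->]; rewrite ?orbT // h ?vC.
Qed.

Lemma valid_transfer t : valid t -> valid (transfer t).
Proof.
elim: t => // b t1 IH1 t2 IH2 [v1 v2 /subsetP h1 /subsetP h2 /subsetP h12].
have child t' : {subset verts t' :&: b <= root_bag t'} ->
    verts (transfer t') :&: (b :&: C :|: X :&: verts (Node b t1 t2)) \subset root_bag (transfer t').
  move=> h; apply/subsetP => v; rewrite verts_transfer in_setI in_setI => /andP[/andP[vt vCX] vb].
  apply: root_transfer => // vC; apply: h; rewrite in_setI vt.
  by move: vb; rewrite in_setU !in_setI (disjointFr dCX vC) orbF => /andP[].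
split; [exact: IH1|exact: IH2|exact: child|exact: child|].
rewrite !verts_transfer; apply/subsetP => v; rewrite !in_setI => /andP[/andP[vt1 vCX] /andP[vt2 _]].
rewrite in_setU !in_setI h12 ?in_setI ?vt1 //=; move: vCX; rewrite in_setU => /orP[->//|->].
by rewrite !in_setU vt1 !orbT.
Qed.

Lemma transfer_edge t b u v : b \in bags t -> u \in b -> u \in C -> v \in b ->
  v \in C :|: X -> exists2 W, W \in bags (transfer t) & (u \in W) && (v \in W).
Proof.
elim: t => // b' t1 IH1 t2 IH2; rewrite inE mem_cat => bt ub uC vb vCX.
case/or3P: bt => [/eqP e|b1|b2].
- exists (b' :&: C :|: X :&: verts (Node b' t1 t2)); first by rewrite /= mem_head.
  have vV : v \in verts (Node b' t1 t2) by rewrite /= in_setU -e vb.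
  rewrite !in_setU !in_setI vV -e ub uC vb /= andbT.
  by move: vCX; rewrite in_setU.
- by have [W W1 uv] := IH1 b1 ub uC vb vCX; exists W; rewrite // inE mem_cat W1 orbT.
- by have [W W2 uv] := IH2 b2 ub uC vb vCX; exists W; rewrite // inE mem_cat W2 !orbT.
Qed.

(** [t] is a subtree of a tree-decomposition whose root bag is [b0]. *)
Definition anchored t := {subset b0 :&: verts t <= root_bag t} /\
  forall u v, u \in verts t -> u \notin root_bag t -> edge u v ->
    exists2 b, b \in bags t & (u \in b) && (v \in b).

Lemma anchored_left b t1 t2 : valid (Node b t1 t2) -> anchored (Node b t1 t2) -> anchored t1.
Proof.
move=> [_ _ /subsetP h1 _ /subsetP h12] [a1 a2]; split=> [v|u v u1 ur uv].
  rewrite in_setI => /andP[v0 v1]; apply: h1; rewrite in_setI v1 /=.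
  by apply: a1; rewrite in_setI v0 /= !in_setU v1 !orbT.
have ub : u \notin b by apply: contra ur => ub; apply: h1; rewrite in_setI u1.
have [|c] := a2 u v _ ub uv; first by rewrite /= !in_setU u1 !orbT.
rewrite inE mem_cat => /or3P[/eqP->|c1|c2] /andP[uc vc]; first by rewrite uc in ub.
  by exists c; rewrite // uc.
by case/negP: ub; apply: h12; rewrite in_setI u1 (bag_verts c2 uc).
Qed.

Lemma anchored_right b t1 t2 : valid (Node b t1 t2) -> anchored (Node b t1 t2) -> anchored t2.
Proof.
move=> vt [a1 a2]; apply: (anchored_left (valid_swap vt)); split=> [v|u v uV ur uv].
  by rewrite /= [verts t2 :|: _]setUC; apply: a1.
have [|c cb cuv] := a2 u v _ ur uv; first by move: uV; rewrite /= [verts t2 :|: _]setUC.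
by exists c => //; move: cb; rewrite /= !inE !mem_cat [(c \in bags t2) || _]orbC.
Qed.

Variables (BB : {set {set G}}) (K : nat) (p : G -> seq G).
Hypothesis conn : forall B, B \in BB -> connected_set B.
Hypothesis meet0 : forall B, B \in BB -> ~~ [disjoint B & b0].
Hypothesis XK : #|X| <= K.
Hypothesis pP : forall x, x \in X -> [/\ path (@edge G) x (p x), last x (p x) \in b0
  & {in p x, forall v, v \notin C :|: X}].
Hypothesis pD : forall x y v, x \in X -> y \in X -> v \in p x -> v \in p y -> x = y.

(** A bag that is replaced does not become larger: the vertices of [X] that it
receives are separated from the root bag by the old bag, which therefore contains
a vertex of each of the disjoint paths starting at them. *)
Lemma card_transfer b t1 t2 : anchored (Node b t1 t2) ->
  #|b :&: C :|: X :&: verts (Node b t1 t2)| <= #|b|.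
Proof.
set V := verts _ => -[a1 a2]; pose N := (X :&: V) :\: b.
have hit x : x \in N -> exists v, (v \in p x) && (v \in b).
  rewrite in_setD in_setI => /and3P[xb xX xV]; have [px lx _] := pP xX.
  apply: contrapT => no; have nob v : v \in p x -> v \notin b.
    by move=> vp; apply/negP => vb; apply: no; exists v; rewrite vp.
  have : last x (p x) \in V :\: b.
    have : x \in V :\: b by rewrite in_setD xb.
    move: (p x) px nob => s0 px nob.
    elim: s0 x px nob {xb xX xV lx no} => //= y s IH x /andP[xy ys] nob.
    rewrite in_setD => /andP[xb xV]; apply: IH => // [v vs|].
      by apply: nob; rewrite inE vs orbT.
    have [c cV /andP[xc yc]] := a2 x y xV xb xy.
    by rewrite in_setD nob ?mem_head // /V (bag_verts cV yc).
  by rewrite in_setD => /andP[lb lV]; case/negP: lb; apply: a1; rewrite in_setI lx.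
pose g x := if [pick v | (v \in p x) && (v \in b)] is Some v then v else x.
have gP x : x \in N -> (g x \in p x) && (g x \in b).
  move=> /hit[v vp]; rewrite /g; case: pickP => [w //|/(_ v)]; by rewrite vp.
have NX x : x \in N -> x \in X by rewrite in_setD in_setI => /and3P[].
have cN : #|N| <= #|(b :\: C) :\: X|.
  rewrite -(card_in_imset (f := g) (D := N)); last first.
    move=> x y xN yN e; have /andP[gx _] := gP x xN; have /andP[gy _] := gP y yN.
    by apply: (pD (NX _ xN) (NX _ yN) gx); rewrite e.
  apply: subset_leq_card; apply/subsetP => _ /imsetP[x xN ->].
  have /andP[gx gb] := gP x xN; have [_ _ /(_ _ gx)] := pP (NX _ xN).
  by rewrite in_setU negb_or !in_setD gb => /andP[-> ->].
rewrite -(cardsID C b) -(cardsID X (b :\: C)).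
have sub : b :&: C :|: X :&: V \subset (b :&: C) :|: ((b :\: C) :&: X :|: N).
  apply/subsetP => v; rewrite /N; rewrite !inE.
  case vX: (v \in X); rewrite ?andbF ?orbF /=; last by move=> ->.
  by rewrite (disjointFl dCX vX) /=; case: (v \in b) => //= ->.
apply: leq_trans (subset_leq_card sub) _.
apply: leq_trans (leq_card_setU _ _) _; rewrite leq_add2l.
by apply: leq_trans (leq_card_setU _ _) _; rewrite leq_add2l.
Qed.

(** A large new bag comes from a large old bag, which avoids some element of the larger
bramble; this is not [C], because the new bag is too large to lie in [X]. It also
avoids what the new bag took from [X]: as it meets the root bag, it could reach the
subtree below the old bag only through that bag. *)
Lemma transfer_large t : valid t -> anchored t ->
    (forall b, b \in bags t -> K < #|b| -> exists2 B, B \in C |: BB & [disjoint B & b]) ->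
  forall W, W \in bags (transfer t) -> K < #|W| -> exists2 B, B \in BB & [disjoint B & W].
Proof.
elim: t => // b t1 IH1 t2 IH2 vt at_ good W; rewrite inE mem_cat.
have [v1 v2 _ _ _] := vt; case/or3P=> [/eqP->|W1|W2]; last first.
- apply: IH2 W2 => //; first exact: anchored_right vt at_.
  by move=> c c2; apply: good; rewrite inE mem_cat c2 !orbT.
- apply: IH1 W1 => //; first exact: anchored_left vt at_.
  by move=> c c1; apply: good; rewrite inE mem_cat c1 orbT.
set V := verts _ => big; have [a1 a2] := at_.
have [|B BC dB] := good b (mem_head _ _); first exact: leq_trans big (card_transfer at_).
have BBB : B \in BB.
  move: BC; rewrite in_setU1 => /orP[/eqP BC|//]; move: big; rewrite ltnNge => /negP[].
  apply: leq_trans XK; apply: subset_leq_card; apply/subsetP => v.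
  rewrite in_setU !in_setI => /orP[/andP[vb vC]|/andP[]//].
  by rewrite -BC (disjointFl dB vb) in vC.
exists B => //; apply/pred0P => z /=; apply/negP => /andP[zB zW].
have zb : z \notin b by rewrite (disjointFr dB zB).
have zV : z \in V.
  by move: zW; rewrite in_setU !in_setI (negPf zb) /= => /andP[].
have /pred0Pn[y /andP[/= yB y0]] := meet0 BBB.
have yN : y \notin V :\: b.
  rewrite in_setD negb_and negbK; apply/orP; case: (boolP (y \in V)) => yV; [left|by right].
  by apply: a1; rewrite in_setI y0.
have zN : z \in V :\: b by rewrite in_setD zb.
have [u [v [/setIP[uB uN] /setDP[vB vN] uv _]]] := connected_exit (conn BBB) zB yB zN yN.
move: uN; rewrite in_setD => /andP[ub uV].
have [c cV /andP[uc vc]] := a2 u v uV ub uv.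
by rewrite in_setD (bag_verts cV vc) (disjointFr dB vB) in vN.
Qed.

End Transfer.

Section Duality.
Variables (G : sgraph) (K : nat).
Hypothesis cover : forall BB : {set {set G}}, bramble BB ->
  exists2 X : {set G}, #|X| <= K & forall b, b \in BB -> ~~ [disjoint b & X].

Definition edges_covered (t : dtree G) (P : {set G}) := forall u v, edge u v ->
  u \in P -> exists2 b, b \in bags t & (u \in b) && (v \in b).

Definition large_bags_avoid (t : dtree G) (BB : {set {set G}}) :=
  forall b, b \in bags t -> K < #|b| -> exists2 B, B \in BB & [disjoint B & b].

Lemma component_eq (S : {set G}) c v : v \in component S c -> component S v = component S c.
Proof.
rewrite inE => cv; apply/setP => w; rewrite !inE; apply/idP/idP; last first.
  by apply: connect_trans; rewrite inside_csym.
exact: connect_trans.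
Qed.

Lemma component_edge (X : {set G}) c u v : u \in component (~: X) c -> edge u v -> u \notin X ->
  v \in component (~: X) c :|: X.
Proof.
rewrite !inE => cu uv uX; case: (boolP (v \in X)) => vX; rewrite ?orbT // orbF.
by apply: (connect_trans cu); apply: connect_edge; rewrite ?inE.
Qed.

Lemma glue_components (X : {set G}) (BB : {set {set G}}) (Cs : seq {set G}) : #|X| <= K ->
    uniq Cs -> (forall C, C \in Cs -> exists2 c, c \notin X & C = component (~: X) c) ->
    (forall C, C \in Cs -> exists t : dtree G, [/\ valid t, root_bag t = X,
      verts t = X :|: C, edges_covered t C & large_bags_avoid t BB]) ->
  exists t : dtree G, [/\ valid t, root_bag t = X /\ X \in bags t, verts t = X :|: \bigcup_(C <- Cs) C,
    edges_covered t (\bigcup_(C <- Cs) C) & large_bags_avoid t BB].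
Proof.
move=> XK; elim: Cs => [_ _ _|C Cs IH /= /andP[CCs uCs] comp trees].
  exists (Node X Leaf Leaf); rewrite big_nil; split=> //=.
  - by split=> //; rewrite set0I sub0set.
  - by rewrite mem_head.
  - by rewrite setU0.
  - by move=> u v _; rewrite inE.
  - by move=> b; rewrite inE => /eqP->; rewrite ltnNge XK.
have tl C' : C' \in Cs -> C' \in C :: Cs by rewrite inE => ->; rewrite orbT.
have [t [vt [rt bt] Vt et lt]] := IH uCs (fun C' h => comp C' (tl C' h)) (fun C' h => trees C' (tl C' h)).
have [t1 [vt1 rt1 Vt1 et1 lt1]] := trees C (mem_head _ _).
exists (Node X t1 t); rewrite big_cons; split.
- split=> //; rewrite ?rt1 ?rt ?subsetIr // Vt1 Vt -setUIr subUset subxx /=.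
  apply/subsetP => v; rewrite in_setI => /andP[vC]; rewrite big_seq => vCs.
  have [C' C's vC'] : exists2 C', C' \in Cs & v \in C'.
    move: vCs; elim/big_ind: _ => [|A B hA hB|C' C's vC']; first by rewrite inE.
      by case/setUP.
    by exists C'.
  have [c _ Cc] := comp C (mem_head _ _); have [c' _ Cc'] := comp C' (tl _ C's).
  rewrite Cc in vC; rewrite Cc' in vC'.
  have CC : C' = C by rewrite Cc Cc' -(component_eq vC) -(component_eq vC').
  by rewrite -CC C's in CCs.
- by rewrite /= mem_head.
- by rewrite /= Vt1 Vt; apply/setP => v; rewrite !inE; case: (v \in X); rewrite //= ?orbT.
- move=> u v uv /setUP[uC|uU].
    by have [b b1 buv] := et1 u v uv uC; exists b; rewrite // inE mem_cat b1 orbT.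
  by have [b b1 buv] := et u v uv uU; exists b; rewrite // inE mem_cat b1 !orbT.
- move=> b; rewrite inE mem_cat => /or3P[/eqP->|/lt1//|/lt//].
  by rewrite ltnNge XK.
Qed.

(** Larger brambles are treated first. A smallest cover [X] of the bramble
separates the graph into components; for a component [C] that can be added to the
bramble, the tree obtained for the larger bramble is re-rooted at a large bag that
covers the smaller one and transferred to [C :|: X]. *)
Lemma tree_avoiding_bramble n (BB : {set {set G}}) : #|~: BB| < n -> bramble BB ->
  exists t : dtree G, [/\ valid t, t <> Leaf, verts t = [set: G], edges_covered t [set: G]
    & large_bags_avoid t BB].
Proof.
elim: n BB => // n IH BB BBn br; have [nz cn tch] := br.
have [X0 X0K X0cov] := cover br.
pose P (X : {set G}) := [forall b in BB, ~~ [disjoint b & X]].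
have P0 : P X0 by apply/forall_inP.
case: (@arg_minnP _ X0 P (fun X => #|X|) P0) => X /forall_inP Xcov Xmin.
have XK : #|X| <= K by apply: leq_trans (Xmin _ P0) X0K.
have Xnot (S : {set G}) : #|S| < #|X| -> exists2 B, B \in BB & [disjoint B & S].
  move=> SX; have : ~~ P S by apply: contraL SX => /Xmin; rewrite -leqNgt.
  by rewrite /P negb_forall_in => /exists_inP[B BBB]; rewrite negbK; exists B.
apply: contrapT => nogood.
have tree C : (exists2 c, c \notin X & C = component (~: X) c) ->
  exists t : dtree G, [/\ valid t, root_bag t = X, verts t = X :|: C,
    edges_covered t C & large_bags_avoid t BB].
  move=> [c cX eC]; have cC : connected_set C by rewrite eC; apply: component_connected.
  have cX' : c \in ~: X by rewrite inE.
  have Cc : c \in C by rewrite eC inE connect0.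
  have dCX : [disjoint C & X].
    by rewrite disjoints_subset eC; apply: component_sub.
  have Cout u v : u \in C -> edge u v -> v \in C :|: X.
    move=> uC uv; have uX : u \notin X by rewrite (disjointFr dCX uC).
    by rewrite eC; apply: component_edge uv uX; rewrite -eC.
  have [brC|nbr] := pselect (bramble (C |: BB)); last first.
    (* the bag around [C] misses an element that [C] does not touch *)
    have [B BBB nt] : exists2 B, B \in BB & ~~ touch B C.
      apply: contrapT => no; have all_t B : B \in BB -> touch B C.
        by move=> BBB; apply: contraT => nt; case: no; exists B.
      apply: nbr; split.
      - by move=> b /setU1P[->|/nz//]; apply/set0Pn; exists c.
      - by move=> b /setU1P[->//|/cn].
      - have ts A B : touch A B = touch B A by rewrite /touch setIC adj_sym.
        move=> a b /setU1P[->|aB] /setU1P[->|bB].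
        + by apply/orP; left; rewrite setIid; apply/set0Pn; exists c.
        + by rewrite ts; apply: all_t.
        + exact: all_t.
        + exact: tch.
    pose b := C :|: [set v in X | adj C [set v]].
    exists (Node X (Node b Leaf Leaf) Leaf); split.
    - by split=> //=; rewrite ?set0I ?setI0 ?sub0set // ?setU0 ?subsetIl //; split; rewrite // set0I sub0set.
    - by [].
    - by rewrite /= !setU0; apply/setP => v; rewrite !inE; case: (v \in X); rewrite ?andbF ?orbF.
    - move=> u v uv uC; exists b; first by rewrite /= !inE eqxx orbT.
      rewrite /b !in_setU uC /=; have := Cout u v uC uv; rewrite in_setU => /orP[->//|vX].
      rewrite in_set vX (_ : adj _ _) ?orbT //; apply/adjP; exists u, v.
      by rewrite set11.
    - move=> b'; rewrite /= !inE => /orP[/eqP->|/eqP->]; first by rewrite ltnNge XK.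
      move=> _; exists B => //; apply/pred0P => v /=; apply/negP => /andP[vB].
      move: nt; rewrite /touch negb_or negbK => /andP[/eqP BC nadj].
      rewrite in_setU in_set => /orP[vC|/andP[_ /adjP[u [w [uC /set1P -> uv]]]]].
        have : v \in B :&: C by rewrite in_setI vB.
        by rewrite BC inE.
      by case/negP: nadj; rewrite adj_sym; apply/adjP; exists u, v.
  have CBB : C \notin BB by apply/negP => /Xcov; rewrite dCX.
  have lt : #|~: (C |: BB)| < n.
    rewrite -ltnS; apply: leq_trans BBn; rewrite ltnS; apply: proper_card.
    rewrite properE setCS subsetUr /=; apply/negP => /subsetP/(_ C).
    by rewrite !inE CBB eqxx => /(_ isT).
  have [t [vt tne Vt et lbt]] := IH (C |: BB) lt brC.
  have [bb [bbt bbK bbcov]] : exists b, [/\ b \in bags t, K < #|b|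
      & forall B, B \in BB -> ~~ [disjoint B & b]].
    apply: contrapT => no; apply: nogood; exists t; split=> // b bt bK.
    apply: contrapT => noB; apply: no; exists b; split=> // B BBB.
    by apply/negP => dB; apply: noB; exists B.
  have dC : [disjoint C & bb].
    have [B /setU1P[-> //|BBB] dB] := lbt bb bbt bbK.
    by have := bbcov B BBB; rewrite dB.
  have [u1 [u2 [vu uE]]] := reroot vt bbt.
  set t' := Node bb u1 u2 in vu uE.
  have Vt' : verts t' = [set: G].
    apply/setP => v; rewrite in_setT; apply/vertsP.
    have : v \in verts t by rewrite Vt inE.
    by case/vertsP=> b bt vb; exists b; rewrite ?uE.
  have et' u v : edge u v -> exists2 b, b \in bags t' & (u \in b) && (v \in b).
    by move=> uv; have [b bt buv] := et u v uv (in_setT u); exists b; rewrite ?uE.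
  (* the relation forbids a return to [X], so that the paths avoid [C] as well *)
  pose e : rel G := fun u v => (v \notin X) && edge u v.
  have [S SX|p [pP pD]] := @menger_all _ e X bb.
    have [B BBB dBS] := Xnot S SX.
    have /pred0Pn[x /andP[/= xB xX]] := Xcov B BBB.
    have /pred0Pn[y /andP[/= yB yb]] := bbcov B BBB.
    have [q [pq lq uq sq]] := connected_simple (cn B BBB) xB yB.
    have hX : has (mem X) (x :: q) by rewrite /= xX.
    have [s1 [z [s2 [es zX ns2]]]] := split_last hX.
    have lz : last z s2 = y by rewrite -lq -[RHS](last_cons z) es last_cat.
    have pz : path (@edge G) z s2.
      case: s1 es => [[<- <-//]|z' s1 [_ ep]].
      by move: pq; rewrite ep cat_path /= => /and3P[].
    have pe : path e z s2.
      elim: s2 (z) pz ns2 {es lz} => //= a s2 IHs z' /andP[za pa].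
      by rewrite negb_or => /andP[aX ns2]; rewrite /e aX za; apply: IHs.
    have [|q' [q'P qs]] := @walk_abpath _ e X bb z s2 zX pe; first by rewrite lz.
    exists z, q'; split=> // v /qs vq; rewrite (disjointFr dBS) //; apply: sq.
    by rewrite es mem_cat vq orbT.
  have pP' x : x \in X -> [/\ path (@edge G) x (p x), last x (p x) \in bb
      & {in p x, forall v, v \notin C :|: X}].
    move=> xX; have [_ px lx _] := pP x xX; split=> //.
      by apply: sub_path px => u v /andP[].
    move: (p x) px lx => s0 px lx.
    elim: s0 x px lx {xX} => //= y s IHs w /andP[/andP[yX wy] ys] lx v.
    rewrite inE => /orP[/eqP->|vs]; last exact: IHs ys lx v vs.
    rewrite in_setU negb_or yX andbT; apply/negP => yC.
    have : last y s \in C.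
      elim: s y ys yC {IHs lx yX wy} => //= a s IHs y /andP[/andP[aX ya] pa] yC.
      apply: IHs pa _; have := Cout y a yC ya; by rewrite in_setU (negPf aX) orbF.
    by rewrite (disjointFl dC lx).
  have pD' x y v : x \in X -> y \in X -> v \in p x -> v \in p y -> x = y.
    by move=> xX yX vx vy; apply: (pD x y v xX yX); rewrite inE ?vx ?vy orbT.
  exists (transfer C X t'); split.
  - exact: valid_transfer.
  - have -> : root_bag (transfer C X t') = bb :&: C :|: X :&: verts t' by [].
    rewrite Vt' setIT (_ : bb :&: C = set0) ?set0U //.
    by apply/eqP; rewrite setI_eq0 disjoint_sym.
  - by rewrite verts_transfer Vt' setTI setUC.
  - move=> u v uv uC; have [b bt /andP[ub vb]] := et' u v uv.
    exact: (transfer_edge bt ub uC vb (Cout u v uC uv)).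
  - apply: (transfer_large dCX cn bbcov XK pP' pD' vu) => [|b].
      split=> [v|u v _ _]; last exact: et'.
      by rewrite in_setI => /andP[].
    by rewrite uE; apply: lbt.
have [C|C|t [vt [rt bt] Vt et lt]] :=
  @glue_components X BB (enum [set component (~: X) c | c in ~: X]) XK (enum_uniq _).
- by rewrite mem_enum => /imsetP[c]; rewrite inE => cX ->; exists c.
- rewrite mem_enum => /imsetP[c cX eC]; apply: tree; exists c => //.
  by rewrite inE in cX.
have inU v : v \notin X -> v \in \bigcup_(C <- enum [set component (~: X) c | c in ~: X]) C.
  move=> vX; rewrite big_enum /=; apply/bigcupP; exists (component (~: X) v).
    by apply: imset_f; rewrite inE.
  by rewrite inE connect0.
apply: nogood; exists t; split=> //.
- by move=> t0; rewrite t0 in bt.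
- apply/setP => v; rewrite Vt in_setT in_setU; case: (boolP (v \in X)) => //= vX.
  exact: inU.
- move=> u v uv _; have [uX|uX] := boolP (u \in X); last exact: et uv (inU u uX).
  have [vX|vX] := boolP (v \in X); first by exists X; rewrite ?uX.
  have [b bb buv] := et v u (etrans (edge_sym v u) uv) (inU v vX); exists b => //.
  by rewrite andbC.
Qed.

End Duality.

(** [tree_avoiding_bramble] for the empty bramble, where no bag can avoid an element
and hence all bags are small. *)
Theorem bramble_of_treewidth (G : sgraph) (K : nat) : K < treewidth G ->
  exists2 BB : {set {set G}}, bramble BB
    & forall Y : {set G}, #|Y| <= K.+1 -> exists2 b, b \in BB & [disjoint b & Y].
Proof.
move=> tw; apply: contrapT => no.
have cover (BB : {set {set G}}) : bramble BB ->
    exists2 X : {set G}, #|X| <= K.+1 & forall b, b \in BB -> ~~ [disjoint b & X].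
  move=> br; apply: contrapT => nc; apply: no; exists BB => // Y YK.
  apply: contrapT => nb; apply: nc; exists Y => // b bBB.
  by apply/negP => dis; apply: nb; exists b.
have br0 : bramble (set0 : {set {set G}}) by split=> [b|b|b c]; rewrite inE.
have [t [vt tne Vt et lt]] := tree_avoiding_bramble cover (ltnSn _) br0.
move: tw; rewrite ltnNge => /negP[]; apply: (treewidth_le vt Vt) => //.
  by move=> u v uv; apply: et uv (in_setT u).
by move=> b bt; rewrite leqNgt; apply/negP => /(lt b bt)[B]; rewrite inE.
Qed.

(** * Excluding twisted prisms and the grid *)

Theorem theorem1p7 (l : nat) (hl : 3 <= l) (G : sgraph)
    (hprism : forall s : {perm 'I_l}, ~ is_minor (twisted_prism s) G)
    (hgrid : ~ is_minor (grid 4 4) G) :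
  treewidth G <= 2 * l + 10.
Proof.
rewrite leqNgt; apply/negP => /bramble_of_treewidth[BB br]; rewrite -addnS => large.
by case: (prism_or_grid_of_bramble hl br large) => [[s /hprism]|/hgrid].
Qed.
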